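(* Let $\Omega\subset\mathbb{R}^3$ be open, $C^2$-smooth and such that $\mathbb{R}^3\setminus\Omega$ is bounded, and let $\mathbf{D}^\Omega$ be the exterior MIT bag Dirac operator. Then every resonance $(\lambda,\kappa)$ of $\mathbf{D}^\Omega$ such that $\kappa\notin i(-\infty,0]$ has even multiplicity.
   Context: Notation: $\beta,\alpha_1,\alpha_2,\alpha_3\in\mathbb{C}^{4\times4}$ are the Dirac matrices (standard representation: $\beta=\mathrm{diag}(I_2,-I_2)$, $\alpha_j=\begin{pmatrix}0&\sigma_j\\ \sigma_j&0\end{pmatrix}$ with $\sigma_j$ the Pauli matrices) and $\alpha\cdot v=\sum_{j=1}^3\alpha_jv_j$. Function spaces on $\Omega$ are $\mathbb{C}^4$-valued. MIT bag operator: $n$ is the outward pointing unit normal to $\partial\Omega$ (outward from $\Omega$), $\psi_{|\partial\Omega}\in L^2(\partial\Omega)$ is the trace of $\psi\in H^1(\Omega)$, and $$\mathfrak{D}=\{\psi\in H^1(\Omega):\ (-i\beta\,\alpha\cdot n)\psi_{|\partial\Omega}=\psi_{|\partial\Omega}\}.$$ $\mathbf{D}^\Omega=\beta-i\alpha\cdot\nabla$ with domain $\mathfrak{D}$; it is known to be self-adjoint in $L^2(\Omega)$ with spectrum $(-\infty,-1]\cup[1,+\infty)$. Resonances: let $\mathcal{M}=\{(z,\omega)\in\mathbb{C}^2:\ \omega^2=z^2-1\}$ (a Riemann surface). It is known that there is a (unique) finite meromorphic function $\mathcal{R}$ (meromorphic, with finite-rank coefficients in the principal parts of its Laurent expansions)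 from $\mathcal{M}$ to $\mathcal{L}(L^2_{\mathrm{comp}}(\overline\Omega),\mathfrak{D}_{\mathrm{loc}})$ (where $\mathfrak{D}_{\mathrm{loc}}$ is the space of functions in $H^1_{\mathrm{loc}}(\overline\Omega)$ satisfying the boundary condition defining $\mathfrak{D}$) such that if $(z,\omega)\in\mathcal{M}$ and $\operatorname{Im}\omega>0$, then $(z,\omega)$ is not a pole of $\mathcal{R}$, $z\notin\operatorname{Sp}(\mathbf{D}^\Omega)$ and $\mathcal{R}(z,\omega)=(\mathbf{D}^\Omega-z)^{-1}$ on $L^2_{\mathrm{comp}}(\overline\Omega)$. A resonance of $\mathbf{D}^\Omega$ is a pole $(\lambda,\kappa)\in\mathcal{M}$ of $\mathcal{R}$; it is known that then $\kappa\neq0$, and its multiplicity is the rank of the residue of $\mathcal{R}$ at $(\lambda,\kappa)$ in any local chart near $(\lambda,\kappa)$ (for instance using $z$ as local coordinate). *)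

(* Defs.v *)
From HB Require Import structures.
From mathcomp Require Import all_boot all_order all_algebra.
From mathcomp Require Import all_classical all_reals all_analysis.
From mathcomp Require Import complex.
Set Implicit Arguments.
Unset Strict Implicit.
Unset Printing Implicit Defensive.
Import Order.TTheory GRing.Theory Num.Theory.
Import numFieldNormedType.Exports.
Local Open Scope classical_set_scope.
Local Open Scope ring_scope.
Local Open Scope complex_scope.

(* The types [R * R] and [R * R * R] with the measurable structure carried by
   [lebesgue_measure]. *)
Notation space2 R := (measurableTypeR R * measurableTypeR R)%type.
Notation space3 R :=
  (measurableTypeR R * measurableTypeR R * measurableTypeR R)%type.

Definition spinor_field (R : realType) : Type := R * R * R -> 'cV[R[i]]_4.
Definition operator (R : realType) : Type := spinor_field R -> spinor_field R.

Section DiracMatrices.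
Context {R : realType}.

(* Inside products, ['i] would be parsed as the generic [Num.imaginary]. *)
Definition ii : R[i] := 0 +i* 1.

Definition mat2 (a b c d : R[i]) : 'M[R[i]]_2 :=
  \matrix_(k < 2, l < 2)
    (if k == 0 then if l == 0 then a else b else if l == 0 then c else d).

Definition pauli (j : 'I_3) : 'M[R[i]]_2 :=
  match val j with
  | 0%N => mat2 0 1 1 0
  | 1%N => mat2 0 (- ii) ii 0
  | _ => mat2 1 0 0 (- 1)
  end.

Definition alpha (j : 'I_3) : 'M[R[i]]_4 :=
  (block_mx 0 (pauli j) (pauli j) 0 : 'M[R[i]]_(2 + 2)).

Definition beta : 'M[R[i]]_4 :=
  (block_mx 1%:M 0 0 (- 1%:M) : 'M[R[i]]_(2 + 2)).

End DiracMatrices.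

Section Space.
Context {R : realType}.

Definition coord3 (j : 'I_3) (x : R * R * R) : R :=
  match val j with 0%N => x.1.1 | 1%N => x.1.2 | _ => x.2 end.

(* The two coordinates of [x] other than the [j]-th one, in increasing order. *)
Definition others (j : 'I_3) (x : R * R * R) : R * R :=
  match val j with
  | 0%N => (x.1.2, x.2) | 1%N => (x.1.1, x.2) | _ => (x.1.1, x.1.2)
  end.

(* The point [x] with [others j x = y] and [coord3 j x = t]. *)
Definition insert (j : 'I_3) (y : R * R) (t : R) : R * R * R :=
  match val j with
  | 0%N => (t, y.1, y.2) | 1%N => (y.1, t, y.2) | _ => (y.1, y.2, t)
  end.

Definition unit_vec (j : 'I_3) : R * R * R := insert j (0, 0) 1.

Definition dot_alpha (v : R * R * R) : 'M[R[i]]_4 :=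
  \sum_(j < 3) (coord3 j v)%:C *: alpha j.

Definition leb2 : {measure set (space2 R) -> \bar R} :=
  (@lebesgue_measure R \x @lebesgue_measure R)%E.

Definition leb3 : {measure set (space3 R) -> \bar R} :=
  ((@lebesgue_measure R \x @lebesgue_measure R) \x @lebesgue_measure R)%E.

(* All directional derivatives are required, not only those along a basis; on
   a finite-dimensional space this is the usual notion. *)
Fixpoint Ck {V : normedModType R} (n : nat) (f : V -> R) : Prop :=
  match n with
  | 0%N => continuous f
  | n'.+1 => continuous f /\
      forall v : V, (forall x, derivable f x v) /\ Ck n' (fun x => 'D_v f x)
  end.

Definition smooth {V : normedModType R} (f : V -> R) : Prop :=
  forall n, Ck n f.

Definition test_function {V : normedModType R} (U : set V) (f : V -> R)
    : Prop :=
  [/\ smooth f, compact (closure [set x | f x != 0])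
    & closure [set x | f x != 0] `<=` U].

Definition test_field (f : spinor_field R) : Prop :=
  forall i, test_function setT (fun x => complex.Re (f x i 0)) /\
            test_function setT (fun x => complex.Im (f x i 0)).

End Space.

Section Domain.
Context {R : realType}.
Implicit Types (Omega U : set (R * R * R)) (k : 'I_3) (s : bool)
  (gamma : R * R -> R).

Definition bdry Omega : set (R * R * R) := closure Omega `\` interior Omega.

(* Inside the open set [U], [Omega] is the side x_k > gamma (if [s] is false)
   or x_k < gamma (if [s] is true) of the graph of the C^2 function [gamma] of
   the two coordinates other than x_k. *)
Definition graph_chart Omega U k s gamma : Prop :=
  [/\ open U, Ck 2 gamma &
      Omega `&` U =
      U `&` [set x | 0 < (-1) ^+ s * (coord3 k x - gamma (others k x))]].

Definition C2_domain Omega : Prop :=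
  open Omega /\
  forall x, bdry Omega x ->
    exists U k s gamma, U x /\ graph_chart Omega U k s gamma.

Definition grad2 gamma (y : R * R) : R * R :=
  ('D_((1 : R), (0 : R)) gamma y, 'D_((0 : R), (1 : R)) gamma y).

Definition area_density gamma (y : R * R) : R :=
  Num.sqrt (1 + (grad2 gamma y).1 ^+ 2 + (grad2 gamma y).2 ^+ 2).

(* [sigma] is carried by the boundary and is given there, in every graph chart,
   by the area element sqrt(1 + |grad gamma|^2) dy; for a C^2 domain this
   determines [sigma]. *)
Definition surface_measure Omega
    (sigma : {measure set (space3 R) -> \bar R}) : Prop :=
  sigma (~` bdry Omega) = 0%E /\
  forall U k s gamma, graph_chart Omega U k s gamma ->
    forall A : set (space3 R), measurable A -> A `<=` U ->
      sigma A = (\int[leb2]_(y in [set y | A (insert k y (gamma y))])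
                   (area_density gamma y)%:E)%E.

(* [v] is the unit normal at the boundary point [x] pointing out of [Omega]. *)
Definition outward_normal Omega (x v : R * R * R) : Prop :=
  exists U k s gamma, [/\ U x, graph_chart Omega U k s gamma &
    v = ((-1) ^+ s / area_density gamma (others k x)) *:
        insert k (grad2 gamma (others k x)) (-1)].

End Domain.

(* Elements of function spaces are represented by functions on R^3, of which
   only the values on the domain matter, and are identified when they agree
   almost everywhere there. *)

Section Spaces.
Context {R : realType}.
Variable Omega : set (R * R * R).
Implicit Types (f g u : spinor_field R)
  (mu : {measure set (space3 R) -> \bar R}) (D : set (space3 R)).

Definition normsq (w : 'cV[R[i]]_4) : R :=
  \sum_(i < 4) (complex.Re (w i 0) ^+ 2 + complex.Im (w i 0) ^+ 2).

Definition L2normsq mu D f : \bar R :=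
  (\int[mu]_(x in D) (normsq (f x))%:E)%E.

Definition L2 mu D f : Prop :=
  (forall i, measurable_fun D (fun x => complex.Re (f x i 0)) /\
             measurable_fun D (fun x => complex.Im (f x i 0))) /\
  (L2normsq mu D f < +oo)%E.

Definition aeeq f g : Prop := {ae leb3, forall x, Omega x -> f x = g x}.

Definition cintegral (h : R * R * R -> R[i]) : R[i] :=
  Rintegral leb3 Omega (fun x => complex.Re (h x)) +i*
  Rintegral leb3 Omega (fun x => complex.Im (h x)).

(* [g] is the weak partial derivative of [f] along x_j in [Omega]. *)
Definition weak_partial (j : 'I_3) f g : Prop :=
  forall phi : R * R * R -> R, test_function Omega phi ->
  forall i, cintegral (fun x => f x i 0 * ('D_(unit_vec j) phi x)%:C) =
            - cintegral (fun x => g x i 0 * (phi x)%:C).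

Definition H1 f : Prop :=
  L2 leb3 Omega f /\
  forall j, exists g, L2 leb3 Omega g /\ weak_partial j f g.

(* A representative of the weak partial derivative, for [f] in H^1; the value 0
   it gets for other [f] is junk, and so is then [H1normsq f]. *)
Definition wpartial (j : 'I_3) f : spinor_field R :=
  xget (fun=> 0) [set g | L2 leb3 Omega g /\ weak_partial j f g].

Definition H1normsq f : \bar R :=
  (L2normsq leb3 Omega f + \sum_(j < 3) L2normsq leb3 Omega (wpartial j f))%E.

(* [g] is the trace of [f]: the trace map is the continuous extension to
   H^1(Omega) of the restriction to the boundary of functions of
   C_c^oo(R^3; C^4). *)
Definition trace (sigma : {measure set (space3 R) -> \bar R}) f g : Prop :=
  H1 f /\ L2 sigma (bdry Omega) g /\
  exists phi : nat -> spinor_field R,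
    [/\ forall n, test_field (phi n),
        H1normsq (fun x => phi n x - f x) @[n --> \oo] --> 0%E &
        L2normsq sigma (bdry Omega) (fun x => phi n x - g x)
          @[n --> \oo] --> 0%E].

End Spaces.

Section MITBag.
Context {R : realType}.
Variable Omega : set (R * R * R).
Variable sigma : {measure set (space3 R) -> \bar R}.
Implicit Types (f u : spinor_field R) (T : operator R).

(* [trace] includes membership in H^1(Omega). *)
Definition dom f : Prop :=
  exists g, trace Omega sigma f g /\
    {ae sigma, forall x, bdry Omega x -> forall v, outward_normal Omega x v ->
       ((- ii) *: (beta *m dot_alpha v)) *m g x = g x}.

Definition dirac u : spinor_field R := fun x =>
  beta *m u x - ii *: \sum_(j < 3) alpha j *m wpartial Omega j u x.

(* [T] is the bounded inverse (D - z)^{-1} of D - z : dom -> L^2(Omega). *)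
Definition resolvent (z : R[i]) T : Prop :=
  [/\ forall (c : R[i]) f g, L2 leb3 Omega f -> L2 leb3 Omega g ->
        aeeq Omega (T (fun x => c *: f x + g x)) (fun x => c *: T f x + T g x),
      exists C : R, forall f, L2 leb3 Omega f ->
        (L2normsq leb3 Omega (T f) <= C%:E * L2normsq leb3 Omega f)%E,
      forall f, L2 leb3 Omega f ->
        dom (T f) /\ aeeq Omega (fun x => dirac (T f) x - z *: T f x) f &
      forall u, dom u -> aeeq Omega (T (fun x => dirac u x - z *: u x)) u].

Definition spectrum : set R[i] := [set z | ~ exists T, resolvent z T].

Definition cutoff (chi : R * R * R -> R) f : spinor_field R :=
  fun x => (chi x)%:C *: f x.

Definition dom_loc f : Prop :=
  forall chi : R * R * R -> R, test_function setT chi -> dom (cutoff chi f).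

Definition L2_in (rho : R) f : Prop :=
  L2 leb3 Omega f /\
  {ae leb3, forall x, Omega x -> ~ ball (0 : R * R * R) rho x -> f x = 0}.

Definition L2comp f : Prop := exists rho : R, L2_in rho f.

(* [A] and [B] differ by at most [e] for the seminorm of
   L(L^2_comp, D_loc) attached to the ball of radius [rho] and the cutoff
   [chi]; norms being squared, so is [e]. *)
Definition op_close (rho : R) (chi : R * R * R -> R) (e : R)
    (A B : operator R) : Prop :=
  forall f, L2_in rho f ->
    (H1normsq Omega (cutoff chi (fun x => A f x - B f x)%R)
       <= e%:E * L2normsq leb3 Omega f)%E.

Definition continuous_operator (A : operator R) : Prop :=
  [/\ forall (c : R[i]) f g, L2comp f -> L2comp g ->
        aeeq Omega (A (fun x => c *: f x + g x)) (fun x => c *: A f x + A g x),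
      forall f, L2comp f -> dom_loc (A f) &
      forall rho (chi : R * R * R -> R), test_function setT chi ->
        exists C : R, op_close rho chi C A (fun _ _ => 0)].

Definition zero_operator (A : operator R) : Prop :=
  forall f, L2comp f -> aeeq Omega (A f) (fun=> 0).

Definition has_rank (A : operator R) (m : nat) : Prop :=
  exists f : 'I_m -> spinor_field R,
    [/\ forall i, L2comp (f i),
        forall c : 'I_m -> R[i],
          aeeq Omega (fun x => \sum_(i < m) c i *: A (f i) x) (fun=> 0) ->
          forall i, c i = 0 &
        forall h, L2comp h -> exists c : 'I_m -> R[i],
          aeeq Omega (A h) (fun x => \sum_(i < m) c i *: A (f i) x)].

Definition surfM : set (R[i] * R[i]) := [set p | p.2 ^+ 2 = p.1 ^+ 2 - 1].

(* Local coordinate of M centered at [p], evaluated at [q]: z - z(p) is one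
   where omega(p) != 0, and omega - omega(p) where z(p) != 0. *)
Definition local_coord (p q : R[i] * R[i]) : R[i] :=
  if p.2 == 0 then q.2 - p.2 else q.1 - p.1.

Implicit Type F : R[i] * R[i] -> operator R.

Definition laurent_sum (A : nat -> operator R) (N n : nat) (t : R[i])
    : operator R :=
  fun f x => \sum_(k < n) (t ^+ k / t ^+ N) *: A k f x.

(* F = \sum_(k >= 0) t^(k - N) A_k in a punctured neighborhood of [p], where t
   is the local coordinate; if N = 0 the expansion also holds at [p]. The
   series converges in L(L^2_comp, D_loc). *)
Definition laurent F (p : R[i] * R[i]) (N : nat) (A : nat -> operator R)
    : Prop :=
  (forall k, continuous_operator (A k)) /\
  exists eps : R, 0 < eps /\
    forall q, surfM q -> `|q.1 - p.1| < eps%:C -> `|q.2 - p.2| < eps%:C ->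
      (q = p -> N = 0%N) ->
      continuous_operator (F q) /\
      forall rho (chi : R * R * R -> R), test_function setT chi ->
      forall e : R, 0 < e -> exists n0, forall n, (n0 <= n)%N ->
        op_close rho chi e (F q) (laurent_sum A N n (local_coord p q)).

Definition holomorphic_at F p : Prop := exists A, laurent F p 0 A.

Definition finite_meromorphic F : Prop :=
  forall p, surfM p -> exists N A,
    laurent F p N A /\ forall k, (k < N)%N -> exists m, has_rank (A k) m.

Definition pole F p : Prop :=
  surfM p /\ exists N A, laurent F p N.+1 A /\ ~ zero_operator (A 0%N).

(* Rank of the coefficient of (z - z(p))^{-1}; used at points with
   omega(p) != 0. *)
Definition multiplicity F p (m : nat) : Prop :=
  exists N A, laurent F p N.+1 A /\ has_rank (A N) m.

Definition resolvent_continuation F : Prop :=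
  finite_meromorphic F /\
  forall z omega, surfM (z, omega) -> 0 < complex.Im omega ->
    [/\ holomorphic_at F (z, omega), ~ spectrum z &
        exists T, resolvent z T /\
          forall f, L2comp f -> aeeq Omega (F (z, omega) f) (T f)].

End MITBag.

(* Main.v *)
From HB Require Import structures.
Require Import Defs.
From mathcomp Require Import all_boot all_order all_algebra.
From mathcomp Require Import all_classical all_reals all_analysis.
From mathcomp Require Import measurable_realfun complex ring lra.
Set Implicit Arguments.
Unset Strict Implicit.
Unset Printing Implicit Defensive.
Import Order.TTheory GRing.Theory Num.Theory.
Import numFieldNormedType.Exports.
Local Open Scope classical_set_scope.
Local Open Scope ring_scope.
Local Open Scope complex_scope.

(* Let J be the matrix of the time reversal symmetry and b(f, u) the integral
   over Omega of f^T J u, a bilinear skew form. Since J alpha_j is symmetric and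
   J beta is skew, Green's formula gives b(Du, v) - b(u, Dv) as a boundary
   integral of u^T J (alpha . n) v, which vanishes for u and v in the domain by
   the bag condition. Hence b(f, R(z, omega) g) is skew in f, g when R is the
   resolvent, that is for Im omega > 0.

   With s = z + omega, the surface M becomes the set of all s <> 0, and
   Im omega > 0 means Im s > 0. From a pole with omega outside i(-oo, 0] the
   vertical half-line going up avoids s = 0, so the skewness propagates down
   along it by the identity theorem for Laurent series, and every coefficient A
   of the expansion at the pole satisfies b(f, A g) = - b(g, A f). As b is
   nondegenerate, on the range of A this yields an invertible skew matrix of
   size rank A, and det M^T = (-1)^m det M forces m to be even. *)

(** * Square-integrable functions *)

(** The pairing b involves no conjugation, so that b(f, R(z, omega) g) is meromorphic on M and the
    identity theorem applies to it. Beyond Im omega > 0, R(z, omega) g is only known to be locally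
    square-integrable; so b pairs a compactly supported field with a local one, and the continuation
    is carried out on the scalars b(f, R g) + b(g, R f) with f and g fixed.

    Green's formula is the analytic core. A trace is only given as a limit of restrictions of test
    fields, so the formula is proved for test fields and passed to the limit, in H^1 inside and in
    L^2 on the boundary. In a chart the boundary is not flattened: with N the normal times the area
    density, the vector field e_j + (-1)^s N_j e_k is tangent to the graph, which trades the
    derivative along x_j for one along x_k, and this one is integrated on lines. The local formulas
    are glued by C^1 cutoffs, and the unbounded domain is exhausted by dilated cutoffs whose
    gradients tend to 0. *)

Section SquareIntegrable.
Context d (T : measurableType d) (R : realType).
Variables (mu : {measure set T -> \bar R}) (D : set T).
Hypothesis mD : measurable D.
Implicit Types f g h c : T -> R.

(** Spinor fields are treated through their eight real components, so the L^2 theory is developed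
    for real functions. *)
Definition sqint f : Prop :=
  measurable_fun D f /\ (\int[mu]_(x in D) (f x ^+ 2)%:E < +oo)%E.

Local Notation integ f := (mu.-integrable D (EFin \o f)).

Lemma sqint_integrable_sqr f : sqint f -> integ (fun x => f x ^+ 2).
Proof.
move=> [mf foo]; apply/integrableP; split.
  by apply/measurable_EFinP; exact: measurable_funX.
rewrite (eq_integral (fun x => (f x ^+ 2)%:E))// => x _ /=.
by rewrite ger0_norm ?sqr_ge0.
Qed.

Lemma sqintP f : measurable_fun D f -> integ (fun x => f x ^+ 2) -> sqint f.
Proof.
move=> mf /integrableP[_ foo]; split=> //.
rewrite (eq_integral (fun x => `|(f x ^+ 2)%:E|)%E)// => x _ /=.
by rewrite ger0_norm ?sqr_ge0.
Qed.

Lemma le_integ f g : measurable_fun D f -> integ g ->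
  (forall x, D x -> `|f x| <= `|g x|) -> integ f.
Proof.
move=> mf ig fg; apply: (le_integrable mD _ _ ig); first exact/measurable_EFinP.
by move=> x Dx /=; rewrite lee_fin fg.
Qed.

Lemma integ_meas f : integ f -> measurable_fun D f.
Proof. by move=> /integrableP[/measurable_EFinP]. Qed.

Lemma integD f g : integ f -> integ g -> integ (fun x => f x + g x).
Proof. by move=> i j; have := integrableD mD i j; apply: eq_integrable. Qed.

Lemma integZ (k : R) f : integ f -> integ (fun x => k * f x).
Proof. by move=> i; have := integrableZl mD k i; apply: eq_integrable. Qed.

Lemma integ0 : integ (fun=> 0).
Proof. exact: integrable0. Qed.

Lemma sqint_mul f g : sqint f -> sqint g -> integ (fun x => f x * g x).
Proof.
move=> sf sg.
apply: (@le_integ _ (fun x => f x ^+ 2 + g x ^+ 2)).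
- by apply: measurable_funM; [case: sf|case: sg].
- exact: integD (sqint_integrable_sqr sf) (sqint_integrable_sqr sg).
- move=> x _; rewrite (ger0_norm (addr_ge0 (sqr_ge0 _) (sqr_ge0 _))).
  by rewrite ler_norml; apply/andP; split; nra.
Qed.

Lemma sqintZ (k : R) f : sqint f -> sqint (fun x => k * f x).
Proof.
move=> [mf foo]; apply: sqintP; first exact: measurable_funM.
have := integZ (k ^+ 2) (sqint_integrable_sqr (conj mf foo)).
by apply: eq_integrable => // x _ /=; rewrite exprMn.
Qed.

Lemma sqintD f g : sqint f -> sqint g -> sqint (fun x => f x + g x).
Proof.
move=> sf sg; have [mf _] := sf; have [mg _] := sg.
apply: sqintP; first exact: measurable_funD.
have := integD (integD (sqint_integrable_sqr sf) (sqint_integrable_sqr sg))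
  (integZ 2 (sqint_mul sf sg)).
by apply: eq_integrable => // x _ /=; congr (_%:E); ring.
Qed.

Lemma sqintN f : sqint f -> sqint (fun x => - f x).
Proof.
move=> /(sqintZ (-1)); congr sqint.
by apply/funext => x; rewrite mulN1r.
Qed.

Lemma sqintB f g : sqint f -> sqint g -> sqint (fun x => f x - g x).
Proof. by move=> sf /sqintN; exact: sqintD. Qed.

Lemma sqint0 : sqint (fun=> 0).
Proof.
split; first exact: measurable_cst.
by under eq_integral do rewrite expr0n /=; rewrite integral0 ltry.
Qed.

Lemma sqint_bmul c f (M : R) : measurable_fun D c ->
  (forall x, D x -> `|c x| <= M) -> sqint f -> sqint (fun x => c x * f x).
Proof.
move=> mc cM sf; have [mf _] := sf.
apply: sqintP; first exact: measurable_funM.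
apply: le_integ (integZ (M ^+ 2) (sqint_integrable_sqr sf)) _.
  by apply: measurable_funX; exact: measurable_funM.
move=> x Dx; rewrite exprMn normrM [leRHS]normrM ler_wpM2r//.
rewrite normrX [leRHS]normrX lerXn2r ?nnegrE//.
by rewrite (le_trans (cM _ Dx))// ler_norm.
Qed.

Lemma sqint_le f g : measurable_fun D f -> sqint g ->
  (forall x, D x -> `|f x| <= `|g x|) -> sqint f.
Proof.
move=> mf sg fg; apply: sqintP => //.
apply: le_integ (sqint_integrable_sqr sg) _; first exact: measurable_funX.
by move=> x Dx; rewrite normrX [leRHS]normrX lerXn2r ?nnegrE// fg.
Qed.

Definition sqn f : R := Rintegral mu D (fun x => f x ^+ 2).

Lemma sqn_ge0 f : 0 <= sqn f.
Proof. by apply: Rintegral_ge0 => x _; exact: sqr_ge0. Qed.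

Lemma sqnE f : sqint f -> (sqn f)%:E = (\int[mu]_(x in D) (f x ^+ 2)%:E)%E.
Proof.
move=> sf; rewrite /sqn /Rintegral fineK//.
exact: (integrable_fin_num mD (sqint_integrable_sqr sf)).
Qed.

Lemma integral_le0P (a b : R) : (forall t : R, 0 <= a + t * b) -> b = 0.
Proof.
(* At this t the affine function takes the value -1. *)
move=> H; have [//|b0] := eqVneq b 0; have := H (- (a + 1) / b).
by rewrite divfK// => ?; exfalso; lra.
Qed.

Lemma quad_discr (a b c : R) : 0 <= a -> 0 <= c ->
  (forall t, 0 <= a + 2 * t * b + t ^+ 2 * c) -> b ^+ 2 <= a * c.
Proof.
move=> a0 c0 H; have [c00|cn0] := eqVneq c 0.
  have : 2 * b = 0.
    apply: (@integral_le0P a) => t; have := H t.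
    by rewrite c00 mulr0 addr0 mulrA [t * 2]mulrC.
  by move=> b0; have -> : b = 0; [lra|rewrite expr0n mulr_ge0].
have cp : 0 < c by rewrite lt_neqAle eq_sym cn0.
have := H (- b / c).
have -> : a + 2 * (- b / c) * b + (- b / c) ^+ 2 * c = a - b ^+ 2 / c by field.
by rewrite subr_ge0 ler_pdivrMr.
Qed.

(** The integral of (f + t g)^2 is a nonnegative quadratic polynomial in t, so its discriminant is
    at most 0. *)
Lemma cauchy_schwarz f g : sqint f -> sqint g ->
  `|Rintegral mu D (fun x => f x * g x)| <= Num.sqrt (sqn f * sqn g).
Proof.
move=> sf sg.
have sfg := sqint_mul sf sg.
have f2 := sqint_integrable_sqr sf; have g2 := sqint_integrable_sqr sg.
rewrite -sqrtr_sqr ler_sqrt ?mulr_ge0 ?sqn_ge0//.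
apply: quad_discr; rewrite ?sqn_ge0// => t.
have -> : sqn f + 2 * t * Rintegral mu D (fun x => f x * g x) + t ^+ 2 * sqn g
    = Rintegral mu D (fun x => (f x + t * g x) ^+ 2).
  have ib := integZ (2 * t) sfg; have ic := integZ (t ^+ 2) g2.
  rewrite /sqn -!RintegralZl// -RintegralD// -RintegralD//; last exact: integD.
  by apply: eq_Rintegral => x _; ring.
by apply: Rintegral_ge0 => x _; exact: sqr_ge0.
Qed.

(** The difference of the products is (f_n - f)(g_n - g) + (f_n - f) g + f (g_n - g), and
    Cauchy-Schwarz bounds each term. The bounded weight c will be a cutoff, a derivative of it, or a
    cutoff times a component of the normal. *)
Lemma sqint_bilin_cvg c f g (f_ g_ : nat -> T -> R) (M : R) :
  measurable_fun D c -> (forall x, D x -> `|c x| <= M) ->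
  sqint f -> sqint g -> (forall n, sqint (f_ n)) -> (forall n, sqint (g_ n)) ->
  sqn (fun x => f_ n x - f x) @[n --> \oo] --> (0 : R) ->
  sqn (fun x => g_ n x - g x) @[n --> \oo] --> (0 : R) ->
  Rintegral mu D (fun x => c x * (f_ n x * g_ n x)) @[n --> \oo] -->
  Rintegral mu D (fun x => c x * (f x * g x)).
Proof.
move=> mc cM sf sg sf_ sg_ fc gc.
have scf : sqint (fun x => c x * f x) := sqint_bmul mc cM sf.
have sdf n : sqint (fun x => f_ n x - f x) by apply: sqintB.
have sdg n : sqint (fun x => g_ n x - g x) by apply: sqintB.
have scdf n : sqint (fun x => c x * (f_ n x - f x)) := sqint_bmul mc cM (sdf n).
have scdfM n : sqn (fun x => c x * (f_ n x - f x)) <=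
    M ^+ 2 * sqn (fun x => f_ n x - f x).
  rewrite /sqn -RintegralZl//; last exact: sqint_integrable_sqr.
  apply: le_Rintegral => //; first exact: sqint_integrable_sqr.
    by apply: integZ; exact: sqint_integrable_sqr.
  move=> x Dx; rewrite exprMn ler_wpM2r ?sqr_ge0//.
  by rewrite -(real_normK (num_real (c x))) lerXn2r ?nnegrE ?cM//
    (le_trans _ (cM _ Dx)).
apply/cvgrPdist_le => e e0.
pose B n := Num.sqrt (M ^+ 2 * sqn (fun x => f_ n x - f x) * sqn (fun x => g_ n x - g x)) +
  Num.sqrt (M ^+ 2 * sqn (fun x => f_ n x - f x) * sqn g) +
  Num.sqrt (sqn (fun x => c x * f x) * sqn (fun x => g_ n x - g x)).
have Bc : B n @[n --> \oo] --> (0 : R).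
  rewrite -[0]addr0 -[X in X + _]addr0; apply: cvgD; first apply: cvgD.
  - rewrite -[0]sqrtr0; apply: continuous_cvg; first exact: sqrt_continuous.
    rewrite -[0](mulr0 0); apply: cvgM => //.
    by rewrite -[0](mulr0 (M ^+ 2)); apply: cvgM => //; exact: cvg_cst.
  - rewrite -[0]sqrtr0; apply: continuous_cvg; first exact: sqrt_continuous.
    rewrite -[0](mul0r (sqn g)); apply: cvgM => //; last exact: cvg_cst.
    by rewrite -[0](mulr0 (M ^+ 2)); apply: cvgM => //; exact: cvg_cst.
  - rewrite -[0]sqrtr0; apply: continuous_cvg; first exact: sqrt_continuous.
    rewrite -[0](mulr0 (sqn (fun x => c x * f x))); apply: cvgM => //.
    exact: cvg_cst.
have step n : `|Rintegral mu D (fun x => c x * (f x * g x)) -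
    Rintegral mu D (fun x => c x * (f_ n x * g_ n x))| <= B n.
  have iA := sqint_mul (scdf n) (sdg n).
  have iB := sqint_mul (scdf n) sg.
  have iC := sqint_mul scf (sdg n).
  have iD := sqint_mul scf sg.
  rewrite distrC.
  have -> : Rintegral mu D (fun x => c x * (f_ n x * g_ n x)) =
     Rintegral mu D (fun x => c x * (f_ n x - f x) * (g_ n x - g x)) +
     Rintegral mu D (fun x => c x * (f_ n x - f x) * g x) +
     Rintegral mu D (fun x => c x * f x * (g_ n x - g x)) +
     Rintegral mu D (fun x => c x * f x * g x).
    rewrite -!RintegralD//; first by apply: eq_Rintegral => x _; ring.
    - by apply: integD => //; exact: integD.
    - exact: integD.
  have -> : Rintegral mu D (fun x => c x * (f x * g x)) =
      Rintegral mu D (fun x => c x * f x * g x).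
    by apply: eq_Rintegral => x _; ring.
  rewrite addrK; apply: le_trans (ler_normD _ _) _.
  apply: lerD; last exact: cauchy_schwarz.
  apply: le_trans (ler_normD _ _) _; apply: lerD.
  - apply: le_trans (cauchy_schwarz (scdf n) (sdg n)) _.
    by apply: ler_wsqrtr; apply: ler_wpM2r; [exact: sqn_ge0|exact: scdfM].
  - apply: le_trans (cauchy_schwarz (scdf n) sg) _.
    by apply: ler_wsqrtr; apply: ler_wpM2r; [exact: sqn_ge0|exact: scdfM].
have /cvgrPdist_le/(_ e e0) := Bc.
apply: filterS => n; rewrite sub0r normrN => Bn.
by apply: le_trans (step n) _; apply: le_trans Bn; exact: ler_norm.
Qed.

Lemma Rintegral_dominated_cvg (f_ : nat -> T -> R) f g :
  (forall n, measurable_fun D (f_ n)) -> measurable_fun D f ->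
  (forall x, D x -> f_ ^~ x @ \oo --> f x) -> integ g ->
  (forall n x, D x -> `|f_ n x| <= g x) ->
  Rintegral mu D (f_ n) @[n --> \oo] --> Rintegral mu D f.
Proof.
move=> mf_ mf cf ig fg.
have cE : {ae mu, forall x, D x -> (fun n => (f_ n x)%:E) @ \oo --> (f x)%:E}.
  by apply: aeW => x Dx; apply: cvg_EFin; [exact: nearW|exact: cf].
have bE : {ae mu, forall x n, D x -> (`|(f_ n x)%:E| <= (EFin \o g) x)%E}.
  by apply: aeW => x n Dx; rewrite lee_fin fg.
have mE n : measurable_fun D (fun x => (f_ n x)%:E) by apply/measurable_EFinP.
have mE' : measurable_fun D (fun x => (f x)%:E) by apply/measurable_EFinP.
have [fi _ H] := dominated_convergence mD mE mE' cE ig bE.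
apply: fine_cvg; rewrite fineK; last exact: integrable_fin_num.
exact: H.
Qed.

End SquareIntegrable.

(** * Borel sets of R^3 and the product sigma-algebra *)

Section Borel.
Context {R : realType}.

Definition cube (q : R * R * R) (r : R) : set (R * R * R) :=
  [set y | `|y.1.1 - q.1.1| < r /\ `|y.1.2 - q.1.2| < r /\ `|y.2 - q.2| < r].

Lemma ballE3 (x y : R * R * R) (e : R) : ball x e y <->
  `|x.1.1 - y.1.1| < e /\ `|x.1.2 - y.1.2| < e /\ `|x.2 - y.2| < e.
Proof. by split=> [[[? ?] ?]|[? [? ?]]]. Qed.

Lemma cube_ball x r : cube x r = ball x r.
Proof.
apply/seteqP; split=> y.
  by move=> [h1 [h2 h3]]; apply/ballE3; rewrite (distrC x.1.1) (distrC x.1.2) (distrC x.2).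
by move=> /ballE3[h1 [h2 h3]]; rewrite /cube /= (distrC y.1.1) (distrC y.1.2) (distrC y.2).
Qed.

Lemma nbhs_cube (x : R * R * R) (A : set (R * R * R)) :
  nbhs x A <-> exists2 r, 0 < r & cube x r `<=` A.
Proof.
split=> [/nbhs_ballP[r r0 rA]|[r r0 rA]].
  by exists r => //; rewrite cube_ball.
by apply/nbhs_ballP; exists r => //; rewrite -cube_ball.
Qed.

Lemma measurable_fst3 : measurable_fun setT (fun x : space3 R => x.1.1).
Proof. exact: (measurableT_comp measurable_fst measurable_fst). Qed.

Lemma measurable_snd3 : measurable_fun setT (fun x : space3 R => x.1.2).
Proof. exact: (measurableT_comp measurable_snd measurable_fst). Qed.

Lemma measurable_thd3 : measurable_fun setT (fun x : space3 R => x.2).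
Proof. exact: measurable_snd. Qed.

Lemma measurable_cube q r : measurable (cube q r : set (space3 R)).
Proof.
have H (f : space3 R -> R) (a : R) : measurable_fun setT f ->
    measurable [set y | `|f y - a| < r].
  move=> mf; rewrite -[X in measurable X]setTI.
  have -> : [set y | `|f y - a| < r] = (fun y => `|f y - a|) @^-1` `]-oo, r[%classic.
    by apply/seteqP; split=> y /=; rewrite in_itv.
  have mg : measurable_fun setT (fun y => `|f y - a|).
    by apply: measurableT_comp => //; exact: measurable_funB.
  by apply: mg => //; exact: measurable_itv.
have -> : cube q r = [set y | `|y.1.1 - q.1.1| < r] `&`
   ([set y | `|y.1.2 - q.1.2| < r] `&` [set y | `|y.2 - q.2| < r]) by [].
apply: measurableI; last apply: measurableI.
- exact: (H _ _ measurable_fst3).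
- exact: (H _ _ measurable_snd3).
- exact: (H _ _ measurable_thd3).
Qed.

Definition ratcube (p : rat * rat * rat * rat) : set (R * R * R) :=
  cube (ratr p.1.1.1, ratr p.1.1.2, ratr p.1.2) (ratr p.2).

Lemma ratcube_nbhs (x : R * R * R) (A : set (R * R * R)) : nbhs x A ->
  exists2 p, ratcube p x &
    cube (ratr p.1.1.1, ratr p.1.1.2, ratr p.1.2) (2 * ratr p.2) `<=` A.
Proof.
move=> /nbhs_cube[r r0 rA].
(* The rational center will be within d of x, so the doubled cube stays within 3 d < r of x. *)
have [d] : exists d : rat, 0 < (ratr d : R) < r / 3.
  have [d] := @rat_in_itvoo R 0 (r / 3) ltac:(lra).
  by rewrite in_itv /=; exists d.
move=> /andP[d0 dr].
have H a : exists b : rat, `|a - ratr b| < (ratr d : R).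
  have [b] := @rat_in_itvoo R (a - ratr d) (a + ratr d) ltac:(lra).
  rewrite in_itv /= => /andP[? ?]; exists b.
  by rewrite ltr_norml; apply/andP; split; lra.
have [b1 H1] := H x.1.1; have [b2 H2] := H x.1.2; have [b3 H3] := H x.2.
exists (b1, b2, b3, d); first by split.
move=> y; rewrite /cube /= => -[h1 [h2 h3]]; apply: rA.
move: H1 H2 H3 h1 h2 h3; rewrite /cube /= !ltr_norml.
move=> /andP[? ?] /andP[? ?] /andP[? ?] /andP[? ?] /andP[? ?] /andP[? ?].
by split; [|split]; apply/andP; split; lra.
Qed.

(** Cubes with rational data form a countable base. The doubled cubes are kept inside U so that the
    closed cubes are too, as the supports of test functions require. *)
Lemma open_bigcup_cube (U : set (R * R * R)) : open U ->
  exists (q : nat -> R * R * R) (r : nat -> R),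
    (forall n, cube (q n) (2 * r n) `<=` U) /\ U = \bigcup_n cube (q n) (r n).
Proof.
move=> oU.
pose good (p : rat * rat * rat * rat) := 
  cube (ratr p.1.1.1, ratr p.1.1.2, ratr p.1.2) (2 * ratr p.2) `<=` U.
pose Q n : option (rat * rat * rat * rat) :=
  if unpickle n is Some p then if `[< good p >] then Some p else None else None.
exists (fun n => if Q n is Some p then (ratr p.1.1.1, ratr p.1.1.2, ratr p.1.2) else 0).
(* Indices that code no suitable cube get half-side 0, that is the empty cube. *)
exists (fun n => if Q n is Some p then ratr p.2 else 0).
split.
  move=> n y; rewrite /Q; case: unpickle => [p|]; last first.
    by rewrite mulr0 => -[/= /(le_lt_trans (normr_ge0 _))]; rewrite ltxx.
  case: asboolP => [gp|_]; first exact: gp.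
  by rewrite mulr0 => -[/= /(le_lt_trans (normr_ge0 _))]; rewrite ltxx.
apply/seteqP; split=> x.
  move=> Ux; have [p px pU] := ratcube_nbhs (open_nbhs_nbhs (conj oU Ux)).
  by exists (pickle p) => //; rewrite /Q pickleK asboolT.
move=> [n _]; rewrite /Q; case: unpickle => [p|]; last first.
  by move=> [/= /(le_lt_trans (normr_ge0 _))]; rewrite ltxx.
case: asboolP => [gp|_]; last first.
  by move=> [/= /(le_lt_trans (normr_ge0 _))]; rewrite ltxx.
move=> [/= h1 [h2 h3]]; apply: gp.
have := normr_ge0 (x.1.1 - ratr p.1.1.1); split; last split => /=; lra.
Qed.

Lemma open_measurable3 (U : set (R * R * R)) : open U ->
  measurable (U : set (space3 R)).
Proof.
move=> /open_bigcup_cube[q [r [_ ->]]].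
apply: bigcup_measurable => p _; exact: measurable_cube.
Qed.

Lemma closed_measurable3 (U : set (R * R * R)) : closed U ->
  measurable (U : set (space3 R)).
Proof.
by move=> cU; rewrite -(setCK U); apply: measurableC; apply: open_measurable3;
  exact: closed_openC.
Qed.

Lemma continuous_measurable3 (f : R * R * R -> R) : continuous f ->
  measurable_fun setT (f : space3 R -> R).
Proof.
move=> cf; apply: (measurability _ (RGenOpens.measurableE R)).
move=> _ [_ [a [b ->]] <-]; rewrite setTI.
apply: open_measurable3; move/continuousP: cf; apply; exact: interval_open.
Qed.

End Borel.

(** * Differential calculus and cutoff functions *)

Section Ck.
Context {R : realType}.

Section General.
Variable V : normedModType R.
Implicit Types f g : V -> R.

Lemma Ck_continuous n f : Ck n f -> continuous f.
Proof. by case: n => [|n] // []. Qed.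

Lemma Ck_pred n f : Ck n.+1 f -> Ck n f.
Proof.
elim: n f => [|n IH] f; first by case.
by move=> [cf df]; split=> // v; have [dv /IH] := df v.
Qed.

Lemma Ck_derivable n f x v : Ck n.+1 f -> derivable f x v.
Proof. by move=> [_ df]; have [] := df v. Qed.

Lemma Ck_derive n f v : Ck n.+1 f -> Ck n ('D_v f).
Proof. by move=> [_ df]; have [] := df v. Qed.

Lemma Ck_cst n (c : R) : Ck n (fun _ : V => c).
Proof.
elim: n c => [|n IH] c /=; first exact: cst_continuous.
split; first exact: cst_continuous.
move=> v; split=> [x|]; first exact: derivable_cst.
rewrite (_ : (fun x => 'D_v (fun=> c) x) = fun=> 0)//.
by apply/funext => x; rewrite derive_cst.
Qed.

Lemma Ck_add n f g : Ck n f -> Ck n g -> Ck n (fun x => f x + g x).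
Proof.
elim: n f g => [|n IH] f g /= => [cf cg x|[cf df] [cg dg]].
  by apply: cvgD; [exact: cf|exact: cg].
split=> [x|v]; first by apply: cvgD; [exact: cf|exact: cg].
have [df1 df2] := df v; have [dg1 dg2] := dg v.
split=> [x|]; first exact: derivableD.
rewrite (_ : (fun x => 'D_v (fun x => f x + g x) x) =
  fun x => 'D_v f x + 'D_v g x); first exact: IH.
by apply/funext => x; rewrite -deriveD.
Qed.

Lemma deriveM_fun f g x v : derivable f x v -> derivable g x v ->
  'D_v (fun x => f x * g x) x = 'D_v f x * g x + f x * 'D_v g x.
Proof.
move=> df dg; have := deriveM df dg.
by rewrite /GRing.scale /= => ->; rewrite addrC mulrC [X in _ + X]mulrC [X in X + _]mulrC.
Qed.

Lemma Ck_mul n f g : Ck n f -> Ck n g -> Ck n (fun x => f x * g x).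
Proof.
elim: n f g => [|n IH] f g.
  by move=> cf cg x; apply: cvgM; [exact: cf|exact: cg].
move=> Cf Cg; have [cf df] := Cf; have [cg dg] := Cg.
split=> [x|v]; first by apply: cvgM; [exact: cf|exact: cg].
have [df1 df2] := df v; have [dg1 dg2] := dg v.
split=> [x|]; first exact: derivableM.
rewrite (_ : (fun x => 'D_v (fun x => f x * g x) x) =
  fun x => 'D_v f x * g x + f x * 'D_v g x).
  by apply: Ck_add; apply: IH => //; exact: Ck_pred.
by apply/funext => x; rewrite deriveM_fun.
Qed.

Lemma Ck_scale n (c : R) f : Ck n f -> Ck n (fun x => c * f x).
Proof. by apply: Ck_mul; exact: Ck_cst. Qed.

Lemma Ck_opp n f : Ck n f -> Ck n (fun x => - f x).
Proof.
move=> /(Ck_scale (-1)); congr Ck.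
by apply/funext => x; rewrite mulN1r.
Qed.

Lemma Ck_sub n f g : Ck n f -> Ck n g -> Ck n (fun x => f x - g x).
Proof. by move=> Cf /Ck_opp; exact: Ck_add. Qed.

Lemma derive_line f x v : 'D_v f x = 'D_1 (fun h : R => f (h *: v + x)) 0.
Proof.
rewrite /derive; set g1 := fun h => h^-1 *: _; set g2 := fun h => h^-1 *: _.
suff -> : g1 = g2 by [].
by rewrite funeqE /g1 /g2 => h /=; rewrite addr0 scale0r add0r [_%:A]mulr1.
Qed.

Lemma is_derive_line f x v l :
  is_derive (0 : R) (1 : R) (fun h : R => f (h *: v + x)) l <-> is_derive x v f l.
Proof.
split=> -[d1 d2].
  have d3 : derivable f x v by apply/derivable1P.
  by apply: DeriveDef => //; rewrite derive_line.
have d3 := proj1 (@derivable1P _ _ _ f x v) d1.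
by apply: DeriveDef => //; rewrite -derive_line.
Qed.

Lemma is_derive_comp1 f (th : R -> R) x v (l m : R) :
  is_derive (f x) 1 th m -> is_derive x v f l ->
  is_derive x v (fun y => th (f y)) (m * l).
Proof.
move=> dth /is_derive_line df; apply/is_derive_line.
have := @is_derive1_comp R th (fun h : R => f (h *: v + x)) 0 m l.
by rewrite scale0r add0r; apply.
Qed.

End General.

(** In one variable the derivative along v is v f', so a single derivative controls all
    directions. *)
Lemma Ck_intro1 n (f f' : R -> R) : (forall x : R, is_derive x 1 f (f' x)) ->
  Ck n f' -> Ck n.+1 f.
Proof.
move=> df Cf'.
have dff x : differentiable f x.
  by apply/derivable1_diffP; exact: (@ex_derive _ _ _ _ _ _ _ (df x)).
split=> [x|v]; first exact: differentiable_continuous.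
split=> [x|]; first exact: diff_derivable.
rewrite (_ : (fun x => 'D_v f x) = fun x => v * f' x); first exact: Ck_scale.
apply/funext => x; rewrite deriveE// diff1E//= derive1E.
by rewrite (@derive_val _ _ _ _ _ _ _ (df x)).
Qed.

(** [M] is the linear part of the affine map [L]; both sides are limits of the same difference
    quotient. *)
Lemma derive_comp_affine (V W : normedModType R) (f : W -> R) (L M : V -> W) x v :
  (forall h v x, L (h *: v + x) = h *: M v + L x) ->
  'D_v (fun x => f (L x)) x = 'D_(M v) f (L x).
Proof.
by move=> lL; rewrite derive_line [RHS]derive_line; under eq_fun do rewrite lL.
Qed.

Lemma derivable_comp_affine (V W : normedModType R) (f : W -> R) (L M : V -> W) x v :
  (forall h v x, L (h *: v + x) = h *: M v + L x) ->
  derivable f (L x) (M v) -> derivable (fun x => f (L x)) x v.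
Proof.
move=> lL d1; have [_] := @derivable1P _ _ _ (fun x => f (L x)) x v; apply.
have := proj1 (@derivable1P _ _ _ f (L x) (M v)) d1.
by under eq_fun do rewrite -lL.
Qed.

Lemma Ck_comp_affine (V W : normedModType R) n (f : W -> R) (L M : V -> W) :
  (forall h v x, L (h *: v + x) = h *: M v + L x) -> continuous L ->
  Ck n f -> Ck n (fun x => f (L x)).
Proof.
move=> lL cL; elim: n f => [|n IH] f.
  by move=> cf x; apply: continuous_comp; [exact: cL|exact: cf].
move=> [cf df].
split=> [x|v]; first by apply: continuous_comp; [exact: cL|exact: cf].
have [d1 d2] := df (M v); split=> [x|]; first exact: (derivable_comp_affine lL).
rewrite (_ : (fun x => 'D_v (fun x => f (L x)) x) = fun x => 'D_(M v) f (L x)).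
  exact: (IH _ d2).
by apply/funext => x; rewrite (derive_comp_affine _ _ _ lL).
Qed.

Lemma Ck1_comp (V : normedModType R) (f : V -> R) (th th' : R -> R) :
  (forall t : R, is_derive t 1 th (th' t)) -> continuous th' ->
  Ck 1 f -> Ck 1 (fun x => th (f x)).
Proof.
move=> dth cth' Cf; have cf := Ck_continuous Cf.
have E x v : is_derive x v (fun x => th (f x)) (th' (f x) * 'D_v f x).
  by apply: is_derive_comp1; apply: DeriveDef => //; exact: Ck_derivable Cf.
split=> [x|v].
  apply: continuous_comp; first exact: cf.
  apply: differentiable_continuous; apply/derivable1_diffP.
  exact: (@ex_derive _ _ _ _ _ _ _ (dth (f x))).
split=> [x|]; first exact: (@ex_derive _ _ _ _ _ _ _ (E x v)).
rewrite (_ : (fun x => _) = fun x => th' (f x) * 'D_v f x).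
  move=> x; apply: cvgM; last exact: (Ck_derive v Cf).
  by apply: continuous_comp; [exact: cf|exact: cth'].
by apply/funext => x; rewrite (@derive_val _ _ _ _ _ _ _ (E x v)).
Qed.

(** The difference quotient is at most C |h|. This gives the derivative at 0 of functions glued
    there from two formulas. *)
Lemma is_derive_quadratic (f : R -> R) (C : R) : f 0 = 0 ->
  (forall h, `|f h| <= C * h ^+ 2) -> is_derive (0 : R) (1 : R) f 0.
Proof.
move=> f0 fC.
have C0 : 0 <= C by have := fC 1; rewrite expr1n mulr1; exact: le_trans.
have cv : (fun h : R => h^-1 *: ((f \o shift 0) (h *: (1 : R)) - f 0)) @ 0^' --> (0 : R).
  have -> : (fun h : R => h^-1 *: ((f \o shift 0) (h *: (1 : R)) - f 0)) =
      fun h => h^-1 * f h.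
    by apply/funext => h /=; rewrite addr0 [h *: 1]mulr1 f0 subr0.
  apply/cvgrPdist_le => e e0.
  near=> h; rewrite sub0r normrN.
  have hn0 : h != 0 by near: h; exact: nbhs_dnbhs_neq.
  have HE : `|h^-1 * f h| <= C * `|h|.
    rewrite normrM normfV ler_pdivrMl ?normr_gt0//.
    by apply: le_trans (fC h) _; rewrite [leRHS]mulrCA -[_ * `|h|]expr2 real_normK ?num_real.
  apply: le_trans HE _.
  have : `|h| <= e / (C + 1).
    by near: h; apply: dnbhs0_le; rewrite divr_gt0// ltr_wpDl.
  rewrite ler_pdivlMr ?ltr_wpDl// => He; apply: le_trans He.
  by rewrite mulrC ler_wpM2l// lerDl.
apply: DeriveDef; first by apply/cvg_ex; exists 0.
exact: cvg_lim.
Unshelve. all: by end_near.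
Qed.

Lemma derive_out (V : normedModType R) (f : V -> R) (v x : V) :
  (\forall y \near x, f y = 0) -> 'D_v f x = 0.
Proof.
move=> f0; have [->|v0] := eqVneq v 0; first exact: derive0.
rewrite -(@derive_cst _ V R 0 x v); apply: near_eq_derive => //.
Qed.

End Ck.

Section FlatFunctions.
Context {R : realType}.

(* The powers of 1/x make the family stable under differentiation. *)
Definition flat (k : nat) (x : R) : R :=
  if 0 < x then x^-1 ^+ k * expR (- x^-1) else 0.

Lemma flat_ge0 k x : 0 <= flat k x.
Proof.
rewrite /flat; case: ifPn => // x0.
by rewrite mulr_ge0 ?expR_ge0// exprn_ge0// invr_ge0 ltW.
Qed.

Lemma flat_le0 k (x : R) : x <= 0 -> flat k x = 0.
Proof. by move=> x0; rewrite /flat ltNge x0. Qed.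

(** With y = 1/x, the exponential of y dominates y^k / k!. *)
Lemma flat_bounded k : exists C : R, forall x, flat k x <= C.
Proof.
exists (k`!%:R + 1) => x; rewrite /flat; case: ifPn => [x0|_]; last first.
  by rewrite addr_ge0.
rewrite expRN ler_pdivrMr ?expR_gt0//.
have y0 : 0 <= x^-1 by rewrite invr_ge0 ltW.
case: k => [|k].
  rewrite expr0; have := expR_ge1Dx x^-1; rewrite fact0; nra.
have := expR_ge1Dxn k y0.
rewrite -lerBrDl ler_pdivrMr ?ltr0n ?fact_gt0// => /le_trans; apply.
have := expR_ge0 x^-1; have : 0 < (k.+1`!)%:R :> R by rewrite ltr0n fact_gt0.
nra.
Qed.

Lemma is_derive_flat k (x : R) :
  is_derive x 1 (flat k) (- k%:R * flat k.+1 x + flat k.+2 x).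
Proof.
have [x0|x0|->] := ltgtP x 0.
- have -> : - k%:R * flat k.+1 x + flat k.+2 x = 0.
    by rewrite /flat ltNge (ltW x0) /= mulr0 addr0.
  have d0 : is_derive x (1 : R) (fun _ : R => 0 : R) 0 by exact: is_derive_cst.
  apply: (near_eq_is_derive _ d0).
  near=> y; rewrite /flat ifF//; apply/negbTE; rewrite -leNgt ltW//.
  by near: y; exact: lt_nbhsl.
- apply: (@near_eq_is_derive _ _ _ (fun y : R => y^-1 ^+ k * expR (- y^-1))).
    near=> y; rewrite /flat ifT//.
    by near: y; exact: lt_nbhsr.
  have xn0 : x != 0 by rewrite gt_eqF.
  have dV : is_derive x 1 (fun y : R => y^-1) (- x ^- 2).
    have := @is_deriveV R id x 1 1 xn0 (is_derive_id _ _).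
    by rewrite /GRing.scale /= mulr1.
  have dE : is_derive x 1 (fun y : R => expR (- y^-1)) (expR (- x^-1) * x ^- 2).
    have dN : is_derive x 1 (fun y : R => - y^-1) (x ^- 2).
      by rewrite -[x ^- 2]opprK; exact: is_deriveN.
    exact: (@is_derive1_comp R expR _ x _ _ _ dN).
  have dX : is_derive x 1 (fun y : R => y^-1 ^+ k) (k%:R * x^-1 ^+ k.-1 * (- x ^- 2)).
    have := @is_deriveX _ _ (fun y : R => y^-1) k x 1 _ dV.
    by rewrite exprfctE.
  have := @is_deriveM _ _ (fun y : R => y^-1 ^+ k) (fun y : R => expR (- y^-1)) x 1 _ _ dX dE.
  rewrite /GRing.scale /= => -[d1 d2]; apply: DeriveDef; first exact: d1.
  rewrite [LHS]d2.
  rewrite /flat x0; case: k {dX d1 d2} => [|k] /=; rewrite ?exprS; field => //.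
- rewrite !flat_le0// mulr0 addr0.
  (* For h > 0, [flat k h] is h^2 times [flat k.+2 h], so this bound makes it quadratically small at
     0. *)
  have [C HC] := flat_bounded k.+2.
  apply: (@is_derive_quadratic _ _ C); first by rewrite flat_le0.
  move=> h; rewrite ger0_norm ?flat_ge0//.
  have [h0|h0] := ltP 0 h; last first.
    rewrite flat_le0// mulr_ge0 ?sqr_ge0//.
    by apply: le_trans (HC 0); exact: flat_ge0.
  have := HC h; rewrite /flat h0 => Hh.
  apply: le_trans (ler_wpM2r (sqr_ge0 h) Hh).
  by rewrite le_eqVlt; apply/orP; left; rewrite !exprS; apply/eqP; field; rewrite gt_eqF.
Unshelve. all: by end_near.
Qed.

Lemma Ck_flat n k : Ck n (flat k).
Proof.
elim: n k => [|n IH] k.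
  move=> x; apply: differentiable_continuous; apply/derivable1_diffP.
  exact: (@ex_derive _ _ _ _ _ _ _ (is_derive_flat k x)).
by apply: (Ck_intro1 (is_derive_flat k)); apply: Ck_add => //; exact: Ck_scale.
Qed.

Lemma flat_gt0 k (x : R) : 0 < x -> 0 < flat k x.
Proof.
by move=> x0; rewrite /flat x0 mulr_gt0 ?expR_gt0// exprn_gt0// invr_gt0.
Qed.

Lemma flat0_le1 (x : R) : flat 0 x <= 1.
Proof.
rewrite /flat; case: ifPn => // x0; rewrite mul1r -[leRHS]expR0 ler_expR.
by rewrite lerNl oppr0 invr_ge0 ltW.
Qed.

Lemma flat_nondecreasing : {homo (@flat 0) : x y / x <= y}.
Proof.
move=> x y xy; have [x0|x0] := ltP 0 x; last first.
  by rewrite (flat_le0 _ x0) flat_ge0.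
rewrite /flat x0 (lt_le_trans x0 xy) !mul1r ler_expR lerN2.
by rewrite lef_pV2// posrE ?(lt_le_trans x0 xy).
Qed.

Lemma flat_cvg1 (x : R) : 0 < x ->
  (fun n : nat => flat 0 (n.+1%:R * x)) @ \oo --> (1 : R).
Proof.
move=> x0.
have -> : (fun n : nat => flat 0 (n.+1%:R * x)) =
    (fun n : nat => expR (- (harmonic n * x^-1))).
  by apply/funext => n; rewrite /flat mulr_gt0// mul1r invfM.
rewrite -[X in _ --> X]expR0; apply: continuous_cvg; first exact: continuous_expR.
rewrite -[X in _ --> X]oppr0; apply: cvgN; rewrite -[X in _ --> X](mul0r x^-1).
by apply: cvgM; [exact: cvg_harmonic|exact: cvg_cst].
Qed.

End FlatFunctions.

Section Plateau.
Context {R : realType}.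

(* The ramp below is C^1 only, which suffices for Green's formula. *)
Definition sqpos (x : R) : R := Num.max x 0 ^+ 2.

Lemma sqpos_ge0 x : 0 <= sqpos x. Proof. exact: sqr_ge0. Qed.

Lemma is_derive_sqpos (x : R) : is_derive x 1 sqpos (2 * Num.max x 0).
Proof.
have [x0|x0|->] := ltgtP x 0.
- rewrite mulr0.
  have d0 : is_derive x (1 : R) (fun _ : R => 0 : R) 0 by exact: is_derive_cst.
  apply: (near_eq_is_derive _ d0).
  near=> y; rewrite /sqpos max_r ?expr0n//; apply: ltW.
  by near: y; exact: lt_nbhsl.
- have d2 : is_derive x (1 : R) (fun y : R => y ^+ 2) (2 * x).
    have := @is_deriveX _ _ (@id R) 2 x 1 1 (is_derive_id _ _).
    by rewrite exprfctE /GRing.scale /= mulr1 expr1.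
  apply: (near_eq_is_derive _ d2).
  near=> y; rewrite /sqpos max_l//; apply: ltW.
  by near: y; exact: lt_nbhsr.
- rewrite mulr0; apply: (@is_derive_quadratic _ _ 1).
    by rewrite /sqpos maxxx expr0n.
  move=> h; rewrite ger0_norm ?sqpos_ge0// mul1r /sqpos.
  by rewrite maxEle; case: ifPn => _ //; rewrite expr0n/= sqr_ge0.
Unshelve. all: by end_near.
Qed.

(** A C^1 step function: 0 for x <= 0, 1 for x >= 1, with values in [0, 1] between. *)
Definition ramp (x : R) : R := 1 - sqpos (1 - sqpos x).
Definition ramp' (x : R) : R :=
  2 * Num.max (1 - sqpos x) 0 * (2 * Num.max x 0).

Lemma continuous_maxl0 : continuous (fun x : R => Num.max x 0).
Proof.
move=> x; apply: (@continuous_max R R (@id R) (fun=> 0)).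
  exact: cvg_id.
exact: cvg_cst.
Qed.

Lemma continuous_sqpos : continuous sqpos.
Proof.
move=> x; rewrite /continuous_at /sqpos; under eq_fun do rewrite expr2.
by rewrite expr2; apply: cvgM; exact: continuous_maxl0.
Qed.

Lemma is_derive_ramp (x : R) : is_derive x 1 ramp (ramp' x).
Proof.
have d1 : is_derive x 1 (fun y : R => 1 - sqpos y) (- (2 * Num.max x 0)).
  by have := @is_deriveB _ _ _ _ _ _ _ _ _ (is_derive_cst (1 : R) x (1 : R)) (is_derive_sqpos x);
    rewrite sub0r.
have d2 := @is_derive1_comp R sqpos (fun y : R => 1 - sqpos y) x _ _ (is_derive_sqpos (1 - sqpos x)) d1.
have := @is_deriveB _ _ _ _ _ _ _ _ _ (is_derive_cst (1 : R) x (1 : R)) d2.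
by rewrite sub0r mulrN opprK.
Qed.

Lemma continuous_ramp' : continuous ramp'.
Proof.
move=> x; apply: cvgM.
  apply: cvgM; first exact: cvg_cst.
  apply: (@continuous_comp _ _ _ (fun x => 1 - sqpos x) (fun x => Num.max x 0)).
    by apply: cvgB; [exact: cvg_cst|exact: continuous_sqpos].
  exact: continuous_maxl0.
by apply: cvgM; [exact: cvg_cst|exact: continuous_maxl0].
Qed.

Lemma ramp_le0 x : x <= 0 -> ramp x = 0.
Proof.
by move=> x0; rewrite /ramp /sqpos (max_r x0) expr0n /= subr0 max_l// expr1n subrr.
Qed.

Lemma ramp_ge1 x : 1 <= x -> ramp x = 1.
Proof.
move=> x1; rewrite /ramp {1}/sqpos max_r ?expr0n ?subr0//.
rewrite subr_le0 /sqpos max_l ?(le_trans ler01)//.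
by rewrite exprn_ege1.
Qed.

Lemma ramp_01 x : 0 <= ramp x <= 1.
Proof.
rewrite /ramp gerBl sqpos_ge0 andbT subr_ge0 /sqpos.
rewrite expr_le1 ?le_max ?lexx ?orbT// ge_max ler01 andbT.
by rewrite gerBl sqr_ge0.
Qed.

Lemma Ck_ramp : Ck 1 ramp.
Proof. by apply: (Ck_intro1 is_derive_ramp); exact: continuous_ramp'. Qed.

End Plateau.

Section Bumps.
Context {R : realType}.
Implicit Types (q x : R * R * R) (r : R).

(* A product of functions of one variable, supported in the cube of center q
   and half-side r when g is supported in ]0, +oo[. *)
Definition cube_fun (g : R -> R) q r (c : R) x : R :=
  g (c * (r + (x.1.1 - q.1.1))) * g (c * (r - (x.1.1 - q.1.1))) *
  (g (c * (r + (x.1.2 - q.1.2))) * g (c * (r - (x.1.2 - q.1.2)))) *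
  (g (c * (r + (x.2 - q.2))) * g (c * (r - (x.2 - q.2)))).

Lemma cont_coord (j : 'I_3) : continuous (coord3 j : R * R * R -> R).
Proof.
move=> x; rewrite /coord3; case: (val j) => [|[|_]].
- apply: (@continuous_comp _ _ _ fst fst); exact: cvg_fst.
- apply: (@continuous_comp _ _ _ fst snd); [exact: cvg_fst|exact: cvg_snd].
- exact: cvg_snd.
Qed.

Lemma Ck_affine_coord n (g : R -> R) (j : 'I_3) (a b : R) :
  Ck n g -> Ck n (fun x : R * R * R => g (a * coord3 j x + b)).
Proof.
move=> Cg; apply: (@Ck_comp_affine _ _ _ n g _ (fun v => a * coord3 j v)) => //.
  move=> h v x; rewrite /coord3.
  by case: (val j) => [|[|_]] /=; rewrite /GRing.scale /=; ring.
move=> x; apply: cvgD; last exact: cvg_cst.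
by apply: cvgM; [exact: cvg_cst|exact: cont_coord].
Qed.

Lemma Ck_cube_fun n g q r c : Ck n g -> Ck n (cube_fun g q r c).
Proof.
move=> Cg.
have H (j : 'I_3) (a : R) : Ck n (fun x => g (c * (r + (coord3 j x - a))) * g (c * (r - (coord3 j x - a)))).
  apply: Ck_mul.
    rewrite (_ : (fun x => _) = fun x : R * R * R => g (c * coord3 j x + (c * (r - a)))).
      exact: Ck_affine_coord.
    by apply/funext => x; congr g; ring.
  rewrite (_ : (fun x => _) = fun x : R * R * R => g (- c * coord3 j x + (c * (r + a)))).
    exact: Ck_affine_coord.
  by apply/funext => x; congr g; ring.
apply: Ck_mul; first apply: Ck_mul.
- exact: (H (@Ordinal 3 0 isT)).
- exact: (H (@Ordinal 3 1 isT)).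
- exact: (H (@Ordinal 3 2 isT)).
Qed.

Lemma cube_fun_out g q r c x : 0 <= c -> (forall t, t <= 0 -> g t = 0) ->
  ~ cube q r x -> cube_fun g q r c x = 0.
Proof.
move=> c0 g0 nx.
have H (t : R) : ~ (`|t| < r) -> g (c * (r + t)) * g (c * (r - t)) = 0.
  move=> /negP; rewrite -leNgt => rt; have [t0|t0] := leP 0 t.
    rewrite (g0 (c * (r - t))) ?mulr0// mulr_ge0_le0// subr_le0.
    by rewrite ger0_norm in rt.
  rewrite (g0 (c * (r + t))) ?mul0r// mulr_ge0_le0//.
  by rewrite ltr0_norm// in rt; lra.
rewrite /cube_fun; have [h1|/H->] := pselect (`|x.1.1 - q.1.1| < r); last by rewrite !mul0r.
have [h2|/H->] := pselect (`|x.1.2 - q.1.2| < r); last by rewrite mulr0 mul0r.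
have [h3|/H->] := pselect (`|x.2 - q.2| < r); last by rewrite mulr0.
by exfalso; apply: nx.
Qed.

Lemma closed_ccube q r : closed [set x : R * R * R |
  forall j, `|coord3 j x - coord3 j q| <= r].
Proof.
have -> : [set x : R * R * R | forall j, `|coord3 j x - coord3 j q| <= r] =
    \bigcap_(j in setT) [set x | `|coord3 j x - coord3 j q| <= r].
  by apply/seteqP; split=> x /= H j => [_|]; exact: H.
apply: closed_bigI => j _.
apply: (@closed_comp _ _ (fun x : R * R * R => `|coord3 j x - coord3 j q|) [set t | t <= r]).
  move=> x _.
  apply: (@continuous_comp _ _ _ (fun x => coord3 j x - coord3 j q) (fun t : R => `|t|));
    last exact: norm_continuous.
  by apply: cvgB; [exact: cont_coord|exact: cvg_cst].
exact: closed_le.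
Qed.

Lemma compact_ccube q r : compact [set x : R * R * R |
  forall j, `|coord3 j x - coord3 j q| <= r].
Proof.
have cK : compact (`[q.1.1 - r, q.1.1 + r]%classic `*` `[q.1.2 - r, q.1.2 + r]%classic
   `*` `[q.2 - r, q.2 + r]%classic : set (R * R * R)).
  apply: compact_setX; first apply: compact_setX; exact: segment_compact.
apply: (subclosed_compact _ cK); first exact: closed_ccube.
move=> x H; have := H (@Ordinal 3 0 isT); have := H (@Ordinal 3 1 isT).
have := H (@Ordinal 3 2 isT); rewrite /coord3 /= !ler_norml.
move=> /andP[? ?] /andP[? ?] /andP[? ?].
by split; [split|]; rewrite /= in_itv /=; apply/andP; split; lra.
Qed.

Lemma cube_coord q r x : cube q r x <-> forall j, `|coord3 j x - coord3 j q| < r.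
Proof.
split=> [[h1 [h2 h3]] j|H].
  by rewrite /coord3; case: (val j) => [|[|_]].
by split; [exact: (H (@Ordinal 3 0 isT))|split;
  [exact: (H (@Ordinal 3 1 isT))|exact: (H (@Ordinal 3 2 isT))]].
Qed.

Lemma closure_cube q r : closure (cube q r) `<=` [set x : R * R * R |
  forall j, `|coord3 j x - coord3 j q| <= r].
Proof.
rewrite closureE; apply: smallest_sub; first exact: closed_ccube.
by move=> x /cube_coord H j; exact: ltW.
Qed.

Lemma test_function_sub (f : R * R * R -> R) U q r : smooth f ->
  (forall x, ~ cube q r x -> f x = 0) ->
  (forall x, (forall j, `|coord3 j x - coord3 j q| <= r) -> U x) -> test_function U f.
Proof.
move=> sf fq rU.
have sub : closure [set x | f x != 0] `<=` [set x : R * R * R |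
    forall j, `|coord3 j x - coord3 j q| <= r].
  apply: subset_trans (@closure_cube q r); apply: closureS.
  by move=> x /=; apply: contra_neqP => /fq.
split=> //; last by move=> x /sub; exact: rU.
by apply: (subclosed_compact _ (@compact_ccube q r) sub); exact: closed_closure.
Qed.

(** Smooth functions supported in a fixed cube that tend to its indicator as n grows. *)
Definition cbump q r (n : nat) := cube_fun (flat 0) q r n.+1%:R.

Lemma smooth_cbump q r n : smooth (cbump q r n).
Proof. by move=> m; apply: Ck_cube_fun; exact: Ck_flat. Qed.

Lemma cbump_out q r n x : ~ cube q r x -> cbump q r n x = 0.
Proof. by apply: cube_fun_out => //; exact: flat_le0. Qed.

Lemma test_cbump q r n U : (forall x, (forall j, `|coord3 j x - coord3 j q| <= r) -> U x) ->
  test_function U (cbump q r n).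
Proof.
move=> rU; apply: (test_function_sub (smooth_cbump q r n) _ rU).
by move=> x; exact: cbump_out.
Qed.

Lemma test_cbumpT q r n : test_function setT (cbump q r n).
Proof. exact: test_cbump. Qed.

Lemma cbump_ge0 q r n x : 0 <= cbump q r n x.
Proof. by rewrite /cbump /cube_fun !mulr_ge0 ?flat_ge0. Qed.

Lemma cbump_le1 q r n x : cbump q r n x <= 1.
Proof. by rewrite /cbump /cube_fun !mulr_ile1 ?mulr_ge0 ?flat_ge0 ?flat0_le1. Qed.

Lemma cbump_cvg q r x :
  (fun n => cbump q r n x) @ \oo --> (\1_(cube q r) x : R).
Proof.
rewrite indicE; have [xq|xq] := pselect (cube q r x); last first.
  rewrite memNset//; under eq_fun do rewrite cbump_out//.
  exact: cvg_cst.
rewrite mem_set// -[X in _ --> X](mulr1 1) -[X in X * _](mulr1 1).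
have H (t : R) : `|t| < r -> (fun n : nat => flat 0 (n.+1%:R * (r + t)) * flat 0 (n.+1%:R * (r - t)))
   @ \oo --> (1 : R).
  rewrite ltr_norml => /andP[? ?]; rewrite -[X in _ --> X](mulr1 1).
  by apply: cvgM; apply: flat_cvg1; lra.
by move: xq => [h1 [h2 h3]]; apply: cvgM; first apply: cvgM; exact: H.
Qed.

Lemma cbump_lower q r0 r n : r0 < r -> exists2 m : R, 0 < m &
  forall x, cube q r0 x -> m <= cbump q r n x.
Proof.
move=> r0r; exists (flat 0 (n.+1%:R * (r - r0)) ^+ 6).
  by rewrite exprn_gt0// flat_gt0// mulr_gt0// subr_gt0.
set m := flat 0 _; have m0 : 0 <= m by exact: flat_ge0.
have H (t : R) : `|t| < r0 -> m ^+ 2 <= flat 0 (n.+1%:R * (r + t)) * flat 0 (n.+1%:R * (r - t)).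
  rewrite ltr_norml => /andP[? ?]; rewrite expr2; apply: ler_pM => //.
    by apply: flat_nondecreasing; rewrite ler_pM2l//; lra.
  by apply: flat_nondecreasing; rewrite ler_pM2l//; lra.
move=> x [h1 [h2 h3]]; rewrite /cbump /cube_fun.
rewrite -[6%N]/(2 + 2 + 2)%N !exprD -!expr2.
by apply: ler_pM; rewrite ?mulr_ge0 ?sqr_ge0 ?H//; apply: ler_pM; rewrite ?sqr_ge0 ?H.
Qed.

(** Equal to 1 on the cube of half-side r and to 0 off the one of half-side 2 r. It serves both to
    split a cutoff into local pieces and, dilated, to exhaust the domain. *)
Definition plateau q r := cube_fun ramp q (2 * r) r^-1.

Lemma Ck_plateau q r : Ck 1 (plateau q r).
Proof. by apply: Ck_cube_fun; exact: Ck_ramp. Qed.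

Lemma plateau_out q r x : 0 <= r -> ~ cube q (2 * r) x -> plateau q r x = 0.
Proof. by move=> r0; apply: cube_fun_out; [rewrite invr_ge0|exact: ramp_le0]. Qed.

Lemma plateau_1 q r x : 0 < r -> cube q r x -> plateau q r x = 1.
Proof.
move=> r0.
have H (t : R) : `|t| < r -> ramp (r^-1 * (2 * r + t)) * ramp (r^-1 * (2 * r - t)) = 1.
  rewrite ltr_norml => /andP[? ?].
  by rewrite !ramp_ge1 ?mulr1// ler_pdivlMl// mulr1; lra.
by move=> [h1 [h2 h3]]; rewrite /plateau /cube_fun !H// !mulr1.
Qed.

Lemma plateau_01 q r x : 0 <= plateau q r x <= 1.
Proof.
have H (a b : R) : 0 <= a <= 1 -> 0 <= b <= 1 -> 0 <= a * b <= 1.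
  by move=> /andP[? ?] /andP[? ?]; rewrite mulr_ge0 ?mulr_ile1.
by rewrite /plateau /cube_fun !H// ramp_01.
Qed.

End Bumps.

(** * Fubini's theorem along any coordinate axis *)

Section Fubini.
Context {R : realType}.
Notation leb1 := (@lebesgue_measure R).

Lemma leb2_sigma_finite : sigma_finite setT (@leb2 R).
Proof.
have /sigma_finiteP[F [TF ndF Foo]] := sigma_finiteT leb1.
exists (fun n => F n `*` F n).
  rewrite -setXTT TF predeqE => -[x y]; split.
    move=> [/= [n _ Fnx] [k _ Gky]]; exists (maxn n k) => //; split.
    - by move: x Fnx; exact/subsetPset/ndF/leq_maxl.
    - by move: y Gky; exact/subsetPset/ndF/leq_maxr.
  by move=> [n _ []/= ? ?]; split; exists n.
move=> k; have [? ?] := Foo k; split; first exact: measurableX.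
by rewrite /leb2 /= product_measure1E// lte_mul_pinfty// ge0_fin_numE.
Qed.

(* Canonical structures only give sigma-finiteness of products of finite
   measures. *)
Definition mu2 : {sigma_finite_measure set (space2 R) -> \bar R} :=
  HB.pack_for {sigma_finite_measure set (space2 R) -> \bar R}
   (product_measure1 leb1 leb1)
   (Measure_isSigmaFinite.Build _ _ _ (product_measure1 leb1 leb1) leb2_sigma_finite).

Lemma measurable_insert (j : 'I_3) :
  measurable_fun setT (fun p : space3 R => insert j p.1 p.2 : space3 R).
Proof.
rewrite /insert; case: (val j) => [|[|_]].
- apply: measurable_fun_pair; last exact: measurable_snd3.
  by apply: measurable_fun_pair; [exact: measurable_thd3|exact: measurable_fst3].
- apply: measurable_fun_pair; last exact: measurable_snd3.
  by apply: measurable_fun_pair; [exact: measurable_fst3|exact: measurable_thd3].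
- apply: measurable_fun_pair; last exact: measurable_thd3.
  by apply: measurable_fun_pair; [exact: measurable_fst3|exact: measurable_snd3].
Qed.

Lemma tonelli3 (f : space3 R -> \bar R) : measurable_fun setT f ->
  (forall x, 0 <= f x)%E ->
  (\int[leb3]_x f x = \int[leb1]_a \int[leb1]_b \int[leb1]_c f (a, b, c))%E.
Proof.
move=> mf f0; rewrite [LHS](@fubini_tonelli1 _ _ _ _ _ mu2 leb1 f)//.
rewrite (@fubini_tonelli1 _ _ _ _ _ leb1 leb1)//.
  exact: measurable_fun_fubini_tonelli_F.
by move=> x; exact: integral_ge0.
Qed.

Lemma tonelli_swap01 (f : space3 R -> \bar R) : measurable_fun setT f ->
  (forall x, 0 <= f x)%E ->
  (\int[leb3]_x f x = \int[leb1]_b \int[leb1]_a \int[leb1]_c f (a, b, c))%E.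
Proof.
move=> mf f0; rewrite (tonelli3 mf f0).
have m1 := @measurable_fun_fubini_tonelli_F _ _ _ _ _ leb1 f mf f0.
have p1 x : (0 <= fubini_F leb1 f x)%E by exact: integral_ge0.
exact: (@fubini_tonelli _ _ _ _ _ leb1 leb1 (fubini_F leb1 f) m1 p1).
Qed.

Lemma tonelli_swap12 (f : space3 R -> \bar R) : measurable_fun setT f ->
  (forall x, 0 <= f x)%E ->
  (\int[leb3]_x f x = \int[leb1]_a \int[leb1]_c \int[leb1]_b f (a, b, c))%E.
Proof.
move=> mf f0; rewrite (tonelli3 mf f0); apply: eq_integral => a _.
apply: (@fubini_tonelli _ _ _ _ _ leb1 leb1 (fun p => f (a, p.1, p.2))) => //.
apply: (measurableT_comp mf); apply: measurable_fun_pair; last exact: measurable_snd.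
by apply: measurable_fun_pair; [exact: measurable_cst|exact: measurable_fst].
Qed.

(** Lebesgue measure is invariant under the permutation that moves the last coordinate to place j;
    for the indicator of A this is an exchange of iterated integrals. *)
Lemma leb3_insert (j : 'I_3) (A : set (space3 R)) : measurable A ->
  leb3 A = pushforward leb3 (fun p : space3 R => insert j p.1 p.2 : space3 R) A.
Proof.
move=> mA.
have mB := measurable_insert j measurableT mA; rewrite setTI in mB.
have ind (B : set (space3 R)) : measurable B -> leb3 B = (\int[leb3]_x (\1_B x)%:E)%E.
  by move=> ?; rewrite integral_indic// setIT.
rewrite /pushforward (ind _ mA) (ind _ mB).
have m1 (B : set (space3 R)) : measurable B ->
    measurable_fun setT (fun x => (\1_B x)%:E : \bar R).
  by move=> ?; apply/measurable_EFinP; exact: measurable_indic.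
have p1 (B : set (space3 R)) x : (0 <= (\1_B x)%:E :> \bar R)%E by rewrite lee_fin.
rewrite [RHS](tonelli3 (m1 _ mB) (p1 _)).
have E a b c : (\1_((fun p : space3 R => insert j p.1 p.2 : space3 R) @^-1` A) (a, b, c) : R)
   = \1_A (insert j (a, b) c) by [].
under [RHS]eq_integral do under eq_integral do under eq_integral do rewrite E.
case: j {mB E} => -[|[|[|//]]] j3; rewrite /insert /=.
- etransitivity; first exact: (tonelli_swap01 (m1 _ mA) (p1 _)).
  apply: eq_integral => a _.
  apply: (@fubini_tonelli _ _ _ _ _ leb1 leb1 (fun p => (\1_A (p.1, a, p.2))%:E)) => //.
  apply: (measurableT_comp (m1 _ mA)); apply: measurable_fun_pair; last exact: measurable_snd.
  by apply: measurable_fun_pair; [exact: measurable_fst|exact: measurable_cst].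
- exact: (tonelli_swap12 (m1 _ mA) (p1 _)).
- exact: (tonelli3 (m1 _ mA) (p1 _)).
Qed.

Lemma fubini_insert (j : 'I_3) (f : space3 R -> R) :
  leb3.-integrable setT (EFin \o f) ->
  (\int[leb3]_x (f x)%:E = \int[leb2]_y \int[leb1]_t (f (insert j y t))%:E)%E.
Proof.
move=> fi; have := fi => /integrableP[mf foo].
pose phi := (fun p : space3 R => insert j p.1 p.2 : space3 R).
have mphi : measurable_fun setT phi := measurable_insert j.
have eqint (g : space3 R -> \bar R) :
    (\int[pushforward leb3 phi]_x g x = \int[leb3]_x g x)%E.
  by apply: eq_measure_integral => A mA _; exact/esym/leb3_insert.
have fphi : leb3.-integrable setT ((EFin \o f) \o phi).
  apply/integrableP; split; first exact: measurableT_comp.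
  have := ge0_integral_pushforward mphi leb3 (D := setT) (f := abse \o (EFin \o f)) measurableT.
  rewrite preimage_setT => <-.
  - by rewrite eqint.
  - exact: measurableT_comp.
  - by move=> y _; exact: abse_ge0.
have := @integral_pushforward _ _ _ _ _ _ mphi leb3 setT (EFin \o f) mf.
rewrite preimage_setT => /(_ fphi measurableT); rewrite eqint => ->.
exact/esym/(@integral12_prod_meas1 _ _ _ _ _ mu2 leb1).
Qed.

End Fubini.

(** * Integration by parts and the fundamental lemma *)

Section CompactSupport.
Context {R : realType}.
Notation leb1 := (@lebesgue_measure R).
Implicit Types (q x : R * R * R) (r : R) (f W : R * R * R -> R).

Lemma leb3_cube_fin q r : (leb3 (cube q r : set (space3 R)) < +oo)%E.
Proof.
pose I (a : R) := `]a - r, a + r[%classic.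
have mI a : measurable (I a : set (measurableTypeR R)) by exact: measurable_itv.
have fI a : (leb1 (I a) < +oo)%E.
  by rewrite lebesgue_measure_itv /=; case: ifP => _; rewrite ?ltry// -EFinB ltry.
have -> : cube q r = I q.1.1 `*` I q.1.2 `*` I q.2.
  apply/seteqP; split=> x.
    rewrite /cube /I /= !ltr_norml !in_itv /=.
    move=> [/andP[? ?] [/andP[? ?] /andP[? ?]]].
    by split; [split|]; apply/andP; split; lra.
  move=> [[]]; rewrite /cube /I /= !in_itv /=.
  move=> /andP[? ?] /andP[? ?] /andP[? ?].
  by split; [|split]; rewrite ltr_norml; apply/andP; split; lra.
have e2 : leb2 (I q.1.1 `*` I q.1.2) = (leb1 (I q.1.1) * leb1 (I q.1.2))%E.
  exact: (@product_measure1E _ _ _ _ _ leb1 leb1).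
have -> : leb3 (I q.1.1 `*` I q.1.2 `*` I q.2) =
    (leb2 (I q.1.1 `*` I q.1.2) * leb1 (I q.2))%E.
  apply: (@product_measure1E _ _ _ _ _ (@leb2 R) leb1) => //.
  exact: measurableX.
rewrite e2 lte_mul_pinfty//.
- by rewrite mule_ge0.
- by rewrite ge0_fin_numE ?mule_ge0// lte_mul_pinfty// ge0_fin_numE.
Qed.

Lemma continuous_cube_bounded f q r : continuous f ->
  exists2 M, 0 <= M & forall x, cube q r x -> `|f x| <= M.
Proof.
move=> cf; have cK := @compact_ccube R q r.
have := continuous_compact (continuous_subspaceT cf) cK.
move=> /compact_bounded[M [_ HM]].
exists (`|M| + 1); first by rewrite addr_ge0.
move=> x xq; apply: (HM (`|M| + 1)); first by rewrite ltr_pwDr// ler_norm.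
by exists x => //= j; apply: ltW; move/cube_coord: xq; exact.
Qed.

Lemma measurable_bounded_cube_integrable f q r M : measurable_fun setT (f : space3 R -> R) ->
  (forall x, `|f x| <= M) -> (forall x, ~ cube q r x -> f x = 0) ->
  leb3.-integrable setT (EFin \o f).
Proof.
move=> mf fM f0.
have : leb3.-integrable (cube q r : set (space3 R)) (EFin \o f).
  apply: measurable_bounded_integrable.
  - exact: measurable_cube.
  - exact: leb3_cube_fin.
  - exact: measurable_funTS.
  - exists M; split; first exact: num_real.
    by move=> N MN x _; apply: le_trans (ltW MN).
rewrite integrable_mkcond; last exact: measurable_cube.
apply: eq_integrable => // x _; rewrite /patch; case: ifPn => //.
by rewrite notin_setE => /f0 /= ->.
Qed.

Lemma continuous_cube_integrable f q r : continuous f ->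
  (forall x, ~ cube q r x -> f x = 0) -> leb3.-integrable setT (EFin \o f).
Proof.
move=> cf f0; have [M M0 HM] := continuous_cube_bounded q r cf.
apply: (@measurable_bounded_cube_integrable f q r M _ _ f0).
  exact: continuous_measurable3.
move=> x; have [/HM//|/f0->] := pselect (cube q r x).
by rewrite normr0.
Qed.

(** Doubling the cube leaves room for a whole neighborhood of x on which W vanishes. *)
Lemma derive_out_cube W q r v x : (forall x, ~ cube q r x -> W x = 0) ->
  ~ cube q (2 * r) x -> 'D_v W x = 0.
Proof.
move=> W0 nx; apply: derive_out.
(* For r <= 0 the cube is empty and W vanishes everywhere. *)
have [r0|r0] := ltP 0 r; last first.
  apply/nbhs_cube; exists 1 => // y _; apply: W0 => -[/(le_lt_trans (normr_ge0 _))].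
  by rewrite ltNge r0.
apply/nbhs_cube; exists r => // y /cube_coord yx; apply: W0 => /cube_coord yq.
apply: nx; apply/cube_coord => j; have := yx j; have := yq j.
rewrite !ltr_norml => /andP[? ?] /andP[? ?]; apply/andP; split; lra.
Qed.

Definition side (s : bool) (t : R) : R := (0 < (-1) ^+ s * t)%R%:R.

(** The fundamental theorem of calculus on a half-line: g vanishes far out, so only the endpoint c
    contributes, with the sign of the direction pointing out of the half-line. *)
Lemma half_line_integral (s : bool) (g g' : R -> R) (a b c : R) :
  (forall t : R, is_derive t 1 g (g' t)) -> continuous g' ->
  (forall t, ~ (a < t < b) -> g t = 0) -> (forall t, ~ (a < t < b) -> g' t = 0) ->
  (\int[leb1]_t (side s (t - c) * g' t)%:E = (- (-1) ^+ s * g c)%:E)%E.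
Proof.
move=> dg cg' g0 g'0.
have cg : continuous g.
  move=> t; apply: differentiable_continuous; apply/derivable1_diffP.
  exact: (@ex_derive _ _ _ _ _ _ _ (dg t)).
have FTC u w : u < w -> (\int[leb1]_(t in `[u, w]) (g' t)%:E = (g w)%:E - (g u)%:E)%E.
  move=> uw; apply: continuous_FTC2 => //.
  - exact: continuous_subspaceT.
  - split=> [t ti||].
    + exact: (@ex_derive _ _ _ _ _ _ _ (dg t)).
    + by apply: cvg_at_right_filter; exact: cg.
    + by apply: cvg_at_left_filter; exact: cg.
  - by move=> t _; rewrite derive1E (@derive_val _ _ _ _ _ _ _ (dg t)).
case: s.
- rewrite expr1.
  rewrite opprK mul1r.
  pose u := Num.min a c - 1.
  have uc : u < c by rewrite /u; have := ge_min c a c; rewrite lexx orbT => ?; lra.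
  have ua : u < a by rewrite /u; have := ge_min a a c; rewrite lexx => ?; lra.
  have gu : g u = 0 by apply: g0 => /andP[? ?]; lra.
  transitivity (\int[leb1]_(t in `[u, c[) (g' t)%:E)%E.
    rewrite [RHS]integral_mkcond; apply: eq_integral => t _.
    rewrite /patch /side expr1 mulN1r; case: ifPn => [|].
      by rewrite inE /= in_itv /= => /andP[? ?]; rewrite oppr_gt0 subr_lt0 (_ : t < c)// mul1r.
    rewrite notin_setE /= in_itv /= oppr_gt0 subr_lt0.
    case: ltP => tc; rewrite ?mul0r//= mul1r andbT => /negP.
    by rewrite -ltNge => tu; rewrite g'0// => /andP[? ?]; lra.
  rewrite integral_itv_bndo_bndc; last first.
    by apply: measurable_funTS; apply/measurable_EFinP; exact: continuous_measurable_fun.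
  by rewrite FTC// gu sube0.
- rewrite expr0 mulN1r.
  pose w := Num.max b c + 1.
  have cw : c < w by rewrite /w; have := le_max c b c; rewrite lexx orbT => ?; lra.
  have bw : b < w by rewrite /w; have := le_max b b c; rewrite lexx => ?; lra.
  have gw : g w = 0 by apply: g0 => /andP[? ?]; lra.
  transitivity (\int[leb1]_(t in `]c, w]) (g' t)%:E)%E.
    rewrite [RHS]integral_mkcond; apply: eq_integral => t _.
    rewrite /patch /side expr0 mul1r; case: ifPn => [|].
      by rewrite inE /= in_itv /= => /andP[? ?]; rewrite subr_gt0 (_ : c < t)// mul1r.
    rewrite notin_setE /= in_itv /= subr_gt0.
    case: ltP => tc; rewrite ?mul0r//= mul1r => /negP.
    by rewrite -ltNge => tu; rewrite g'0// => /andP[? ?]; lra.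
  rewrite integral_itv_obnd_cbnd; last first.
    by apply: measurable_funTS; apply/measurable_EFinP; exact: continuous_measurable_fun.
  by rewrite FTC// gw sub0e.
Qed.

Lemma line_integral0 (g g' : R -> R) (a b : R) :
  (forall t : R, is_derive t 1 g (g' t)) -> continuous g' ->
  (forall t, ~ (a < t < b) -> g t = 0) -> (forall t, ~ (a < t < b) -> g' t = 0) ->
  (\int[leb1]_t (g' t)%:E = 0)%E.
Proof.
move=> dg cg' g0 g'0.
(* Cut at a - 1, to the left of the support, the half-line misses only points where g' is zero. *)
have aux (t : R) : t - (a - 1) <= 0 -> g' t = 0.
  by move=> ta; apply: g'0 => /andP[? ?]; lra.
have := half_line_integral false (a - 1) dg cg' g0 g'0.
rewrite (g0 (a - 1)) ?mulr0; last by move=> /andP[? ?]; lra.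
move=> H; rewrite -[RHS]/(0%:E) -H; apply: eq_integral => t _; rewrite /side expr0 mul1r.
by case: ltP => [|/aux ->]; rewrite ?mul1r ?mulr0.
Qed.

Lemma insert_affine (j : 'I_3) (y : R * R) (h v x : R) :
  insert j y (h *: v + x) = h *: insert j (0, 0) v + insert j y x.
Proof.
rewrite /insert; case: (val j) => [|[|_]].
- by rewrite -[RHS]/(h *: v + x, h *: (0 : R) + y.1, h *: (0 : R) + y.2) !scaler0 !add0r.
- by rewrite -[RHS]/(h *: (0 : R) + y.1, h *: v + x, h *: (0 : R) + y.2) !scaler0 !add0r.
- by rewrite -[RHS]/(h *: (0 : R) + y.1, h *: (0 : R) + y.2, h *: v + x) !scaler0 !add0r.
Qed.

Lemma is_derive_insert (j : 'I_3) W (y : R * R) (t : R) : Ck 1 W ->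
  is_derive t 1 (fun t => W (insert j y t)) ('D_(unit_vec j) W (insert j y t)).
Proof.
move=> CW; apply: DeriveDef.
  apply: (derivable_comp_affine (@insert_affine j y)).
  exact: Ck_derivable CW.
exact: (derive_comp_affine _ _ _ (@insert_affine j y)).
Qed.

Lemma continuous_insert (j : 'I_3) (y : R * R) : continuous (insert j y : R -> R * R * R).
Proof.
move=> t A /nbhs_cube[r r0 rA]; apply/nbhs_ballP; exists r => // u.
rewrite /ball /= distrC => ut; apply: rA; rewrite /insert /cube.
by case: (val j) => [|[|_]] /=; rewrite !subrr normr0.
Qed.

Lemma coord_insert j (y : R * R) (t : R) : coord3 j (insert j y t) = t.
Proof. by rewrite /coord3 /insert; case: (val j) => [|[|_]]. Qed.

Lemma others_insert j (y : R * R) (t : R) : others j (insert j y t) = y.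
Proof. by case: y => a b; rewrite /others /insert; case: (val j) => [|[|_]]. Qed.

Lemma cube_insert q r j y t : cube q r (insert j y t) -> coord3 j q - r < t < coord3 j q + r.
Proof.
move=> /cube_coord/(_ j); rewrite coord_insert ltr_norml => /andP[? ?].
by apply/andP; split; lra.
Qed.

Lemma Ck1_derive_integrable W q r v : Ck 1 W -> (forall x, ~ cube q r x -> W x = 0) ->
  leb3.-integrable setT (EFin \o (fun x => 'D_v W x)).
Proof.
move=> CW W0; apply: (@continuous_cube_integrable _ q (2 * r)).
  exact: (Ck_derive v CW).
by move=> x; exact: derive_out_cube.
Qed.

Lemma integral_derive0 (j : 'I_3) W q r : Ck 1 W ->
  (forall x, ~ cube q r x -> W x = 0) ->
  (\int[leb3]_x ('D_(unit_vec j) W x)%:E = 0)%E.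
Proof.
move=> CW W0; rewrite (fubini_insert j); last exact: Ck1_derive_integrable CW W0.
apply: integral0_eq => y _.
apply: (@line_integral0 (fun t => W (insert j y t))
    (fun t => 'D_(unit_vec j) W (insert j y t)) (coord3 j q - (2 * `|r|)) (coord3 j q + 2 * `|r|)).
- by move=> t; exact: is_derive_insert.
- move=> t; apply: (@continuous_comp _ _ _ (insert j y) (fun x => 'D_(unit_vec j) W x)).
    exact: continuous_insert.
  exact: (Ck_derive (unit_vec j) CW).
- move=> t nt; apply: W0 => /cube_insert/andP[? ?]; apply: nt.
  by have := ler_norm r; have := normr_ge0 r; move=> ? ?; apply/andP; split; lra.
- move=> t nt; apply: (derive_out_cube _ W0) => /cube_insert/andP[? ?]; apply: nt.
  by have := ler_norm r; have := normr_ge0 r; move=> ? ?; apply/andP; split; lra.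
Qed.

End CompactSupport.

Section FundamentalLemma.
Context {R : realType}.

(** Finite intersections of cubes form the pi-system for Dynkin's theorem; the empty list codes the
    whole space. *)
Definition cubes (s : seq ((R * R * R) * R)) : set (R * R * R) :=
  foldr (fun p A => cube p.1 p.2 `&` A) setT s.

Definition cube_inters : set (set (R * R * R)) := [set A | exists s, A = cubes s].

Lemma cubes_cat s1 s2 : cubes (s1 ++ s2) = cubes s1 `&` cubes s2.
Proof. by elim: s1 => [|p s1 /= ->]; rewrite ?setTI ?setIA. Qed.

Lemma setI_cube_inters : setI_closed cube_inters.
Proof. by move=> A B [s1 ->] [s2 ->]; exists (s1 ++ s2); rewrite cubes_cat. Qed.

Lemma measurable_cubes s : measurable (cubes s : set (space3 R)).
Proof. by elim: s => [|p s IH] //=; apply: measurableI => //; exact: measurable_cube. Qed.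

(** Every open set is a countable union of cubes, so continuous functions, among them the three
    coordinates, are measurable for the algebra that the cubes generate. *)
Lemma g_sigma_cube_inters :
  (@measurable _ (space3 R)) = <<s cube_inters >>.
Proof.
apply/seteqP; split; last first.
  apply: smallest_sub; first exact: sigma_algebra_measurable.
  by move=> _ [s ->]; exact: measurable_cubes.
pose T := g_sigma_algebraType cube_inters.
have oT (U : set (R * R * R)) : open U -> measurable (U : set T).
  move=> /open_bigcup_cube[q [r [_ ->]]]; apply: bigcup_measurable => n _.
  by apply: sub_sigma_algebra; exists [:: (q n, r n)] => /=; rewrite setIT.
have mf (f : R * R * R -> R) : continuous f -> measurable_fun setT (f : T -> R).
  move=> cf; apply: (measurability _ (RGenOpens.measurableE R)).
  move=> _ [_ [a [b ->]] <-]; rewrite setTI.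
  by apply: oT; move/continuousP: cf; apply; exact: interval_open.
have mid : measurable_fun setT (fun x : T => (x.1.1, x.1.2, x.2) : space3 R).
  apply: measurable_fun_pair; first apply: measurable_fun_pair.
  - exact: (mf (coord3 (@Ordinal 3 0 isT)) (@cont_coord R _)).
  - exact: (mf (coord3 (@Ordinal 3 1 isT)) (@cont_coord R _)).
  - exact: (mf (coord3 (@Ordinal 3 2 isT)) (@cont_coord R _)).
move=> A mA; have := mid measurableT A mA; rewrite setTI.
by congr measurable; apply/seteqP; split=> -[[]].
Qed.

Definition bumps (s : seq ((R * R * R) * R)) n (x : R * R * R) : R :=
  foldr (fun p y => cbump p.1 p.2 n x * y) 1 s.

Lemma smooth_bumps s n : smooth (bumps s n).
Proof.
move=> m; elim: s => [|p s IH]; first exact: Ck_cst.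
by apply: Ck_mul => //; exact: smooth_cbump.
Qed.

Lemma bumps_01 s n x : 0 <= bumps s n x <= 1.
Proof.
elim: s => [|p s /andP[IH1 IH2]] /=; first by rewrite ler01 lexx.
by rewrite mulr_ge0 ?cbump_ge0//= mulr_ile1 ?cbump_ge0 ?cbump_le1.
Qed.

Lemma bumps_cvg s x : (fun n => bumps s n x) @ \oo --> (\1_(cubes s) x : R).
Proof.
elim: s => [|p s IH] /=; first by rewrite indicT; exact: cvg_cst.
rewrite indicI; apply: cvgM => //; exact: cbump_cvg.
Qed.

Lemma test_bumps q r s n (U : set (R * R * R)) : 0 < r -> cube q (2 * r) `<=` U ->
  test_function U (bumps ((q, r) :: s) n).
Proof.
move=> r0 qU; apply: (@test_function_sub _ _ _ q r).
- exact: smooth_bumps.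
- by move=> x nx /=; rewrite cbump_out// mul0r.
- move=> x H; apply: qU; apply/cube_coord => j.
  by apply: le_lt_trans (H j) _; rewrite ltr_pMl// ltrDl.
Qed.

Lemma sqint_cst_cube q r (c : R) : sqint leb3 (cube q r : set (space3 R)) (fun=> c).
Proof.
split; first exact: measurable_cst.
rewrite integral_cst; last exact: measurable_cube.
rewrite lte_mul_pinfty// ?lee_fin ?sqr_ge0//; exact: leb3_cube_fin.
Qed.

Lemma sqintS (D E : set (space3 R)) f : measurable D -> measurable E -> E `<=` D ->
  sqint leb3 D f -> sqint leb3 E f.
Proof.
move=> mD mE ED sf; apply: sqintP => //.
  by apply: measurable_funS ED _ => //; case: sf.
by apply: (integrableS mD mE ED); exact: sqint_integrable_sqr.
Qed.

(** The fundamental lemma of the calculus of variations. On a small cube, bumps tending to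
    indicators show that w has zero integral over every intersection of cubes, hence by Dynkin over
    every measurable set, so w vanishes almost everywhere there; countably many such cubes fill
    Omega. *)
Lemma integral_test0 (Omega : set (R * R * R)) (w : R * R * R -> R) : open Omega ->
  sqint leb3 (Omega : set (space3 R)) w ->
  (forall phi, test_function Omega phi ->
     Rintegral leb3 (Omega : set (space3 R)) (fun x => w x * phi x) = 0) ->
  {ae leb3, forall x, Omega x -> w x = 0}.
Proof.
move=> oO sw H; have mO := open_measurable3 oO.
have cubeH q r : 0 < r -> cube q (2 * r) `<=` Omega ->
    {ae leb3, forall x, cube q r x -> w x = 0}.
  move=> r0 qO; pose C := (cube q r : set (space3 R)).
  have mC : measurable C by exact: measurable_cube.
  have CO : C `<=` Omega.
    by move=> x [h1 [h2 h3]]; apply: qO; split; [|split]; rewrite /=; lra.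
  have iw : leb3.-integrable C (EFin \o w).
    have := sqint_mul mC (sqintS mO mC CO sw) (sqint_cst_cube q r 1).
    by apply: eq_integrable => // x _ /=; rewrite mulr1.
  have iS (A : set (space3 R)) : measurable A -> leb3.-integrable (A `&` C) (EFin \o w).
    by move=> mA; apply: integrableS iw => //; exact: measurableI.
  have G s : (\int[leb3]_(x in cubes s `&` C) (w x)%:E = 0)%E.
    (* The extra cube (q, r) at the head of the list keeps the support inside Omega, even when s is
       empty. *)
    pose phi n x := bumps ((q, r) :: s) n x.
    have mphi n : measurable_fun setT (phi n : space3 R -> R).
      apply: continuous_measurable3; exact: (smooth_bumps ((q, r) :: s) n 0%N).
    have e n : Rintegral leb3 C (fun x => w x * phi n x) = 0.
      rewrite -(H (phi n) (test_bumps s n r0 qO)).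
      rewrite -[in LHS](setIidl CO) setIC Rintegral_mkcondr; apply: eq_Rintegral => x _.
      rewrite /patch; case: ifPn => //; rewrite notin_setE => nx.
      by rewrite /phi /= cbump_out// mul0r mulr0.
    have mI : measurable_fun setT (\1_(cubes s) : space3 R -> R).
      by apply: measurable_indic; exact: measurable_cubes.
    have mw : measurable_fun C w := integ_meas iw.
    have cv := @Rintegral_dominated_cvg _ _ _ leb3 C mC
      (fun n x => w x * phi n x) (fun x => w x * \1_(cubes s) x) (fun x => `|w x|).
    have {cv} : Rintegral leb3 C (fun x => w x * phi n x) @[n --> \oo] -->
        Rintegral leb3 C (fun x => w x * \1_(cubes s) x).
      apply: cv.
      - by move=> n; apply: measurable_funM => //; exact: measurable_funTS.
      - by apply: measurable_funM => //; exact: measurable_funTS.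
      - move=> x [h1 [h2 h3]]; apply: cvgM; first exact: cvg_cst.
        have -> : (\1_(cubes s) x : R) = \1_(cubes ((q, r) :: s)) x.
          by rewrite [LHS]indicE [RHS]indicE in_setI (@mem_set _ (cube q r)).
        exact: bumps_cvg.
      - exact: integrable_norm.
      - move=> n x _; rewrite normrM ler_piMr//.
        by have /andP[a b] := bumps_01 ((q, r) :: s) n x; rewrite ger0_norm.
    under eq_fun do rewrite e.
    move=> /(cvg_unique _ (cvg_cst 0)) => /(_ (@Rhausdorff R)) E0.
    have : Rintegral leb3 (cubes s `&` C) w = 0.
      rewrite setIC Rintegral_mkcondr E0; apply: eq_Rintegral => x _.
      by rewrite /patch indicE; case: (x \in cubes s); rewrite ?mulr1 ?mulr0.
    rewrite /Rintegral => /eqP; rewrite fine_eq0; first by move/eqP.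
    exact: (integrable_fin_num (measurableI _ _ (measurable_cubes s) mC) (iS _ (measurable_cubes s))).
  have GC : (\int[leb3]_(x in C) (w x)%:E = 0)%E by have := G [::]; rewrite /= setTI.
  (* The sets A with this property form a Dynkin class containing the pi-system of cube
     intersections. *)
  have P (A : set (space3 R)) : measurable A -> (\int[leb3]_(x in A `&` C) (w x)%:E = 0)%E.
    rewrite g_sigma_cube_inters; move: A.
    apply: (@dynkin_induction _ (space3 R) cube_inters
      (fun A => \int[leb3]_(x in A `&` C) (w x)%:E = 0)%E g_sigma_cube_inters setI_cube_inters).
    - by rewrite setTI.
    - by move=> _ [s ->]; exact: G.
    - move=> A mA A0.
      have : C = (A `&` C) `|` (~` A `&` C) by rewrite -setIUl setUv setTI.
      have mAC : measurable (~` A `&` C) by apply: measurableI => //; exact: measurableC.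
      move=> CE; have := GC; rewrite {1}CE integral_setU ?A0 ?add0e//.
      + exact: measurableI.
      + by rewrite -CE; exact: measurable_int iw.
      + by apply/disj_setPS => x [[Ax _] [nAx _]].
    - move=> F mF tF F0; rewrite setI_bigcupl integral_bigcup.
      + by apply: eseries0 => n _ _; exact: F0.
      + exact: trivIset_setIr tF.
      + by move=> k; exact: measurableI.
      + rewrite -setI_bigcupl; apply: iS; exact: bigcup_measurable.
  have ae0 : ae_eq leb3 C (EFin \o w) (fun=> 0%E).
    apply: integral_ae_eq => //.
    move=> E EC mE; rewrite integral0 -[RHS](P E mE).
    by rewrite (setIidl EC).
  by apply: filterS ae0 => x /= wx xC; have [] := wx xC.
have [q [r [qO ->]]] := open_bigcup_cube oO.
suff N : leb3.-negligible (\bigcup_n ~` [set x : space3 R | cube (q n) (r n) x -> w x = 0]).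
  apply: (negligibleS _ N) => x /= nx; apply: contrapT => nb; apply: nx => -[n _ xn].
  by apply: contrapT => wx; apply: nb; exists n => //= H0; exact/wx/H0.
apply: negligible_bigcup => n.
(* A cube of nonpositive half-side is empty, so there is nothing to exclude. *)
have [r0|r0] := ltP 0 (r n); first exact: cubeH.
exists set0; split => // x /= []; move=> -[/(le_lt_trans (normr_ge0 _))].
by rewrite ltNge r0.
Qed.

End FundamentalLemma.

(** * Spinor fields and weak derivatives *)

Section Components.
Context {R : realType}.

Definition cpart (b : bool) (z : R[i]) : R := if b then complex.Im z else complex.Re z.

(** Since [b] selects the imaginary part, the real components of a field are indexed by the finite
    type ['I_4 * bool]. *)
Definition part (i : 'I_4) (b : bool) (f : spinor_field R) (x : R * R * R) : R :=
  cpart b (f x i 0).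

Lemma cpartB b (z w : R[i]) : cpart b (z - w) = cpart b z - cpart b w.
Proof. by case: b z w => -[? ?] [? ?]. Qed.

Lemma cpartD b (z w : R[i]) : cpart b (z + w) = cpart b z + cpart b w.
Proof. by case: b z w => -[? ?] [? ?]. Qed.

Lemma partB i b (f g : spinor_field R) x :
  part i b (fun x => f x - g x) x = part i b f x - part i b g x.
Proof. by rewrite /part !mxE cpartB. Qed.

Lemma part_sub i b (f g : spinor_field R) :
  part i b (fun x => f x - g x) = fun x => part i b f x - part i b g x.
Proof. by apply/funext => x; rewrite partB. Qed.

Lemma eq_cpart (z w : R[i]) : (forall b, cpart b z = cpart b w) -> z = w.
Proof. by case: z w => [a b] [c d] H; have /= -> := H true; have /= -> := H false. Qed.

Lemma eq_part (f g : spinor_field R) x :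
  (forall i b, part i b f x = part i b g x) -> f x = g x.
Proof.
move=> H; apply/matrixP => i j; rewrite (ord1 j).
by apply: eq_cpart => b; exact: H.
Qed.

Lemma normsq_part (f : spinor_field R) x :
  normsq (f x) = \sum_(p : 'I_4 * bool) part p.1 p.2 f x ^+ 2.
Proof.
rewrite /normsq -(pair_big xpredT xpredT (fun i b => part i b f x ^+ 2)) /=.
by apply: eq_bigr => i _; rewrite big_bool /part /= addrC.
Qed.

Lemma ae_forall_fin d (T : measurableType d) (mu : {measure set T -> \bar R}) (I : finType)
    (P : I -> T -> Prop) :
  (forall i, {ae mu, forall x, P i x}) -> {ae mu, forall x, forall i, P i x}.
Proof.
move=> H.
have : forall s : seq I, {ae mu, forall x, forall i, i \in s -> P i x}.
  elim=> [|i s IH]; first by apply: aeW.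
  apply: filterS2 (H i) IH => x Pi Ps k.
  by rewrite in_cons => /predU1P[->//|]; exact: Ps.
by move=> /(_ (enum I)); apply: filterS => x H1 i; apply: H1; rewrite mem_enum.
Qed.

Lemma ae_imp d (T : measurableType d) (mu : {measure set T -> \bar R}) (P Q : T -> Prop) :
  {ae mu, forall x, P x} -> (forall x, P x -> Q x) -> {ae mu, forall x, Q x}.
Proof. by move=> H PQ; apply: filterS H. Qed.

Lemma ae_imp2 d (T : measurableType d) (mu : {measure set T -> \bar R}) (P1 P2 Q : T -> Prop) :
  {ae mu, forall x, P1 x} -> {ae mu, forall x, P2 x} -> (forall x, P1 x -> P2 x -> Q x) ->
  {ae mu, forall x, Q x}.
Proof. by move=> H1 H2 PQ; apply: filterS2 H1 H2. Qed.

Section L2.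
Variables (mu : {measure set (space3 R) -> \bar R}) (D : set (space3 R)).
Hypothesis mD : measurable D.

Lemma L2P (f : spinor_field R) : L2 mu D f <-> forall i b, sqint mu D (part i b f).
Proof.
have E : (forall i b, measurable_fun D (part i b f)) ->
    L2normsq mu D f = (\sum_(p : 'I_4 * bool)
       (\int[mu]_(x in D) (part p.1 p.2 f x ^+ 2)%:E))%E.
  move=> mf; rewrite /L2normsq -ge0_integral_sum//.
  - apply: eq_integral => x _; rewrite normsq_part -sumEFin//.
  - by move=> p; apply/measurable_EFinP; exact: measurable_funX.
  - by move=> p x _; rewrite lee_fin sqr_ge0.
split=> [[mf foo] i b|H].
  have mp k c : measurable_fun D (part k c f) by have [] := mf k; case: c.
  split; first exact: mp.
  apply: le_lt_trans foo; rewrite E// (bigD1 (i, b))//= leeDl// sume_ge0// => p _.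
  by apply: integral_ge0 => x _; rewrite lee_fin sqr_ge0.
have mp k c : measurable_fun D (part k c f) by have [] := H k c.
split; first by move=> i; split; [exact: (mp i false)|exact: (mp i true)].
rewrite E//; apply/lte_sum_pinfty => p _.
by have [] := H p.1 p.2.
Qed.

Lemma L2normsqE (f : spinor_field R) : L2 mu D f ->
  L2normsq mu D f = (\sum_(p : 'I_4 * bool) sqn mu D (part p.1 p.2 f))%:E.
Proof.
move=> /L2P H; rewrite /L2normsq -sumEFin.
under [RHS]eq_bigr do rewrite sqnE//.
rewrite -ge0_integral_sum//.
- apply: eq_integral => x _; rewrite normsq_part -sumEFin//.
- by move=> p; apply/measurable_EFinP; apply: measurable_funX; case: (H p.1 p.2).
- by move=> p x _; rewrite lee_fin sqr_ge0.
Qed.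

Lemma sqn_part_le (f : spinor_field R) i b : L2 mu D f ->
  ((sqn mu D (part i b f))%:E <= L2normsq mu D f)%E.
Proof.
move=> H; rewrite L2normsqE// lee_fin (bigD1 (i, b))//= lerDl sumr_ge0// => p _.
exact: sqn_ge0.
Qed.

Lemma L2B (f g : spinor_field R) : L2 mu D f -> L2 mu D g -> L2 mu D (fun x => f x - g x).
Proof.
move=> /L2P Hf /L2P Hg; apply/L2P => i b.
have := sqintB mD (Hf i b) (Hg i b); congr sqint; apply/funext => x.
by rewrite partB.
Qed.

Lemma eq_sqint_ae (f g : space3 R -> R) : {ae mu, forall x, D x -> f x = g x} ->
  sqint mu D f -> sqint mu D g -> sqn mu D f = sqn mu D g.
Proof.
move=> fg [mf _] [mg _]; rewrite /sqn /Rintegral; congr fine.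
apply: ae_eq_integral => //.
- by apply/measurable_EFinP; exact: measurable_funX.
- by apply/measurable_EFinP; exact: measurable_funX.
- by apply: filterS fg => x fg Dx; rewrite fg.
Qed.

End L2.

End Components.

Section WeakDerivative.
Context {R : realType}.
Variable Omega : set (R * R * R).
Hypothesis oO : open Omega.
Let mO : measurable (Omega : set (space3 R)) := open_measurable3 oO.

Lemma test_support (U : set (R * R * R)) (phi : R * R * R -> R) : test_function U phi ->
  exists2 r, 0 < r & forall x, ~ cube 0 r x -> phi x = 0.
Proof.
move=> [_ /compact_bounded[M [_ HM]] _].
exists (`|M| + 2); first by rewrite ltr_wpDl.
move=> x nx; apply/eqP/negPn/negP => px0; apply: nx.
have px : closure [set x | phi x != 0] x by apply: subset_closure.
have := HM (`|M| + 1); rewrite ltr_pwDr ?ler_norm//= => /(_ isT x px).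
rewrite !prod_normE !ge_max => /andP[/andP[? ?] ?].
split; first by rewrite subr0; lra.
by split; rewrite subr0; lra.
Qed.

Lemma test_out (U : set (R * R * R)) (phi : R * R * R -> R) x : test_function U phi ->
  ~ U x -> phi x = 0.
Proof.
move=> [_ _ sU] nU; apply/eqP/negPn/negP => px; apply: nU; apply: sU.
by apply: subset_closure.
Qed.

Lemma test_derive_out (U : set (R * R * R)) (phi : R * R * R -> R) x v : test_function U phi ->
  ~ U x -> 'D_v phi x = 0.
Proof.
move=> [_ _ sU] nU; apply: derive_out.
have ox : open_nbhs x (~` closure [set y | phi y != 0]).
  by split; [exact: closed_openC (@closed_closure _ _)|move=> /sU].
apply: filterS (open_nbhs_nbhs ox) => y ny; apply/eqP/negPn/negP => py; apply: ny.
by apply: subset_closure.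
Qed.

Lemma test_Ck n (U : set (R * R * R)) (phi : R * R * R -> R) : test_function U phi -> Ck n phi.
Proof. by case=> sm _ _; exact: sm. Qed.

Lemma sqint_continuous_cube (D : set (space3 R)) (f : R * R * R -> R) q r :
  measurable D -> continuous f -> (forall x, ~ cube q r x -> f x = 0) -> sqint leb3 D f.
Proof.
move=> mD cf f0; apply: (@sqintS _ setT) => //; apply: sqintP => //.
  exact: continuous_measurable3.
apply: (@continuous_cube_integrable _ _ q r) => //.
  move=> x; under eq_fun do rewrite expr2.
  by apply: cvgM; exact: cf.
by move=> x /f0 ->; rewrite expr0n.
Qed.

Lemma sqint_test (D : set (space3 R)) U phi : measurable D -> test_function U phi ->
  sqint leb3 D phi.
Proof.
move=> mD tp; have [r r0 Hr] := test_support tp.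
apply: sqint_continuous_cube Hr => //; exact: (test_Ck 0 tp).
Qed.

Lemma sqint_dtest (D : set (space3 R)) U phi v : measurable D -> test_function U phi ->
  sqint leb3 D (fun x => 'D_v phi x).
Proof.
move=> mD tp; have [r r0 Hr] := test_support tp.
apply: (@sqint_continuous_cube _ _ 0 (2 * r)) => //.
  exact: (Ck_derive v (test_Ck 1 tp)).
by move=> x; exact: derive_out_cube.
Qed.

Definition rweak (j : 'I_3) (u v : R * R * R -> R) : Prop :=
  forall phi, test_function Omega phi ->
    Rintegral leb3 (Omega : set (space3 R)) (fun x => u x * 'D_(unit_vec j) phi x) =
    - Rintegral leb3 (Omega : set (space3 R)) (fun x => v x * phi x).

(** Test functions are real, so the complex identity splits into its real components. *)
Lemma weak_partialP j (f g : spinor_field R) : weak_partial Omega j f g <->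
  forall i b, rweak j (part i b f) (part i b g).
Proof.
have E (z : R[i]) (r : R) b : cpart b (z * r%:C) = cpart b z * r.
  by case: z => a c; case: b => /=; rewrite ?mulr0 ?subr0 ?add0r ?addr0.
have N (z : R[i]) b : cpart b (- z) = - cpart b z by case: z b => ? ? [].
have P b (h : R * R * R -> R[i]) : cpart b (cintegral Omega h) =
    Rintegral leb3 Omega (fun x => cpart b (h x)) by case: b.
split=> H.
  move=> i b phi tp; have := congr1 (cpart b) (H phi tp i); rewrite N !P.
  by under eq_Rintegral do rewrite E; under [X in - X]eq_Rintegral do rewrite E.
move=> phi tp i; apply: eq_cpart => b; rewrite N !P.
under eq_Rintegral do rewrite E; under [X in - X]eq_Rintegral do rewrite E.
exact: H.
Qed.

Lemma rweakB j u v u' v' : sqint leb3 Omega u -> sqint leb3 Omega v ->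
  sqint leb3 Omega u' -> sqint leb3 Omega v' ->
  rweak j u v -> rweak j u' v' -> rweak j (fun x => u x - u' x) (fun x => v x - v' x).
Proof.
move=> su sv su' sv' H H' phi tp.
have sp := sqint_test mO tp; have sd := sqint_dtest (unit_vec j) mO tp.
under eq_Rintegral do rewrite mulrBl.
under [X in _ = - X]eq_Rintegral do rewrite mulrBl.
rewrite !RintegralB//; try exact: (sqint_mul mO).
by rewrite (H _ tp) (H' _ tp) opprB opprK addrC.
Qed.

(** The integral of D_j (u phi) over R^3 is 0 because u phi has compact support, and both phi and
    its derivative vanish off Omega. *)
Lemma rweak_classical j u : Ck 1 u -> rweak j u (fun x => 'D_(unit_vec j) u x).
Proof.
move=> Cu phi tp; have [r r0 Hr] := test_support tp.
have Cp := test_Ck 1 tp.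
have su0 : forall x, ~ cube 0 r x -> u x * phi x = 0 by move=> x /Hr ->; rewrite mulr0.
have := integral_derive0 j (Ck_mul Cu Cp) su0.
have dE x : 'D_(unit_vec j) (fun x => u x * phi x) x =
    'D_(unit_vec j) u x * phi x + u x * 'D_(unit_vec j) phi x.
  by apply: deriveM_fun; [exact: Ck_derivable Cu|exact: Ck_derivable Cp].
have c1 : continuous (fun x => 'D_(unit_vec j) u x * phi x).
  by move=> x; apply: cvgM; [exact: (Ck_derive (unit_vec j) Cu)|exact: (Ck_continuous Cp)].
have c2 : continuous (fun x => u x * 'D_(unit_vec j) phi x).
  by move=> x; apply: cvgM; [exact: (Ck_continuous Cu)|exact: (Ck_derive (unit_vec j) Cp)].
have i1 : leb3.-integrable setT (EFin \o (fun x => 'D_(unit_vec j) u x * phi x)).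
  by apply: (continuous_cube_integrable c1 (q := 0) (r := r)) => x /Hr ->; rewrite mulr0.
have i2 : leb3.-integrable setT (EFin \o (fun x => u x * 'D_(unit_vec j) phi x)).
  apply: (continuous_cube_integrable c2 (q := 0) (r := 2 * r)) => x nx.
  by rewrite (derive_out_cube _ Hr)// mulr0.
move/(congr1 fine) => /=; rewrite -/(Rintegral leb3 setT _).
under eq_Rintegral do rewrite dE.
rewrite RintegralD//.
have e1 : Rintegral leb3 setT (fun x => 'D_(unit_vec j) u x * phi x) =
    Rintegral leb3 Omega (fun x => 'D_(unit_vec j) u x * phi x).
  rewrite [RHS]Rintegral_mkcond; apply: eq_Rintegral => x _; rewrite /patch.
  by case: ifPn => //; rewrite notin_setE => nx; rewrite (test_out tp nx) mulr0.
have e2 : Rintegral leb3 setT (fun x => u x * 'D_(unit_vec j) phi x) =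
    Rintegral leb3 Omega (fun x => u x * 'D_(unit_vec j) phi x).
  rewrite [RHS]Rintegral_mkcond; apply: eq_Rintegral => x _; rewrite /patch.
  by case: ifPn => //; rewrite notin_setE => nx; rewrite (test_derive_out _ tp nx) mulr0.
by rewrite e1 e2 => /eqP; rewrite addr_eq0 => /eqP ->; rewrite opprK.
Qed.

(** The difference v - w integrates to zero against every test function, and [integral_test0]
    applies. *)
Lemma rweak_unique j u v w : sqint leb3 Omega v -> sqint leb3 Omega w ->
  rweak j u v -> rweak j u w -> {ae leb3, forall x, Omega x -> v x = w x}.
Proof.
move=> sv sw H H'.
have : {ae leb3, forall x, Omega x -> v x - w x = 0}.
  apply: (integral_test0 oO (sqintB mO sv sw)) => phi tp.
  have sp := sqint_test mO tp.
  under eq_Rintegral do rewrite mulrBl.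
  rewrite RintegralB//; try exact: (sqint_mul mO).
  by apply/eqP; rewrite subr_eq0; apply/eqP/oppr_inj; rewrite -(H _ tp) -(H' _ tp).
by move=> H0; apply: (ae_imp H0) => x Hx /Hx /eqP; rewrite subr_eq0 => /eqP.
Qed.

Lemma weak_partial_unique j f g h : L2 leb3 Omega g -> L2 leb3 Omega h ->
  weak_partial Omega j f g -> weak_partial Omega j f h -> aeeq Omega g h.
Proof.
move=> /(L2P _ mO) Lg /(L2P _ mO) Lh /weak_partialP Wg /weak_partialP Wh.
have H : {ae leb3, forall x : space3 R, forall p : 'I_4 * bool, Omega x ->
    part p.1 p.2 g x = part p.1 p.2 h x}.
  by apply: ae_forall_fin => p; exact: (rweak_unique (Lg _ _) (Lh _ _) (Wg _ _) (Wh _ _)).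
by apply: (ae_imp H) => x Hx Ox; apply: eq_part => i b; exact: (Hx (i, b)).
Qed.

Lemma wpartialP j f : H1 Omega f ->
  L2 leb3 Omega (wpartial Omega j f) /\ weak_partial Omega j f (wpartial Omega j f).
Proof.
move=> [_ H]; have := H j.
by move=> /(xgetPex (fun=> 0)).
Qed.

Definition dtest (j : 'I_3) (phi : spinor_field R) : spinor_field R := fun x =>
  \col_i ('D_(unit_vec j) (part i false phi) x +i* 'D_(unit_vec j) (part i true phi) x).

Lemma part_dtest j phi i b x : part i b (dtest j phi) x = 'D_(unit_vec j) (part i b phi) x.
Proof. by rewrite /part /dtest !mxE; case: b. Qed.

Lemma test_field_part (phi : spinor_field R) i b : test_field phi ->
  test_function setT (part i b phi).
Proof. by move=> /(_ i)[t1 t2]; case: b. Qed.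

Lemma test_field_L2 (D : set (space3 R)) phi : measurable D -> test_field phi -> L2 leb3 D phi.
Proof.
move=> mD tp; apply/L2P => // i b.
exact: (sqint_test mD (test_field_part i b tp)).
Qed.

Lemma dtest_L2 (D : set (space3 R)) j phi : measurable D -> test_field phi ->
  L2 leb3 D (dtest j phi).
Proof.
move=> mD tp; apply/L2P => // i b.
have := sqint_dtest (unit_vec j) mD (test_field_part i b tp).
by congr sqint; apply/funext => x; rewrite part_dtest.
Qed.

Lemma dtest_weak j phi : test_field phi -> weak_partial Omega j phi (dtest j phi).
Proof.
move=> tp; apply/weak_partialP => i b.
have := rweak_classical j (test_Ck 1 (test_field_part i b tp)).
by congr rweak; apply/funext => x; rewrite part_dtest.
Qed.

Lemma weak_partialB j f g f' g' : L2 leb3 Omega f -> L2 leb3 Omega g ->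
  L2 leb3 Omega f' -> L2 leb3 Omega g' -> weak_partial Omega j f g ->
  weak_partial Omega j f' g' ->
  weak_partial Omega j (fun x => f x - f' x) (fun x => g x - g' x).
Proof.
move=> /(L2P _ mO) Lf /(L2P _ mO) Lg /(L2P _ mO) Lf' /(L2P _ mO) Lg'.
move=> /weak_partialP Wf /weak_partialP Wf'; apply/weak_partialP => i b.
have := rweakB (Lf i b) (Lg i b) (Lf' i b) (Lg' i b) (Wf i b) (Wf' i b).
by congr rweak; apply/funext => x; rewrite partB.
Qed.

(** [wpartial] is a choice among representatives, so its additivity holds only almost everywhere and
    comes from the uniqueness of weak derivatives. *)
Lemma wpartialB_test j phi f : test_field phi -> H1 Omega f ->
  L2 leb3 Omega (wpartial Omega j (fun x => phi x - f x)) /\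
  aeeq Omega (wpartial Omega j (fun x => phi x - f x))
    (fun x => dtest j phi x - wpartial Omega j f x).
Proof.
move=> tp Hf; have [Lf _] := Hf.
have Lphi := test_field_L2 mO tp.
have HB : H1 Omega (fun x => phi x - f x).
  split; first exact: L2B.
  move=> k; have [Lw Ww] := wpartialP k Hf.
  exists (fun x => dtest k phi x - wpartial Omega k f x); split.
    by apply: L2B => //; exact: dtest_L2.
  by apply: weak_partialB => //; [exact: dtest_L2|exact: dtest_weak].
have [Lw Ww] := wpartialP j Hf; have [LB WB] := wpartialP j HB.
split=> //; apply: (weak_partial_unique LB _ WB).
  by apply: L2B => //; exact: dtest_L2.
by apply: weak_partialB => //; [exact: dtest_L2|exact: dtest_weak].
Qed.

End WeakDerivative.

Section TraceApproximation.
Context {R : realType}.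
Variable Omega : set (R * R * R).
Hypothesis oO : open Omega.
Variable sigma : {measure set (space3 R) -> \bar R}.
Let mO : measurable (Omega : set (space3 R)) := open_measurable3 oO.

Lemma measurable_bdry : measurable (bdry Omega : set (space3 R)).
Proof.
apply: measurableD.
  by apply: closed_measurable3; exact: closed_closure.
by apply: open_measurable3; exact: open_interior.
Qed.

Lemma cvg_ereal0 (u : nat -> R) (v : nat -> \bar R) : (forall n, 0 <= u n) ->
  (forall n, (u n)%:E <= v n)%E -> v n @[n --> \oo] --> 0%E ->
  u n @[n --> \oo] --> (0 : R).
Proof.
move=> u0 uv v0; have : (fun n => (u n)%:E) @ \oo --> (0%:E : \bar R).
  apply: (@squeeze_cvge _ _ _ _ (fun=> 0%E) _ v) => //; last exact: cvg_cst.
  by apply: nearW => n; rewrite lee_fin u0 uv.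
by move/fine_cvg.
Qed.

(** The H^1 norm in [trace] involves [wpartial] of a difference; replacing it by the classical
    derivative of the test field minus [wpartial] of f gives limits to which the product rule for
    test fields can be applied. *)
Lemma trace_approx f g : trace Omega sigma f g ->
  exists phi : nat -> spinor_field R, [/\ forall n, test_field (phi n),
   forall i b, sqn leb3 Omega (fun x => part i b (phi n) x - part i b f x) @[n --> \oo] --> (0 : R),
   forall j i b, sqn leb3 Omega (fun x => 'D_(unit_vec j) (part i b (phi n)) x -
      part i b (wpartial Omega j f) x) @[n --> \oo] --> (0 : R) &
   L2normsq sigma (bdry Omega) (fun x => phi n x - g x) @[n --> \oo] --> 0%E].
Proof.
move=> [Hf [Lg [phi [tp c1 c2]]]]; exists phi; have [Lf _] := Hf.
have Ld n : L2 leb3 Omega (fun x => phi n x - f x).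
  by apply: L2B => //; exact: test_field_L2.
have Lw j n := (wpartialB_test oO j (tp n) Hf).1.
have LE j n := (wpartialB_test oO j (tp n) Hf).2.
have ge0 (u : spinor_field R) : (0 <= L2normsq leb3 Omega u)%E.
  apply: integral_ge0 => x _; rewrite lee_fin normsq_part sumr_ge0// => p _.
  exact: sqr_ge0.
split=> // [i b|j i b].
- apply: cvg_ereal0 c1 => n; first exact: sqn_ge0.
  have := sqn_part_le mO i b (Ld n); rewrite part_sub.
  by move=> /le_trans; apply; rewrite leeDl// sume_ge0.
- apply: cvg_ereal0 c1 => n; first exact: sqn_ge0.
  have -> : sqn leb3 Omega (fun x => 'D_(unit_vec j) (part i b (phi n)) x -
      part i b (wpartial Omega j f) x) =
      sqn leb3 Omega (part i b (wpartial Omega j (fun x => phi n x - f x))).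
    apply: (eq_sqint_ae mO).
    + apply: (ae_imp (LE j n)) => x Hx Ox.
      have := partB i b (dtest j (phi n)) (wpartial Omega j f) x.
      by rewrite part_dtest => <-; rewrite /part (Hx Ox).
    + have /(L2P _ mO) H := L2B mO (dtest_L2 j mO (tp n)) (wpartialP j Hf).1.
      by have := H i b; congr sqint; apply/funext => x; rewrite partB part_dtest.
    + by have /(L2P _ mO) H := Lw j n; exact: H.
  apply: le_trans (sqn_part_le mO i b (Lw j n)) _.
  by rewrite /H1normsq (bigD1 j)//= addeCA leeDl// adde_ge0// sume_ge0// => k _; exact: ge0.
Qed.

End TraceApproximation.

(** * Graph charts of the boundary *)

Section Chart.
Context {R : realType}.
Variables (k : 'I_3) (s : bool) (gamma : R * R -> R).
Hypothesis Cgamma : Ck 2 gamma.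
Local Notation sg := ((-1) ^+ s : R).

Definition glift (y : R * R) : R * R * R := insert k y (gamma y).
Definition height (x : R * R * R) : R := sg * (coord3 k x - gamma (others k x)).
(** The outward normal times the area density, so that [nvec j y] dy is the j-th component of the
    normal times the surface element. *)
Definition nvec (j : 'I_3) (y : R * R) : R := sg * coord3 j (insert k (grad2 gamma y) (-1)).

Lemma sgsg : sg * sg = 1.
Proof. by rewrite -expr2 sqrr_sign. Qed.

Lemma others_linear (h : R) (v x : R * R * R) :
  others k (h *: v + x) = h *: others k v + others k x.
Proof. by rewrite /others; case: (val k) => [|[|_]]. Qed.

Lemma continuous_others : continuous (others k : R * R * R -> R * R).
Proof.
move=> x A /nbhs_ballP[r r0 rA]; apply/nbhs_cube; exists r => // y [h1 [h2 h3]].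
by apply: rA; rewrite /others; case: (val k) => [|[|_]]; split; rewrite /ball /= distrC.
Qed.

Lemma Ck_coord n j : Ck n (coord3 j : R * R * R -> R).
Proof.
have Cid : Ck n (fun t : R => t).
  case: n => [|n]; first by move=> x; exact: cvg_id.
  by apply: (@Ck_intro1 _ _ _ (fun=> 1)); exact: Ck_cst.
have := Ck_affine_coord j 1 0 Cid; congr Ck.
by apply/funext => x; rewrite mul1r addr0.
Qed.

Lemma Ck_height : Ck 2 height.
Proof.
apply: Ck_scale; apply: Ck_sub; first exact: Ck_coord.
by apply: (Ck_comp_affine others_linear) => //; exact: continuous_others.
Qed.

Lemma Ck_nvec j : Ck 1 (nvec j).
Proof.
apply: Ck_scale; rewrite /coord3 /insert.
have d1 := Ck_derive ((1 : R), (0 : R)) Cgamma.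
have d2 := Ck_derive ((0 : R), (1 : R)) Cgamma.
have c1 : Ck 1 (fun _ : R * R => -1 : R) by exact: Ck_cst.
case: (val k) => [|[|_]]; case: (val j) => [|[|_]].
- exact: c1.
- exact: d1.
- exact: d2.
- exact: d1.
- exact: c1.
- exact: d2.
- exact: d1.
- exact: d2.
- exact: c1.
Qed.

Lemma Ck_nvec_others j : Ck 1 (fun x => nvec j (others k x)).
Proof.
apply: (Ck_comp_affine others_linear); first exact: continuous_others.
exact: Ck_nvec.
Qed.

Lemma derive_coord j (v x : R * R * R) : 'D_v (coord3 j) x = coord3 j v.
Proof.
have := @derive_comp_affine R _ _ (@id R) (coord3 j) (coord3 j) x v.
rewrite derive_id; apply => h w z; rewrite /coord3.
by case: (val j) => [|[|_]].
Qed.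

Lemma derive_height j x : 'D_(unit_vec j) height x = - nvec j (others k x).
Proof.
have dg : derivable (fun x => gamma (others k x)) x (unit_vec j).
  apply: (derivable_comp_affine others_linear); exact: Ck_derivable Cgamma.
have dc : derivable (coord3 k : R * R * R -> R) x (unit_vec j).
  exact: Ck_derivable (Ck_coord 1 k).
have -> : 'D_(unit_vec j) height x = sg * ('D_(unit_vec j) (coord3 k) x -
    'D_(unit_vec j) (fun x => gamma (others k x)) x).
  by rewrite -(deriveB dc dg) -[RHS](deriveZ sg (derivableB dc dg)).
rewrite derive_coord (derive_comp_affine _ _ _ others_linear).
rewrite /nvec -mulrN; congr (_ * _).
rewrite /coord3 /insert /unit_vec /insert /others /grad2.
move: (val k) (val j) => [|[|?]] [|[|?]] /=.
all: by rewrite ?opprK ?sub0r ?derive0 ?subr0.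
Qed.

Lemma nvec_k y : nvec k y = - sg.
Proof. by rewrite /nvec coord_insert mulrN1. Qed.

Lemma derive_nvec_k j x : 'D_(unit_vec k) (fun x => nvec j (others k x)) x = 0.
Proof.
rewrite (derive_comp_affine _ _ _ others_linear).
have -> : others k (unit_vec k) = (0 : R * R).
  by rewrite /unit_vec others_insert.
exact: derive0.
Qed.

(** C^1 approximations of the indicator of the side where [height] is positive: with them one can
    integrate by parts over R^3, without a boundary. *)
Definition cutn (n : nat) (x : R * R * R) : R := ramp (n%:R * height x).

Lemma Ck_cutn n : Ck 1 (cutn n).
Proof.
apply: (Ck1_comp (@is_derive_ramp R) (@continuous_ramp' R)).
by apply: Ck_scale; apply: Ck_pred; exact: Ck_height.
Qed.

Lemma derive_cutn n j x :
  'D_(unit_vec j) (cutn n) x = - (ramp' (n%:R * height x) * n%:R * nvec j (others k x)).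
Proof.
have dh : derivable height x (unit_vec j) := Ck_derivable Ck_height.
have d1 : is_derive x (unit_vec j) (fun x => n%:R * height x) (n%:R * - nvec j (others k x)).
  have C1 : Ck 1 (fun x => n%:R * height x).
    by apply: Ck_scale; apply: Ck_pred; exact: Ck_height.
  apply: DeriveDef; first exact: Ck_derivable C1.
  have dc : derivable (fun _ : R * R * R => n%:R : R) x (unit_vec j) by exact: derivable_cst.
  by rewrite (deriveM_fun dc dh) derive_cst mul0r add0r derive_height.
have := @is_derive_comp1 _ _ (fun x => n%:R * height x) ramp x _ _ _ (is_derive_ramp (n%:R * height x)) d1.
by move=> [_ ->]; rewrite mulrA mulrN.
Qed.

Lemma cutn_01 n x : 0 <= cutn n x <= 1.
Proof. exact: ramp_01. Qed.

Lemma cutn_cvg x : cutn n x @[n --> \oo] --> ((0 < height x)%R%:R : R).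
Proof.
have [h0|h0] := ltP 0 (height x); last first.
  rewrite (_ : (fun n => _) = fun=> (0 : R)); first exact: cvg_cst.
  by apply/funext => n; rewrite /cutn ramp_le0// mulr_ge0_le0.
apply: cvg_near_cst; near=> n; rewrite /cutn ramp_ge1//.
rewrite -ler_pdivrMr//; near: n; exact: nbhs_infty_ger.
Unshelve. all: by end_near.
Qed.

(** The vector field e_j + sg [nvec j] e_k annihilates [height], hence [cutn n], and it is
    divergence-free because [nvec j] does not depend on x_k. So the integral of [cutn n] times its
    derivative of W is 0, uniformly over n and without any term in n. *)
Lemma tangential j W q r n : Ck 1 W -> (forall x, ~ cube q r x -> W x = 0) ->
  Rintegral leb3 setT (fun x => cutn n x * 'D_(unit_vec j) W x) =
  Rintegral leb3 setT (fun x => cutn n x * (- sg * nvec j (others k x) * 'D_(unit_vec k) W x)).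
Proof.
move=> CW W0.
have Cc := Ck_cutn n; have CN := Ck_nvec_others j.
have CNW := Ck_mul CN CW.
have z1 : forall x, ~ cube q r x -> cutn n x * W x = 0 by move=> x /W0 ->; rewrite mulr0.
have z2 : forall x, ~ cube q r x -> cutn n x * (nvec j (others k x) * W x) = 0.
  by move=> x /W0 ->; rewrite !mulr0.
have I1 := congr1 fine (integral_derive0 j (Ck_mul Cc CW) z1).
have I2 := congr1 fine (integral_derive0 k (Ck_mul Cc CNW) z2).
have i1 := Ck1_derive_integrable (unit_vec j) (Ck_mul Cc CW) z1.
have i2 := Ck1_derive_integrable (unit_vec k) (Ck_mul Cc CNW) z2.
rewrite /= -/(Rintegral _ _ _) in I1; rewrite /= -/(Rintegral _ _ _) in I2.
have e1 x : 'D_(unit_vec j) (fun x => cutn n x * W x) x =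
    cutn n x * 'D_(unit_vec j) W x - ramp' (n%:R * height x) * n%:R * nvec j (others k x) * W x.
  rewrite deriveM_fun; [|exact: Ck_derivable Cc|exact: Ck_derivable CW].
  by rewrite derive_cutn mulNr addrC.
have e2 x : 'D_(unit_vec k) (fun x => cutn n x * (nvec j (others k x) * W x)) x =
    cutn n x * (nvec j (others k x) * 'D_(unit_vec k) W x) +
    sg * (ramp' (n%:R * height x) * n%:R * nvec j (others k x) * W x).
  rewrite deriveM_fun; [|exact: Ck_derivable Cc|exact: Ck_derivable CNW].
  rewrite derive_cutn nvec_k deriveM_fun; [|exact: Ck_derivable CN|exact: Ck_derivable CW].
  by rewrite derive_nvec_k; ring.
have iz : leb3.-integrable setT (EFin \o (fun x => sg * 'D_(unit_vec k) (fun x => cutn n x * (nvec j (others k x) * W x)) x)).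
  exact: integZ.
(* In this combination the two terms containing [ramp'] cancel because sg^2 = 1. *)
have -> : Rintegral leb3 setT (fun x => cutn n x * 'D_(unit_vec j) W x) =
   Rintegral leb3 setT (fun x => 'D_(unit_vec j) (fun x => cutn n x * W x) x) +
   sg * Rintegral leb3 setT (fun x => 'D_(unit_vec k) (fun x => cutn n x * (nvec j (others k x) * W x)) x) +
   Rintegral leb3 setT (fun x => cutn n x * (- sg * nvec j (others k x) * 'D_(unit_vec k) W x)).
  rewrite -RintegralZl// -RintegralD// -RintegralD//.
  - apply: eq_Rintegral => x _; rewrite e1 e2 mulrDr [sg * (sg * _)]mulrA sgsg mul1r.
    ring.
  - exact: integD.
  - apply: (@continuous_cube_integrable _ _ q (2 * r)) => [x|x nx]; last first.
      by rewrite (derive_out_cube _ W0)// !mulr0.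
    apply: cvgM; first exact: (Ck_continuous Cc).
    apply: cvgM; last exact: (Ck_derive (unit_vec k) CW).
    by apply: cvgM; [exact: cvg_cst|exact: (Ck_continuous CN)].
by rewrite I1 I2 mulr0 !add0r.
Qed.

End Chart.

Section ChartDivergence.
Context {R : realType}.
Variables (k : 'I_3) (s : bool) (gamma : R * R -> R).
Hypothesis Cgamma : Ck 2 gamma.
Local Notation sg := ((-1) ^+ s : R).
Local Notation height := (height k s gamma).
Local Notation nvec := (nvec k s gamma).
Local Notation glift := (glift k gamma).
Notation leb1 := (@lebesgue_measure R).

Lemma measurable_height_pos : measurable [set x : space3 R | 0 < height x].
Proof.
have := continuous_measurable3 (Ck_continuous (Ck_height k s Cgamma)).
move=> /(_ measurableT `]0, +oo[%classic (measurable_itv _)); rewrite setTI.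
by congr measurable; apply/seteqP; split=> x /=; rewrite in_itv /= andbT.
Qed.

Lemma measurable_side_height :
  measurable_fun setT (fun x : space3 R => (0 < height x)%R%:R : R).
Proof.
have : measurable_fun setT (\1_[set x : space3 R | 0 < height x] : space3 R -> R).
  exact: (measurable_indic measurable_height_pos).
by congr measurable_fun; apply/funext => x; rewrite indicE mem_setE.
Qed.

(** The divergence theorem on one side of a graph. Letting n grow in [tangential] replaces the
    derivative along x_j by a multiple of the one along x_k, constant on each line parallel to the
    axis k; Fubini then reduces to these lines. *)
Lemma chart_divergence j W q r : Ck 1 W -> (forall x, ~ cube q r x -> W x = 0) ->
  Rintegral leb3 setT (fun x => (0 < height x)%R%:R * 'D_(unit_vec j) W x) =
  Rintegral leb2 setT (fun y => nvec j y * W (glift y)).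
Proof.
move=> CW W0.
have CN := Ck_nvec_others k s Cgamma j.
have cD v : continuous (fun x => 'D_v W x) := Ck_derive v CW.
have iD v := Ck1_derive_integrable v CW W0.
pose G x := - sg * nvec j (others k x) * 'D_(unit_vec k) W x.
have cG : continuous G.
  move=> x; apply: cvgM; last exact: cD.
  by apply: cvgM; [exact: cvg_cst|exact: (Ck_continuous CN)].
have G0 x : ~ cube q (2 * r) x -> G x = 0.
  by move=> nx; rewrite /G (derive_out_cube _ W0)// mulr0.
have iG := continuous_cube_integrable cG G0.
have mstep := measurable_side_height.
have lim (F : R * R * R -> R) : continuous F -> leb3.-integrable setT (EFin \o F) ->
    Rintegral leb3 setT (fun x => cutn k s gamma n x * F x) @[n --> \oo] -->
    Rintegral leb3 setT (fun x => (0 < height x)%R%:R * F x).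
  move=> cF iF; apply: (@Rintegral_dominated_cvg _ _ _ leb3 setT measurableT _ _ (fun x => `|F x|)).
  - move=> n; apply: measurable_funM; last exact: continuous_measurable3.
    apply: continuous_measurable3; exact: (Ck_continuous (Ck_cutn k s Cgamma n)).
  - by apply: measurable_funM => //; exact: continuous_measurable3.
  - move=> x _; apply: cvgM; last exact: cvg_cst.
    exact: cutn_cvg.
  - exact: integrable_norm.
  - move=> n x _; rewrite normrM ler_piMl//.
    by have /andP[a b] := cutn_01 k s gamma n x; rewrite ger0_norm.
have L1 := lim _ (cD (unit_vec j)) (iD (unit_vec j)).
have L2 := lim _ cG iG.
have E n : Rintegral leb3 setT (fun x => cutn k s gamma n x * 'D_(unit_vec j) W x) =
  Rintegral leb3 setT (fun x => cutn k s gamma n x * G x) := @tangential _ k s gamma Cgamma j W q r n CW W0.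
rewrite (funext E) in L1.
have {L1 L2 E lim} -> : Rintegral leb3 setT (fun x => (0 < height x)%R%:R * 'D_(unit_vec j) W x) =
    Rintegral leb3 setT (fun x => (0 < height x)%R%:R * G x).
  exact: (cvg_unique (@Rhausdorff R) L1 L2).
have iG' : leb3.-integrable setT (EFin \o (fun x => (0 < height x)%R%:R * G x)).
  apply: (le_integ measurableT _ iG).
    by apply: measurable_funM => //; exact: continuous_measurable3.
  by move=> x _; rewrite normrM ler_piMl//; case: (0 < height x); rewrite ?normr1 ?normr0.
rewrite /Rintegral (fubini_insert k iG'); congr fine; apply: eq_integral => y _.
pose g t := - sg * nvec j y * W (insert k y t).
pose g' t := - sg * nvec j y * 'D_(unit_vec k) W (insert k y t).
have dg (t : R) : is_derive t 1 g (g' t).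
  have [d1 d2] := is_derive_insert k y t CW.
  have dc : derivable (fun _ : R => - sg * nvec j y : R) t (1 : R) by exact: derivable_cst.
  apply: DeriveDef; first exact: (derivableM dc d1).
  by rewrite /g (deriveM_fun dc d1) derive_cst mul0r add0r d2.
have cg' : continuous g'.
  move=> t; apply: cvgM; first exact: cvg_cst.
  apply: (@continuous_comp _ _ _ (insert k y) (fun x => 'D_(unit_vec k) W x)).
    exact: continuous_insert.
  exact: cD.
have rr : r <= `|r| := ler_norm r.
have r0 : 0 <= `|r| := normr_ge0 r.
(* On the line over y the chosen side of the graph is a half-line ending at gamma y. *)
have := @half_line_integral _ s g g' (coord3 k q - 2 * `|r|) (coord3 k q + 2 * `|r|)
  (gamma y) dg cg' _ _.
rewrite (_ : - sg * g (gamma y) = nvec j y * W (glift y)); last first.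
  rewrite /g /glift mulNr mulNr mulNr mulrN opprK mulrA mulrA sgsg mul1r.
  by [].
move=> <-.
- apply: eq_integral => t _; rewrite /side /height /G /g' coord_insert others_insert.
  by congr (_%:E).
- move=> t nt; rewrite /g W0 ?mulr0// => /cube_insert/andP[? ?]; apply: nt.
  by apply/andP; split; lra.
- move=> t nt; rewrite /g' (derive_out_cube _ W0) ?mulr0// => /cube_insert/andP[? ?].
  by apply: nt; apply/andP; split; lra.
Qed.

Variables (Omega U : set (R * R * R)).
Hypothesis oO : open Omega.
Hypothesis chart : graph_chart Omega U k s gamma.
Let mO : measurable (Omega : set (space3 R)) := open_measurable3 oO.

Lemma chart_OmegaP x : U x -> Omega x <-> 0 < height x.
Proof.
move=> Ux; have [_ _ E] := chart; split=> H.
  by have : (Omega `&` U) x by []; rewrite E => -[].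
by have : (U `&` [set x | 0 < height x]) x by []; rewrite -E => -[].
Qed.

Lemma chart_divergence_Omega j W q r : Ck 1 W -> (forall x, ~ cube q r x -> W x = 0) ->
  cube q (2 * r) `<=` U ->
  Rintegral leb3 Omega (fun x => 'D_(unit_vec j) W x) =
  Rintegral leb2 setT (fun y => nvec j y * W (glift y)).
Proof.
move=> CW W0 qU; rewrite -(chart_divergence j CW W0) [LHS]Rintegral_mkcond.
apply: eq_Rintegral => x _; rewrite /patch.
have [Ux|nU] := pselect (cube q (2 * r) x); last first.
  by rewrite (derive_out_cube _ W0)// mulr0; case: ifP.
have H := chart_OmegaP (qU _ Ux).
case: ifPn => [|]; first by rewrite inE => /H ->; rewrite mul1r.
by rewrite notin_setE => nO; case: ltP; rewrite ?mul0r// => /H.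
Qed.

Lemma glift_bdry y : U (glift y) -> bdry Omega (glift y).
Proof.
move=> Uy; have [oU _ _] := chart; split; last first.
  move=> /interior_subset /(chart_OmegaP Uy).
  by rewrite /height coord_insert others_insert subrr mulr0 ltxx.
move=> B nB.
have /nbhs_cube[r r0 rU] := open_nbhs_nbhs (conj oU Uy).
have /nbhs_cube[r' r'0 rB] := nB.
pose e := Num.min r r' / 2.
have m0 : 0 < Num.min r r' by rewrite lt_min r0.
have e0 : 0 < e by rewrite divr_gt0.
have er : e < r by rewrite /e ltr_pdivrMr// (le_lt_trans (_ : _ <= r))// ?ge_min ?lexx//; lra.
have er' : e < r' by rewrite /e ltr_pdivrMr// (le_lt_trans (_ : _ <= r'))// ?ge_min ?lexx ?orbT//; lra.
(* This point has height e > 0, hence lies in Omega, at distance e from the graph point. *)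
pose x := insert k y (gamma y + sg * e).
have H t : e < t -> cube (glift y) t x.
  move=> et; apply/cube_coord => i; apply: le_lt_trans et.
  have N : `|sg * e| = e by rewrite normrM normrX normrN1 expr1n mul1r gtr0_norm.
  rewrite /x /glift /coord3 /insert; case: (val k) => [|[|_]]; case: (val i) => [|[|_]] /=;
  by rewrite ?subrr ?normr0 ?(ltW e0)// addrC addKr N.
exists x; split; last by apply/rB/H.
apply/(chart_OmegaP (rU _ (H _ er))); rewrite /height coord_insert others_insert.
by rewrite addrC addKr mulrA sgsg mul1r.
Qed.

End ChartDivergence.

(** * Comparison of the surface measure with Lebesgue measure in a chart *)

Section BoundaryTransfer.
Context {R : realType}.
Variables (Omega U : set (R * R * R)) (k : 'I_3) (s : bool) (gamma : R * R -> R).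
Hypothesis oO : open Omega.
Hypothesis chart : graph_chart Omega U k s gamma.
Let Cgamma : Ck 2 gamma. Proof. by case: chart. Qed.
Variables (sigma : {measure set (space3 R) -> \bar R}).
Hypothesis surf : surface_measure Omega sigma.
Variables (q : R * R * R) (r : R).
Hypothesis qU : cube q r `<=` U.
Local Notation glift := (glift k gamma).
Notation leb1 := (@lebesgue_measure R).

Definition chart_patch : set (space2 R) := [set y | cube q r (glift y)].
Local Notation Y := chart_patch.

Lemma continuous_measurable2 (f : R * R -> R) : continuous f ->
  measurable_fun setT (f : space2 R -> R).
Proof.
move=> cf.
have c3 : continuous (fun x : R * R * R => f x.1).
  by move=> x; apply: (@continuous_comp _ _ _ fst f); [exact: cvg_fst|exact: cf].
have mp : measurable_fun setT (fun y : space2 R => (y, 0) : space3 R).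
  by apply: measurable_fun_pair; [exact: measurable_id|exact: measurable_cst].
exact: (measurableT_comp (continuous_measurable3 c3) mp).
Qed.

Lemma measurable_glift : measurable_fun setT (glift : space2 R -> space3 R).
Proof.
have mp : measurable_fun setT (fun y : space2 R => (y, gamma y) : space3 R).
  apply: measurable_fun_pair; first exact: measurable_id.
  exact: (continuous_measurable2 (Ck_continuous Cgamma)).
exact: (measurableT_comp (measurable_insert k) mp).
Qed.

Lemma measurable_patch : measurable Y.
Proof.
have := measurable_glift measurableT (measurable_cube q r).
by rewrite setTI.
Qed.

Lemma patch_fin : (leb2 Y < +oo)%E.
Proof.
pose I (a : R) := `]a - r, a + r[%classic.
pose c := others k q.
have mI a : measurable (I a : set (measurableTypeR R)) by exact: measurable_itv.
have fI a : (leb1 (I a) < +oo)%E.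
  by rewrite lebesgue_measure_itv /=; case: ifP => _; rewrite ?ltry// -EFinB ltry.
have YI : Y `<=` I c.1 `*` I c.2.
  move=> y; rewrite /Y /= /glift /insert /cube /I /c /others.
  case: (val k) => [|[|_]] /= [h1 [h2 h3]]; move: h1 h2 h3; rewrite !ltr_norml;
    move=> /andP[? ?] /andP[? ?] /andP[? ?]; rewrite /= !in_itv /=;
    by split; apply/andP; split; lra.
apply: (@le_lt_trans _ _ (leb2 (I c.1 `*` I c.2))).
  apply: le_measure => //; rewrite inE; first exact: measurable_patch.
  exact: measurableX.
have -> : leb2 (I c.1 `*` I c.2) = (leb1 (I c.1) * leb1 (I c.2))%E.
  exact: (@product_measure1E _ _ _ _ _ leb1 leb1).
by rewrite lte_mul_pinfty// ge0_fin_numE.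
Qed.

Lemma area_density_ge1 y : 1 <= area_density gamma y.
Proof.
rewrite /area_density -[leLHS]sqrtr1 ler_wsqrtr//.
by rewrite -addrA lerDl addr_ge0 ?sqr_ge0.
Qed.

Lemma measurable_area_density : measurable_fun setT (area_density gamma : space2 R -> R).
Proof.
apply: continuous_measurable2 => y; rewrite /area_density.
apply: (@continuous_comp _ _ _ (fun y => 1 + (grad2 gamma y).1 ^+ 2 + (grad2 gamma y).2 ^+ 2) Num.sqrt);
  last exact: sqrt_continuous.
have d1 := Ck_continuous (Ck_derive ((1 : R), (0 : R)) Cgamma).
have d2 := Ck_continuous (Ck_derive ((0 : R), (1 : R)) Cgamma).
apply: cvgD; last first.
  by under eq_fun do rewrite expr2; apply: cvgM; exact: d2.
apply: cvgD; first exact: cvg_cst.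
by under eq_fun do rewrite expr2; apply: cvgM; exact: d1.
Qed.

(** The area density is at least 1. Null sets and L^2 convergence thus pass from the boundary to the
    parameter domain of the chart. *)
Lemma sigma_patch_ge (A : set (space3 R)) : measurable A ->
  (leb2 (glift @^-1` A `&` Y) <= sigma A)%E.
Proof.
move=> mA; have [_ surfE] := surf.
have mC := measurable_cube q r.
have mAC : measurable (A `&` cube q r : set (space3 R)) by exact: measurableI.
apply: (@le_trans _ _ (sigma (A `&` cube q r))); last first.
  by apply: le_measure; rewrite ?inE//; exact: subIsetl.
rewrite (surfE U k s gamma chart)//; last by apply: subset_trans qU; exact: subIsetr.
have mB : measurable (glift @^-1` A `&` Y).
  apply: measurableI; last exact: measurable_patch.
  by have := measurable_glift measurableT mA; rewrite setTI.
have -> : leb2 (glift @^-1` A `&` Y) = (\int[leb2]_(y in glift @^-1` A `&` Y) 1)%E.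
  by rewrite integral_cst// mul1e.
apply: ge0_le_integral => //.
- by apply/measurable_EFinP; apply: measurable_funTS; exact: measurable_area_density.
- by move=> y _; rewrite lee_fin area_density_ge1.
Qed.

Lemma ae_patch (P : R * R * R -> Prop) : {ae sigma, forall x, P x} ->
  {ae leb2, forall y, Y y -> P (glift y)}.
Proof.
move=> [A [mA A0 PA]]; exists (glift @^-1` A `&` Y); split.
- apply: measurableI; last exact: measurable_patch.
  by have := measurable_glift measurableT mA; rewrite setTI.
- by apply/eqP; rewrite eq_le measure_ge0 andbT -A0 sigma_patch_ge.
- move=> y /= nP; split; last by apply: contrapT => nY; apply: nP.
  by apply: PA => /= Py; apply: nP.
Qed.

(** By [sigma_patch_ge], the image under [glift] of Lebesgue measure on the patch is a measure
    bounded by sigma; extending f by zero makes both integrals run over R^3. *)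
Lemma patch_integral_le (f : space3 R -> \bar R) : measurable_fun (bdry Omega) f ->
  (forall x, 0 <= f x)%E ->
  (\int[leb2]_(y in Y) f (glift y) <= \int[sigma]_(x in bdry Omega) f x)%E.
Proof.
move=> mf f0; have mC := measurable_cube q r; have mb := measurable_bdry Omega.
pose E : set (space3 R) := bdry Omega `&` cube q r.
have mE : measurable (E : set (space3 R)) by exact: measurableI.
pose f' : space3 R -> \bar R := f \_ E.
have mf' : measurable_fun setT f'.
  apply/(measurable_restrictT _ mE); apply: measurable_funS mf => //; exact: subIsetl.
have f'0 x : (0 <= f' x)%E by rewrite /f' /patch; case: ifP.
have mY := measurable_patch.
apply: (@le_trans _ _ (\int[sigma]_x f' x)%E); last first.
  rewrite -integral_mkcond; apply: ge0_subset_integral => //; exact: subIsetl.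
have lE y : f' (glift y) = ((f \o glift) \_ Y) y.
  rewrite /f' /patch; case: ifPn.
    by rewrite inE => -[_ yC]; rewrite mem_set.
  rewrite notin_setE => nE; rewrite memNset// => yY; apply: nE; split=> //.
  by apply: (glift_bdry chart); exact: qU.
have -> : (\int[leb2]_(y in Y) f (glift y) =
    \int[mrestr leb2 mY]_y f' (glift y))%E.
  under [RHS]eq_integral do rewrite lE.
  rewrite -[RHS]integral_mkcond; apply: eq_measure_integral => A mA AY.
  by rewrite /= /mrestr (setIidl AY).
have -> : (\int[mrestr leb2 mY]_y f' (glift y) =
    \int[pushforward (mrestr leb2 mY) (glift : space2 R -> space3 R)]_x f' x)%E.
  have := ge0_integral_pushforward measurable_glift (mrestr leb2 mY) (D := setT) (f := f') measurableT mf'.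
  by rewrite preimage_setT => H; apply/esym/H => y _; exact: f'0.
have le A : measurable A ->
    (pushforward (mrestr leb2 mY) (glift : space2 R -> space3 R) A <= sigma A)%E.
  exact: sigma_patch_ge.
by apply: (ge0_le_measure_integral le) => //; exact: measurable_glift.
Qed.

End BoundaryTransfer.

Lemma cvg_sumr {R : realType} (I : Type) (s : seq I) (F : nat -> I -> R) (L : I -> R) :
  (forall i, F n i @[n --> \oo] --> L i) ->
  \sum_(i <- s) F n i @[n --> \oo] --> \sum_(i <- s) L i.
Proof.
move=> H; elim: s => [|i s IH].
  by under eq_fun do rewrite big_nil; rewrite big_nil; exact: cvg_cst.
by under eq_fun do rewrite big_cons; rewrite big_cons; exact: cvgD.
Qed.

(** * Green's formula for the MIT bag domain *)

Section BilinearForm.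
Context {R : realType}.
Implicit Types (M : 'M[R[i]]_4) (u v : 'cV[R[i]]_4).

Definition unitc (b : bool) : R[i] := if b then ii else 1.

Definition bform M (a : bool) u v : R := cpart a ((u^T *m M *m v) 0 0).

Definition bcoef M (a : bool) (p p' : 'I_4 * bool) : R :=
  cpart a (M p.1 p'.1 * (unitc p.2 * unitc p'.2)).

Lemma cpart_sum (I : Type) (s : seq I) (P : pred I) (F : I -> R[i]) a :
  cpart a (\sum_(i <- s | P i) F i) = \sum_(i <- s | P i) cpart a (F i).
Proof.
elim/big_rec2: _ => [|i x y _ <-]; first by case: a.
by rewrite cpartD.
Qed.

Lemma cpartMr a (z : R[i]) (r : R) : cpart a (z * r%:C) = cpart a z * r.
Proof. by case: z => x y; case: a => /=; rewrite ?mulr0 ?subr0 ?add0r ?addr0. Qed.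

Lemma complex_parts (z : R[i]) : z = \sum_(b : bool) unitc b * (cpart b z)%:C.
Proof.
rewrite big_bool /= /unitc /ii mul1r; case: z => x y; apply/eqP.
by rewrite eq_complex /=; apply/andP; split; apply/eqP; ring.
Qed.

(** Splitting every entry into its real and imaginary parts turns the complex form into 64 products
    of real functions, to which the scalar convergence and integrability lemmas apply. *)
Lemma bformE M a u v : bform M a u v = \sum_(p : ('I_4 * bool) * ('I_4 * bool))
  bcoef M a p.1 p.2 * (cpart p.1.2 (u p.1.1 0) * cpart p.2.2 (v p.2.1 0)).
Proof.
rewrite -(pair_big xpredT xpredT (fun p p' => bcoef M a p p' *
   (cpart p.2 (u p.1 0) * cpart p'.2 (v p'.1 0)))) /=.
rewrite /bform; have -> : (u^T *m M *m v) 0 0 = \sum_(p : 'I_4 * bool) \sum_(p' : 'I_4 * bool)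
    M p.1 p'.1 * (unitc p.2 * unitc p'.2) *
    (cpart p.2 (u p.1 0) * cpart p'.2 (v p'.1 0))%:C.
  rewrite mxE -(pair_big xpredT xpredT (fun i b => \sum_p' M i p'.1 * (unitc b * unitc p'.2) *
    (cpart b (u i 0) * cpart p'.2 (v p'.1 0))%:C)) /=.
  under [RHS]eq_bigr do under eq_bigr do rewrite -(pair_big xpredT xpredT
     (fun i' b' => M _ i' * (unitc _ * unitc b') * (cpart _ (u _ 0) * cpart b' (v i' 0))%:C)).
  under [RHS]eq_bigr do rewrite exchange_big.
  rewrite exchange_big /=; apply: eq_bigr => j _.
  rewrite mxE big_distrl /=; apply: eq_bigr => i _.
  rewrite mxE [in LHS](complex_parts (u i 0)) [in LHS](complex_parts (v j 0)).
  rewrite !big_bool /=.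
  rewrite !rmorphM /=; ring.
rewrite cpart_sum; apply: eq_bigr => p _; rewrite cpart_sum; apply: eq_bigr => p' _.
by rewrite cpartMr.
Qed.

Lemma bformZM M (r : R) a u v : bform (r%:C *: M) a u v = r * bform M a u v.
Proof. by rewrite /bform -scalemxAr -scalemxAl mxE mulrC cpartMr mulrC. Qed.

Lemma bform_sumM (I : finType) (M : I -> 'M[R[i]]_4) a u v :
  bform (\sum_i M i) a u v = \sum_i bform (M i) a u v.
Proof.
rewrite /bform mulmx_sumr mulmx_suml summxE cpart_sum.
by [].
Qed.

End BilinearForm.

Section BilinearIntegral.
Context {R : realType}.
Context d (T : measurableType d) (mu : {measure set T -> \bar R}) (D : set T).
Hypothesis mD : measurable D.
Implicit Types (u v : T -> 'cV[R[i]]_4) (c : T -> R).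

(** The same components as [part], but on an arbitrary measurable space, as traces are also pulled
    back to the plane. *)
Definition cmp (p : 'I_4 * bool) u (x : T) : R := cpart p.2 (u x p.1 0).

Definition sqint4 u := forall p, sqint mu D (cmp p u).

Lemma Rintegral_sum (I : Type) (s : seq I) (F : I -> T -> R) :
  (forall i, mu.-integrable D (EFin \o F i)) ->
  mu.-integrable D (EFin \o (fun x => \sum_(i <- s) F i x)) /\
  Rintegral mu D (fun x => \sum_(i <- s) F i x) = \sum_(i <- s) Rintegral mu D (F i).
Proof.
move=> iF; elim: s => [|i s [IH1 IH2]].
  split.
    by have := integ0 mu D; apply: eq_integrable => // x _; rewrite /= big_nil.
  rewrite big_nil; under eq_Rintegral do rewrite big_nil.
  by rewrite /Rintegral integral0.
split.
  by have := integD mD (iF i) IH1; apply: eq_integrable => // x _; rewrite /= big_cons.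
rewrite big_cons; under eq_Rintegral do rewrite big_cons.
by rewrite RintegralD// IH2.
Qed.

Section OneForm.
Variables (M : 'M[R[i]]_4) (a : bool) (c : T -> R) (K : R).
Hypothesis mc : measurable_fun D c.
Hypothesis cK : forall x, D x -> `|c x| <= K.

Lemma bform_terms u v x : c x * bform M a (u x) (v x) =
  \sum_(p : ('I_4 * bool) * ('I_4 * bool)) bcoef M a p.1 p.2 * (c x * (cmp p.1 u x * cmp p.2 v x)).
Proof. by rewrite bformE mulr_sumr; apply: eq_bigr => p _; rewrite /cmp mulrCA. Qed.

Lemma bform_integrable_term u v p p' : sqint4 u -> sqint4 v ->
  mu.-integrable D (EFin \o (fun x => bcoef M a p p' * (c x * (cmp p u x * cmp p' v x)))).
Proof.
move=> su sv; apply: integZ => //.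
have := sqint_mul mD (sqint_bmul mD mc cK (su p)) (sv p').
by apply: eq_integrable => // x _ /=; rewrite mulrA.
Qed.

Lemma bform_integrable u v : sqint4 u -> sqint4 v ->
  mu.-integrable D (EFin \o (fun x => c x * bform M a (u x) (v x))).
Proof.
move=> su sv; have [H _] := Rintegral_sum (index_enum _)
  (fun p : ('I_4 * bool) * ('I_4 * bool) => bform_integrable_term p.1 p.2 su sv).
by move: H; apply: eq_integrable => // x _ /=; rewrite bform_terms.
Qed.

Lemma bform_cvg u v (u_ v_ : nat -> T -> 'cV[R[i]]_4) :
  sqint4 u -> sqint4 v -> (forall n, sqint4 (u_ n)) -> (forall n, sqint4 (v_ n)) ->
  (forall p, sqn mu D (fun x => cmp p (u_ n) x - cmp p u x) @[n --> \oo] --> (0 : R)) ->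
  (forall p, sqn mu D (fun x => cmp p (v_ n) x - cmp p v x) @[n --> \oo] --> (0 : R)) ->
  Rintegral mu D (fun x => c x * bform M a (u_ n x) (v_ n x)) @[n --> \oo] -->
  Rintegral mu D (fun x => c x * bform M a (u x) (v x)).
Proof.
move=> su sv su_ sv_ cu cv.
have E w z : sqint4 w -> sqint4 z -> Rintegral mu D (fun x => c x * bform M a (w x) (z x)) =
   \sum_(p : ('I_4 * bool) * ('I_4 * bool)) bcoef M a p.1 p.2 *
      Rintegral mu D (fun x => c x * (cmp p.1 w x * cmp p.2 z x)).
  move=> sw sz; have [_] := Rintegral_sum (index_enum _)
    (fun p : ('I_4 * bool) * ('I_4 * bool) => bform_integrable_term p.1 p.2 sw sz).
  under eq_Rintegral do rewrite -bform_terms.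
  move=> ->; apply: eq_bigr => p _; rewrite RintegralZl//.
  have := sqint_mul mD (sqint_bmul mD mc cK (sw p.1)) (sz p.2).
  by apply: eq_integrable => // x _ /=; rewrite mulrA.
rewrite E//; under eq_fun do rewrite E//.
apply: cvg_sumr => p; apply: cvgM; first exact: cvg_cst.
apply: (sqint_bilin_cvg mD mc cK) => //.
- by move=> n; exact: su_.
- by move=> n; exact: sv_.
Qed.

End OneForm.
End BilinearIntegral.

(** * Matrix algebra of time reversal and of the bag condition *)

Section TimeReversal.
Context {R : realType}.
Local Notation C := R[i].

(** This is i sigma_2, which intertwines every Pauli matrix with minus its transpose. *)
Definition eps2 : 'M[C]_2 := mat2 0 1 (-1) 0.

(* The matrix of the time reversal symmetry: the bilinear form u^T J v is skew
   and the Dirac operator is symmetric for it. *)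
Definition Jmx : 'M[C]_4 := (block_mx eps2 0 0 eps2 : 'M[C]_(2 + 2)).

Lemma eps2T : eps2^T = - eps2.
Proof.
apply/matrixP => i j; rewrite !mxE.
by case: i => -[|[|//]] ?; case: j => -[|[|//]] ? /=; rewrite ?oppr0 ?opprK.
Qed.

Lemma eps2_sqr : eps2 *m eps2 = - 1%:M.
Proof.
apply/matrixP => i j; rewrite !mxE !big_ord_recl big_ord0 !mxE.
case: i => -[|[|//]] ?; case: j => -[|[|//]] ? /=; rewrite ?mulr0n ?mulr1n; ring.
Qed.

Lemma pauliT_eps (j : 'I_3) : (pauli j : 'M[C]_2)^T *m eps2 = - (eps2 *m pauli j).
Proof.
apply/matrixP => i l; rewrite !mxE !big_ord_recl !big_ord0 !mxE /pauli.
case: j => -[|[|[|//]]] ? /=; rewrite !mxE;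
case: i => -[|[|//]] ?; case: l => -[|[|//]] ? /=; ring.
Qed.

Lemma JmxT : Jmx^T = - Jmx.
Proof.
rewrite /Jmx -[LHS]/((block_mx eps2 0 0 eps2 : 'M[C]_(2 + 2))^T) tr_block_mx.
by rewrite -[RHS]/(- (block_mx eps2 0 0 eps2 : 'M[C]_(2 + 2))) opp_block_mx !trmx0 eps2T oppr0.
Qed.

Lemma Jmx_sqr : Jmx *m Jmx = - 1%:M.
Proof.
rewrite /Jmx -[LHS]/((block_mx eps2 0 0 eps2 : 'M[C]_(2 + 2)) *m block_mx eps2 0 0 eps2).
rewrite mulmx_block !mulmx0 !mul0mx !addr0 !add0r eps2_sqr.
by rewrite -[RHS]/(- (1%:M : 'M[C]_(2 + 2))) scalar_mx_block opp_block_mx oppr0.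
Qed.

Lemma alphaT_J (j : 'I_3) : (alpha j)^T *m Jmx = - (Jmx *m (alpha j : 'M[C]_4)).
Proof.
rewrite /Jmx /alpha -[LHS]/((block_mx 0 (pauli j) (pauli j) 0 : 'M[C]_(2 + 2))^T *m
   (block_mx eps2 0 0 eps2 : 'M[C]_(2 + 2))).
rewrite -[RHS]/(- ((block_mx eps2 0 0 eps2 : 'M[C]_(2 + 2)) *m
   (block_mx 0 (pauli j) (pauli j) 0 : 'M[C]_(2 + 2)))).
by rewrite tr_block_mx !mulmx_block !trmx0 !mulmx0 !mul0mx !addr0 !add0r opp_block_mx
  !oppr0 pauliT_eps.
Qed.

Lemma betaT_J : (beta : 'M[C]_4)^T *m Jmx = Jmx *m beta.
Proof.
rewrite /Jmx /beta -[LHS]/((block_mx 1%:M 0 0 (- 1%:M) : 'M[C]_(2 + 2))^T *m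
   (block_mx eps2 0 0 eps2 : 'M[C]_(2 + 2))).
rewrite -[RHS]/((block_mx eps2 0 0 eps2 : 'M[C]_(2 + 2)) *m
   (block_mx 1%:M 0 0 (- 1%:M) : 'M[C]_(2 + 2))).
rewrite tr_block_mx !mulmx_block !trmx0 !mulmx0 !mul0mx !addr0 !add0r.
by rewrite trmx1 [(- 1%:M)^T]linearN /= trmx1 mulNmx mulmxN !mul1mx !mulmx1.
Qed.

Lemma beta_sqr : (beta : 'M[C]_4) *m beta = 1%:M.
Proof.
rewrite /beta -[LHS]/((block_mx 1%:M 0 0 (- 1%:M) : 'M[C]_(2 + 2)) *m block_mx 1%:M 0 0 (- 1%:M)).
rewrite mulmx_block !mulmx0 !mul0mx !addr0 !add0r mulNmx mulmxN opprK !mulmx1.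
by rewrite -[RHS]/(1%:M : 'M[C]_(2 + 2)) scalar_mx_block.
Qed.

Lemma dot_alphaT_J (v : R * R * R) : (dot_alpha v)^T *m Jmx = - (Jmx *m dot_alpha v).
Proof.
rewrite /dot_alpha linear_sum /= mulmx_suml mulmx_sumr -sumrN; apply: eq_bigr => j _.
by rewrite linearZ /= -scalemxAl alphaT_J -scalemxAr scalerN.
Qed.

Lemma ii_sqr : ii * ii = -1 :> C.
Proof.
by apply/eqP; rewrite eq_complex /= !mul0r !mulr1 !mulr0 sub0r addr0 oppr0 !eqxx.
Qed.

(* Both fields satisfy X g = i beta g, and J X is symmetric while J beta is
   skew. *)
Lemma bag_form0 (X : 'M[C]_4) (g h : 'cV[C]_4) : X^T *m Jmx = - (Jmx *m X) ->
  ((- ii) *: (beta *m X)) *m g = g -> ((- ii) *: (beta *m X)) *m h = h ->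
  g^T *m (Jmx *m X) *m h = 0.
Proof.
move=> XJ Hg Hh.
have key (w : 'cV[C]_4) : ((- ii) *: (beta *m X)) *m w = w -> X *m w = ii *: (beta *m w).
  move=> Hw; rewrite -[in RHS]Hw -scalemxAl -scalemxAr scalerA mulrN ii_sqr opprK scale1r.
  by rewrite mulmxA mulmxA beta_sqr mul1mx.
have Xg := key _ Hg; have Xh := key _ Hh.
have e1 : g^T *m (Jmx *m X) *m h = ii *: (g^T *m (Jmx *m beta) *m h).
  by rewrite -mulmxA -mulmxA Xh -scalemxAr -scalemxAr !mulmxA.
have e2 : g^T *m (Jmx *m X) *m h = - (ii *: (g^T *m (Jmx *m beta) *m h)).
  rewrite -[Jmx *m X]opprK -XJ mulmxN mulNmx; congr (- _).
  have -> : g^T *m (X^T *m Jmx) *m h = (X *m g)^T *m Jmx *m h.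
    by rewrite trmx_mul !mulmxA.
  by rewrite Xg linearZ /= trmx_mul -!scalemxAl -betaT_J !mulmxA.
have : g^T *m (Jmx *m X) *m h + g^T *m (Jmx *m X) *m h = 0.
  by rewrite {1}e1 e2 addrN.
rewrite -mulr2n -scaler_nat => /eqP; rewrite scaler_eq0 pnatr_eq0 /= => /eqP.
by [].
Qed.

End TimeReversal.

Section TestForm.
Context {R : realType}.
Implicit Types (phi psi : spinor_field R) (M : 'M[R[i]]_4).

Lemma Ck_sum (V : normedModType R) n (I : Type) (s : seq I) (F : I -> V -> R) :
  (forall i, Ck n (F i)) -> Ck n (fun x => \sum_(i <- s) F i x).
Proof.
move=> H; elim: s => [|i s IH].
  by under eq_fun do rewrite big_nil; exact: Ck_cst.
by under eq_fun do rewrite big_cons; exact: Ck_add.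
Qed.

Lemma derive_sumr (V : normedModType R) (I : Type) (s : seq I) (F : I -> V -> R) (x v : V) :
  (forall i, Ck 1 (F i)) -> 'D_v (fun x => \sum_(i <- s) F i x) x = \sum_(i <- s) 'D_v (F i) x.
Proof.
move=> H; elim: s => [|i s IH].
  by under eq_fun do rewrite big_nil; rewrite big_nil derive_cst.
under eq_fun do rewrite big_cons; rewrite big_cons -IH.
have d1 : derivable (F i) x v by exact: Ck_derivable (H i).
have d2 : derivable (fun x => \sum_(i <- s) F i x) x v.
  by apply: Ck_derivable (Ck_sum s H).
by rewrite -(deriveD d1 d2).
Qed.

Lemma Ck_test_bform M a phi psi : test_field phi -> test_field psi ->
  Ck 1 (fun x => bform M a (phi x) (psi x)).
Proof.
move=> tp ts; under eq_fun do rewrite bformE.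
apply: Ck_sum => p; apply: Ck_scale; apply: Ck_mul.
  exact: (test_Ck 1 (test_field_part p.1.1 p.1.2 tp)).
exact: (test_Ck 1 (test_field_part p.2.1 p.2.2 ts)).
Qed.

Lemma derive_test_bform M a phi psi j x : test_field phi -> test_field psi ->
  'D_(unit_vec j) (fun x => bform M a (phi x) (psi x)) x =
  bform M a (dtest j phi x) (psi x) + bform M a (phi x) (dtest j psi x).
Proof.
move=> tp ts; under eq_fun do rewrite bformE.
have Cp p := test_Ck 1 (test_field_part (p : 'I_4 * bool).1 p.2 tp).
have Cs p := test_Ck 1 (test_field_part (p : 'I_4 * bool).1 p.2 ts).
rewrite derive_sumr; last first.
  by move=> p; apply: Ck_scale; apply: Ck_mul; [exact: Cp|exact: Cs].
rewrite !bformE -big_split; apply: eq_bigr => -[p p'] _ /=.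
have dp : derivable (part p.1 p.2 phi) x (unit_vec j) by exact: Ck_derivable (Cp p).
have ds : derivable (part p'.1 p'.2 psi) x (unit_vec j) by exact: Ck_derivable (Cs p').
have dc : derivable (fun _ : R * R * R => bcoef M a p p' : R) x (unit_vec j).
  exact: derivable_cst.
have dm : derivable (fun x => part p.1 p.2 phi x * part p'.1 p'.2 psi x) x (unit_vec j).
  exact (derivableM dp ds).
rewrite (deriveM_fun dc dm) derive_cst mul0r add0r (deriveM_fun dp ds) mulrDr.
by rewrite -!part_dtest.
Qed.

Lemma sqint4_L2 (mu : {measure set (space3 R) -> \bar R}) (D : set (space3 R)) u :
  measurable D -> L2 mu D u -> sqint4 mu D u.
Proof. by move=> mD /(L2P _ mD) H p; exact: H. Qed.

End TestForm.

Section LocalGreen.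
Context {R : realType}.
Variables (Omega U : set (R * R * R)) (k : 'I_3) (s : bool) (gamma : R * R -> R).
Hypothesis oO : open Omega.
Let mO : measurable (Omega : set (space3 R)) := open_measurable3 oO.
Variables (sigma : {measure set (space3 R) -> \bar R}).
Hypothesis surf : surface_measure Omega sigma.
Variables (u v : spinor_field R).
Hypotheses (du : dom Omega sigma u) (dv : dom Omega sigma v).
Variable a : bool.

(** Formally the derivative along x_j of chi u^T J alpha_j v, expanded by the product rule with weak
    derivatives; the sum over j is a divergence. *)
Definition green_term (chi : R * R * R -> R) (j : 'I_3) (x : R * R * R) : R :=
  'D_(unit_vec j) chi x * bform (Jmx *m alpha j) a (u x) (v x) +
  chi x * bform (Jmx *m alpha j) a (wpartial Omega j u x) (v x) +
  chi x * bform (Jmx *m alpha j) a (u x) (wpartial Omega j v x).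

Definition green (chi : R * R * R -> R) : R :=
  \sum_(j < 3) Rintegral leb3 Omega (green_term chi j).

Lemma dom_H1 w : dom Omega sigma w -> H1 Omega w.
Proof. by move=> [g [[]]]. Qed.

Lemma dom_sqint4 w : dom Omega sigma w -> sqint4 leb3 Omega w.
Proof. by move=> /dom_H1 [Lw _]; exact: sqint4_L2. Qed.

Lemma dom_wpartial_sqint4 w j : dom Omega sigma w -> sqint4 leb3 Omega (wpartial Omega j w).
Proof. by move=> /dom_H1 Hw; apply: sqint4_L2 => //; exact: (wpartialP j Hw).1. Qed.

Lemma bounded_chi (chi : R * R * R -> R) q r : Ck 1 chi -> (forall x, ~ cube q r x -> chi x = 0) ->
  exists M : R, forall x, `|chi x| <= M /\ forall j, `|'D_(unit_vec j) chi x| <= M.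
Proof.
move=> C1 c0.
have H (f : R * R * R -> R) : continuous f -> (forall x, ~ cube q (2 * r) x -> f x = 0) ->
    exists2 M, 0 <= M & forall x, `|f x| <= M.
  move=> cf f0; have [M M0 HM] := continuous_cube_bounded q (2 * r) cf; exists M => // x.
  by have [/HM//|/f0->] := pselect (cube q (2 * r) x); rewrite normr0.
have [M0 M00 HM0] : exists2 M, 0 <= M & forall x, `|chi x| <= M.
  have [M M0 HM] := continuous_cube_bounded q r (Ck_continuous C1); exists M => // x.
  by have [/HM//|/c0->] := pselect (cube q r x); rewrite normr0.
have H1 j : exists2 M, 0 <= M & forall x, `|'D_(unit_vec j) chi x| <= M.
  apply: (H _ (Ck_derive (unit_vec j) C1)) => x; exact: derive_out_cube c0.
have [N HN] : exists N : 'I_3 -> R, forall j, 0 <= N j /\ forall x, `|'D_(unit_vec j) chi x| <= N j.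
  have H2 j : exists M, 0 <= M /\ forall x, `|'D_(unit_vec j) chi x| <= M.
    by have [M ? ?] := H1 j; exists M.
  by exists (fun j => sval (cid (H2 j))) => j; exact: (svalP (cid (H2 j))).
exists (M0 + \sum_j N j) => x; split.
  apply: le_trans (HM0 x) _; rewrite lerDl sumr_ge0// => j _; exact: (HN j).1.
move=> j; apply: le_trans ((HN j).2 x) _; rewrite (bigD1 j)//= addrCA lerDl.
by rewrite addr_ge0// sumr_ge0// => i _; exact: (HN i).1.
Qed.

Lemma green_parts (chi : R * R * R -> R) q r j (w z : spinor_field R) (wj zj : spinor_field R) :
  Ck 1 chi -> (forall x, ~ cube q r x -> chi x = 0) ->
  sqint4 leb3 Omega w -> sqint4 leb3 Omega z ->
  sqint4 leb3 Omega wj -> sqint4 leb3 Omega zj ->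
  Rintegral leb3 Omega (fun x =>
    'D_(unit_vec j) chi x * bform (Jmx *m alpha j) a (w x) (z x) +
    chi x * bform (Jmx *m alpha j) a (wj x) (z x) +
    chi x * bform (Jmx *m alpha j) a (w x) (zj x)) =
  Rintegral leb3 Omega (fun x => 'D_(unit_vec j) chi x * bform (Jmx *m alpha j) a (w x) (z x)) +
  Rintegral leb3 Omega (fun x => chi x * bform (Jmx *m alpha j) a (wj x) (z x)) +
  Rintegral leb3 Omega (fun x => chi x * bform (Jmx *m alpha j) a (w x) (zj x)).
Proof.
move=> C1 c0 sw sz swj szj; have [M HM] := bounded_chi C1 c0.
have mc : measurable_fun (Omega : set (space3 R)) chi.
  by apply: measurable_funTS; apply: continuous_measurable3; exact: (Ck_continuous C1).
have mdc : measurable_fun (Omega : set (space3 R)) (fun x => 'D_(unit_vec j) chi x).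
  by apply: measurable_funTS; apply: continuous_measurable3; exact: (Ck_derive (unit_vec j) C1).
have b1 x : Omega x -> `|chi x| <= M by move=> _; exact: (HM x).1.
have b2 x : Omega x -> `|'D_(unit_vec j) chi x| <= M by move=> _; exact: (HM x).2.
have i1 := bform_integrable mO (Jmx *m alpha j) a mdc b2 sw sz.
have i2 := bform_integrable mO (Jmx *m alpha j) a mc b1 swj sz.
have i3 := bform_integrable mO (Jmx *m alpha j) a mc b1 sw szj.
by rewrite (RintegralD mO (integD mO i1 i2) i3) (RintegralD mO i1 i2).
Qed.

End LocalGreen.

Lemma ae_Rintegral0 d (T : measurableType d) (R : realType) (mu : {measure set T -> \bar R})
    (D : set T) (f : T -> R) : measurable D -> measurable_fun D f ->
  {ae mu, forall x, D x -> f x = 0} -> Rintegral mu D f = 0.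
Proof.
move=> mD mf H; rewrite /Rintegral -[RHS]/(fine (0%:E : \bar R)); congr fine.
rewrite -[RHS](integral0 mu D); apply: ae_eq_integral => //.
  exact/measurable_EFinP.
by apply: (ae_imp H) => x Hx Dx /=; rewrite Hx.
Qed.

Section LocalGreenChart.
Context {R : realType}.
Variables (Omega U : set (R * R * R)) (k : 'I_3) (s : bool) (gamma : R * R -> R).
Hypothesis oO : open Omega.
Let mO : measurable (Omega : set (space3 R)) := open_measurable3 oO.
Hypothesis chart : graph_chart Omega U k s gamma.
Let Cgamma : Ck 2 gamma. Proof. by case: chart. Qed.
Variables (sigma : {measure set (space3 R) -> \bar R}).
Hypothesis surf : surface_measure Omega sigma.
Variables (u v : spinor_field R) (a : bool).
Hypotheses (du : dom Omega sigma u) (dv : dom Omega sigma v).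
Variables (chi : R * R * R -> R) (q : R * R * R) (r : R).
Hypothesis C1 : Ck 1 chi.
Hypothesis c0 : forall x, ~ cube q r x -> chi x = 0.
Hypothesis q2U : cube q (2 * r) `<=` U.
Hypothesis qU : cube q r `<=` U.
Local Notation Y := (chart_patch k gamma q r).
Local Notation gl := (glift k gamma).
Local Notation MJ j := (Jmx *m alpha j).

Let mY : measurable Y. Proof. exact: (measurable_patch chart q r). Qed.

Definition bcut (j : 'I_3) (y : space2 R) : R := nvec k s gamma j y * chi (gl y).

Lemma measurable_bcut j : measurable_fun Y (bcut j).
Proof.
apply: measurable_funTS; apply: measurable_funM.
  by apply: continuous_measurable2; exact: (Ck_continuous (Ck_nvec k s Cgamma j)).
have := measurableT_comp (continuous_measurable3 (Ck_continuous C1)) (measurable_glift chart).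
by [].
Qed.

Lemma bounded_bcut j : exists K, forall y, Y y -> `|bcut j y| <= K.
Proof.
have [M HM] := bounded_chi C1 c0.
have [N N0 HN] := continuous_cube_bounded q r (Ck_continuous (Ck_nvec_others k s Cgamma j)).
exists (N * M) => y Yy; rewrite /bcut normrM; apply: ler_pM => //.
  by have := HN _ Yy; rewrite /glift others_insert.
exact: (HM (gl y)).1.
Qed.

(** For test fields the product rule is classical, so this is the divergence theorem in the chart
    for W = chi phi^T J alpha_j psi. *)
Lemma test_green j phi psi : test_field phi -> test_field psi ->
  Rintegral leb3 Omega (fun x =>
    'D_(unit_vec j) chi x * bform (MJ j) a (phi x) (psi x) +
    chi x * bform (MJ j) a (dtest j phi x) (psi x) +
    chi x * bform (MJ j) a (phi x) (dtest j psi x)) =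
  Rintegral leb2 Y (fun y => bcut j y * bform (MJ j) a (phi (gl y)) (psi (gl y))).
Proof.
move=> tp ts.
have CB := Ck_test_bform (MJ j) a tp ts.
have CW := Ck_mul C1 CB.
have W0 x : ~ cube q r x -> chi x * bform (MJ j) a (phi x) (psi x) = 0.
  by move=> /c0 ->; rewrite mul0r.
have := chart_divergence_Omega Cgamma chart j CW W0 q2U.
have -> : Rintegral leb3 Omega (fun x => 'D_(unit_vec j) (fun x => chi x * bform (MJ j) a (phi x) (psi x)) x) =
  Rintegral leb3 Omega (fun x =>
    'D_(unit_vec j) chi x * bform (MJ j) a (phi x) (psi x) +
    chi x * bform (MJ j) a (dtest j phi x) (psi x) +
    chi x * bform (MJ j) a (phi x) (dtest j psi x)).
  apply: eq_Rintegral => x _.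
  have d1 : derivable chi x (unit_vec j) by exact: Ck_derivable C1.
  have d2 : derivable (fun x => bform (MJ j) a (phi x) (psi x)) x (unit_vec j).
    exact: Ck_derivable CB.
  by rewrite (deriveM_fun d1 d2) derive_test_bform// mulrDr addrA.
move=> ->; rewrite [RHS]Rintegral_mkcond; apply: eq_Rintegral => y _.
rewrite /patch; case: ifPn => [_|]; first by rewrite /bcut mulrA.
by rewrite notin_setE => nY; rewrite W0 ?mulr0.
Qed.

Lemma sqint_patch_bounded (f : R * R * R -> R) : continuous f ->
  sqint leb2 Y (fun y : space2 R => f (gl y)).
Proof.
move=> cf; have [M M0 HM] := continuous_cube_bounded q r cf.
have mf : measurable_fun setT (fun y : space2 R => f (gl y)).
  exact: (measurableT_comp (continuous_measurable3 cf) (measurable_glift chart)).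
apply: (@sqint_le _ _ _ leb2 Y mY _ (fun=> M)).
- exact: measurable_funTS.
- split; first exact: measurable_cst.
  by rewrite integral_cst// lte_mul_pinfty// ?lee_fin ?sqr_ge0// (patch_fin chart).
- by move=> y Yy; rewrite (ger0_norm M0); exact: HM.
Qed.

Lemma trace_patch g : L2 sigma (bdry Omega) g ->
  sqint4 leb2 Y (fun y : space2 R => g (gl y)).
Proof.
move=> Lg p; have mb := measurable_bdry Omega.
have /(L2P _ mb) H := Lg; have [mp poo] := H p.1 p.2; split.
  apply: (measurable_comp mb _ mp).
    move=> _ [y Yy <-]; apply: (glift_bdry chart); exact: qU.
  by apply: measurable_funTS; exact: (measurable_glift chart).
apply: le_lt_trans poo.
have := patch_integral_le chart surf qU (f := fun x => ((part p.1 p.2 g x) ^+ 2)%:E).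
apply; last by move=> x; rewrite lee_fin sqr_ge0.
by apply/measurable_EFinP; exact: measurable_funX.
Qed.

Lemma trace_patch_cvg g (phi : nat -> spinor_field R) : L2 sigma (bdry Omega) g ->
  (forall n, test_field (phi n)) ->
  L2normsq sigma (bdry Omega) (fun x => phi n x - g x) @[n --> \oo] --> 0%E ->
  forall p, sqn leb2 Y (fun y : space2 R => cmp p (fun y => phi n (gl y)) y - cmp p (fun y => g (gl y)) y)
     @[n --> \oo] --> (0 : R).
Proof.
move=> Lg tp c p; have mb := measurable_bdry Omega.
apply: cvg_ereal0 c => n; first exact: sqn_ge0.
have cp i b := Ck_continuous (test_Ck 0 (test_field_part i b (tp n))).
rewrite sqnE//; last first.
  apply: (sqintB mY); last exact: trace_patch.
  exact: (sqint_patch_bounded (cp p.1 p.2)).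
have /(L2P _ mb) H := Lg.
have mpart (i : 'I_4 * bool) : measurable_fun (bdry Omega : set (space3 R))
    (fun x => part i.1 i.2 (phi n) x - part i.1 i.2 g x).
  apply: measurable_funB; last by have [] := H i.1 i.2.
  by apply: measurable_funTS; apply: continuous_measurable3; exact: cp.
apply: (@le_trans _ _ (\int[sigma]_(x in bdry Omega)
    ((part p.1 p.2 (phi n) x - part p.1 p.2 g x) ^+ 2)%:E)%E).
  apply: (patch_integral_le chart surf qU
    (f := fun x => ((part p.1 p.2 (phi n) x - part p.1 p.2 g x) ^+ 2)%:E)).
    by apply/measurable_EFinP; apply: measurable_funX; exact: mpart.
  by move=> x; rewrite lee_fin sqr_ge0.
have nE x : normsq (phi n x - g x) =
    \sum_(i : 'I_4 * bool) (part i.1 i.2 (phi n) x - part i.1 i.2 g x) ^+ 2.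
  rewrite (normsq_part (fun x => phi n x - g x)).
  by apply: eq_bigr => i _; rewrite partB.
apply: ge0_le_integral => //.
- by move=> x _; rewrite lee_fin sqr_ge0.
- by apply/measurable_EFinP; apply: measurable_funX; exact: mpart.
- apply/measurable_EFinP; under eq_fun do rewrite nE.
  by apply: measurable_sum => i; apply: measurable_funX; exact: mpart.
- move=> x _; rewrite lee_fin nE (bigD1 p)//= lerDl.
  by rewrite sumr_ge0// => i _; exact: sqr_ge0.
Qed.

(** The components of the unit normal are those of [nvec] divided by the area density, so the sum
    over j is chi times this density times g^T J (alpha . n) h, which [bag_form0] annihilates. *)
Lemma bag_patch g h : trace Omega sigma u g -> trace Omega sigma v h ->
  {ae sigma, forall x, bdry Omega x -> forall w, outward_normal Omega x w ->
       ((- ii) *: (beta *m dot_alpha w)) *m g x = g x} ->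
  {ae sigma, forall x, bdry Omega x -> forall w, outward_normal Omega x w ->
       ((- ii) *: (beta *m dot_alpha w)) *m h x = h x} ->
  {ae leb2, forall y, Y y ->
     \sum_(j < 3) bcut j y * bform (MJ j) a (g (gl y)) (h (gl y)) = 0}.
Proof.
move=> _ _ Bg Bh.
have A1 := ae_patch chart surf qU Bg; have A2 := ae_patch chart surf qU Bh.
apply: (ae_imp2 A1 A2) => y H1 H2 Yy.
have bd : bdry Omega (gl y) by apply: (glift_bdry chart); exact: qU.
pose ar := area_density gamma y.
have ar0 : ar != 0 by rewrite gt_eqF// (lt_le_trans ltr01)// area_density_ge1.
pose w := ((-1) ^+ s / ar) *: insert k (grad2 gamma y) (-1).
have ow : outward_normal Omega (gl y) w.
  exists U, k, s, gamma; split; [exact: qU|exact: chart|].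
  by rewrite /w /ar /glift others_insert.
have := bag_form0 (dot_alphaT_J w) (H1 Yy bd w ow) (H2 Yy bd w ow) => Z.
have cw j : coord3 j w = nvec k s gamma j y / ar.
  rewrite /w /nvec mulrAC /coord3 /insert /GRing.scale /=.
  by case: (val k) => [|[|_]]; case: (val j) => [|[|_]].
have -> : \sum_(j < 3) bcut j y * bform (MJ j) a (g (gl y)) (h (gl y)) =
    chi (gl y) * ar * bform (Jmx *m dot_alpha w) a (g (gl y)) (h (gl y)).
  rewrite /dot_alpha mulmx_sumr bform_sumM mulr_sumr; apply: eq_bigr => j _.
  by rewrite -scalemxAr bformZM cw /bcut; field.
rewrite /bform Z mxE; case: (a); rewrite mulr0//.
Qed.

(** Both sides of [test_green] converge along test fields approximating u and v: the volume side by
    H^1 convergence, the boundary side by L^2 convergence of the traces on the patch. The limit on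
    the boundary vanishes by the bag condition. *)
Lemma local_green : green Omega u v a chi = 0.
Proof.
have [g [tg Bg]] := du; have [h [th Bh]] := dv.
have [_ [Lg _]] := tg; have [_ [Lh _]] := th.
have [phi [tphi p0 p1 p2]] := trace_approx oO tg.
have [psi [tpsi s0 s1 s2]] := trace_approx oO th.
have su := dom_sqint4 oO du; have sv := dom_sqint4 oO dv.
have swu j := dom_wpartial_sqint4 oO j du; have swv j := dom_wpartial_sqint4 oO j dv.
have sphi n := sqint4_L2 mO (test_field_L2 mO (tphi n)).
have spsi n := sqint4_L2 mO (test_field_L2 mO (tpsi n)).
have sdphi j n := sqint4_L2 mO (dtest_L2 j mO (tphi n)).
have sdpsi j n := sqint4_L2 mO (dtest_L2 j mO (tpsi n)).
have [M HM] := bounded_chi C1 c0.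
have mc : measurable_fun (Omega : set (space3 R)) chi.
  by apply: measurable_funTS; apply: continuous_measurable3; exact: (Ck_continuous C1).
have mdc j : measurable_fun (Omega : set (space3 R)) (fun x => 'D_(unit_vec j) chi x).
  by apply: measurable_funTS; apply: continuous_measurable3; exact: (Ck_derive (unit_vec j) C1).
have b1 x : Omega x -> `|chi x| <= M by move=> _; exact: (HM x).1.
have b2 j x : Omega x -> `|'D_(unit_vec j) chi x| <= M by move=> _; exact: (HM x).2.
have cphi (p : 'I_4 * bool) : sqn leb3 Omega (fun x => cmp p (phi n) x - cmp p u x) @[n --> \oo] --> (0 : R) := p0 p.1 p.2.
have cpsi (p : 'I_4 * bool) : sqn leb3 Omega (fun x => cmp p (psi n) x - cmp p v x) @[n --> \oo] --> (0 : R) := s0 p.1 p.2.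
have cdphi j (p : 'I_4 * bool) : sqn leb3 Omega (fun x => cmp p (dtest j (phi n)) x - cmp p (wpartial Omega j u) x) @[n --> \oo] --> (0 : R).
  by have := p1 j p.1 p.2; under eq_fun do under eq_fun do rewrite -part_dtest.
have cdpsi j (p : 'I_4 * bool) : sqn leb3 Omega (fun x => cmp p (dtest j (psi n)) x - cmp p (wpartial Omega j v) x) @[n --> \oo] --> (0 : R).
  by have := s1 j p.1 p.2; under eq_fun do under eq_fun do rewrite -part_dtest.
have lim j : Rintegral leb3 Omega (fun x =>
    'D_(unit_vec j) chi x * bform (MJ j) a (phi n x) (psi n x) +
    chi x * bform (MJ j) a (dtest j (phi n) x) (psi n x) +
    chi x * bform (MJ j) a (phi n x) (dtest j (psi n) x)) @[n --> \oo] -->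
    Rintegral leb3 Omega (green_term Omega u v a chi j).
  rewrite [X in _ --> X](green_parts oO a j C1 c0)//.
  under eq_fun do rewrite (green_parts oO a j C1 c0)//.
  apply: cvgD; first apply: cvgD.
  - exact (bform_cvg mO (mdc j) (b2 j) su sv sphi spsi cphi cpsi).
  - exact (bform_cvg mO mc b1 (swu j) sv (sdphi j) spsi (cdphi j) cpsi).
  - exact (bform_cvg mO mc b1 su (swv j) sphi (sdpsi j) cphi (cdpsi j)).
have gY := trace_patch Lg; have hY := trace_patch Lh.
have tY n (f : nat -> spinor_field R) : (forall n, test_field (f n)) ->
    sqint4 leb2 Y (fun y : space2 R => f n (gl y)).
  move=> tf p; apply: (@sqint_patch_bounded (part p.1 p.2 (f n))).
  exact: (Ck_continuous (test_Ck 0 (test_field_part p.1 p.2 (tf n)))).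
have E j : Rintegral leb3 Omega (green_term Omega u v a chi j) =
    Rintegral leb2 Y (fun y => bcut j y * bform (MJ j) a (g (gl y)) (h (gl y))).
  have [K HK] := bounded_bcut j.
  have L2 := bform_cvg mY (measurable_bcut j) HK gY hY
    (fun n => tY n _ tphi) (fun n => tY n _ tpsi)
    (trace_patch_cvg Lg tphi p2) (trace_patch_cvg Lh tpsi s2).
  have L1 := lim j.
  rewrite (funext (fun n => test_green j (tphi n) (tpsi n))) in L1.
  exact: (cvg_unique (@Rhausdorff R) L1 (L2 (MJ j) a)).
rewrite /green; under eq_bigr do rewrite E.
have iY j : leb2.-integrable Y (EFin \o (fun y => bcut j y * bform (MJ j) a (g (gl y)) (h (gl y)))).
  by have [K HK] := bounded_bcut j; exact: (bform_integrable mY (MJ j) a (measurable_bcut j) HK gY hY).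
have [iS <-] := Rintegral_sum mY (index_enum _) iY.
apply: (ae_Rintegral0 mY); first exact: integ_meas iS.
exact: (bag_patch tg th Bg Bh).
Qed.

End LocalGreenChart.

Lemma compact_finite_cover (T : topologicalType) (K : set T) (V : T -> set T) : compact K ->
  (forall x, nbhs x (V x)) -> exists l : seq T, forall x, K x -> exists2 p, p \in l & V p x.
Proof.
(* Ordering finite lists by inclusion gives a filter along which every point is eventually covered
   together with a neighborhood; the covering form of compactness then yields one list for all of
   K. *)
move=> cK nV; pose B (l0 : seq T) := [set l : seq T | {subset l0 <= l}].
have FF : Filter (filter_from setT B).
  apply: filter_from_filter; first by exists [::].
  move=> l1 l2 _ _; exists (l1 ++ l2) => // l H; split=> x xl; apply: H.
    by rewrite mem_cat xl.
  by rewrite mem_cat xl orbT.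
have := (compact_near_coveringP K).1 cK.
move=> /(_ _ _ (fun (l : seq T) x => exists2 p, p \in l & V p x) FF).
case=> [x Kx|l _ Hl]; last by exists l; exact: Hl.
exists (V x, B [:: x]) => /=; first by split; [exact: nV|exists [:: x]].
by move=> [y l] /= [Vy Bl]; exists x => //; apply: Bl; rewrite mem_head.
Qed.

(** * From local charts to compactly supported cutoffs *)

Section GlobalGreen.
Context {R : realType}.
Variable Omega : set (R * R * R).
Hypothesis C2O : C2_domain Omega.
Let oO : open Omega. Proof. by case: C2O. Qed.
Let mO : measurable (Omega : set (space3 R)) := open_measurable3 oO.

(* Points off the boundary get a chart as well, with a constant function whose
   graph passes beside a small cube; so one local formula covers all points. *)
Lemma chart_everywhere x : exists U k s gamma, U x /\ graph_chart Omega U k s gamma.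
Proof.
have low (b : bool) (V : set (R * R * R)) : open V -> V x -> (forall y, V y -> Omega y <-> b) ->
    exists U k s gamma, U x /\ graph_chart Omega U k s gamma.
  move=> oV Vx Vb.
  exists (V `&` cube x 1), ord0, false, (fun=> x.1.1 + (-1) ^+ b); split.
    by split=> //; rewrite /cube /= !subrr normr0 ltr01.
  split.
  - by apply: openI => //; rewrite cube_ball; exact: ball_open.
  - exact: Ck_cst.
  - apply/seteqP; split=> y /=.
      move=> [Oy [Vy [c1 c2]]]; split=> //; have /Vb Hb := Vy.
      have {}Hb : b by exact/Hb.
      by move: c1; rewrite Hb expr0 mul1r expr1 /coord3 /= ltr_norml => /andP[? _]; lra.
    move=> [[Vy [c1 c2]] h]; split=> //; apply/(Vb _ Vy).
    move: h; case: (b) => //; rewrite expr0 mul1r /coord3 /=.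
    by move: c1; rewrite ltr_norml => /andP[_ ?]; lra.
have [Ox|nOx] := pselect (Omega x).
  by apply: (low true Omega).
have [cx|ncx] := pselect (closure Omega x); last first.
  apply: (low false (~` closure Omega)) => //.
    by apply: closed_openC; exact: closed_closure.
  by move=> y ny; split=> // /subset_closure.
apply: C2O.2; split=> //.
by move/interior_subset.
Qed.

Variables (sigma : {measure set (space3 R) -> \bar R}).
Hypothesis surf : surface_measure Omega sigma.
Variables (u v : spinor_field R) (a : bool).
Hypotheses (du : dom Omega sigma u) (dv : dom Omega sigma v).

Lemma green_near x : exists2 r, 0 < r & forall chi, Ck 1 chi ->
  (forall y, ~ cube x (2 * r) y -> chi y = 0) -> green Omega u v a chi = 0.
Proof.
have [U [k [s [gamma [Ux ch]]]]] := chart_everywhere x.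
have oU : open U by case: ch.
have /nbhs_cube[r r0 rU] : nbhs x U by exact: open_nbhs_nbhs.
have sub (c : R) : c <= r -> cube x c `<=` U.
  move=> cr y [h1 [h2 h3]]; apply: rU; split; first exact: lt_le_trans cr.
  by split; exact: lt_le_trans cr.
(* [local_green] asks for twice the supporting cube inside the chart, and that cube is itself
   doubled: 4 (r / 4) = r. *)
exists (r / 4) => [|chi C1 c0]; first by rewrite divr_gt0.
by apply: (local_green oO ch surf a du dv C1 c0); apply: sub; lra.
Qed.

Lemma green_bound_integrable chi K j : (forall x, Omega x -> `|chi x| <= K) ->
  (forall x, Omega x -> `|'D_(unit_vec j) chi x| <= K) -> Ck 1 chi ->
  leb3.-integrable Omega (EFin \o green_term Omega u v a chi j).
Proof.
move=> b1 b2 C1.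
have mc : measurable_fun (Omega : set (space3 R)) chi.
  by apply: measurable_funTS; apply: continuous_measurable3; exact: (Ck_continuous C1).
have mdc : measurable_fun (Omega : set (space3 R)) (fun x => 'D_(unit_vec j) chi x).
  by apply: measurable_funTS; apply: continuous_measurable3; exact: (Ck_derive (unit_vec j) C1).
have su := dom_sqint4 oO du; have sv := dom_sqint4 oO dv.
have swu := dom_wpartial_sqint4 oO j du; have swv := dom_wpartial_sqint4 oO j dv.
have i1 := bform_integrable mO (Jmx *m alpha j) a mdc b2 su sv.
have i2 := bform_integrable mO (Jmx *m alpha j) a mc b1 swu sv.
have i3 := bform_integrable mO (Jmx *m alpha j) a mc b1 su swv.
exact: (integD mO (integD mO i1 i2) i3).
Qed.

Lemma green_term_integrable chi q r j : Ck 1 chi -> (forall x, ~ cube q r x -> chi x = 0) ->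
  leb3.-integrable Omega (EFin \o green_term Omega u v a chi j).
Proof.
move=> C1 c0; have [K HK] := bounded_chi C1 c0.
by apply: (green_bound_integrable (K := K)) => // x _; have [] := HK x.
Qed.

Lemma greenD chi psi q r : Ck 1 chi -> (forall x, ~ cube q r x -> chi x = 0) ->
  Ck 1 psi -> (forall x, ~ cube q r x -> psi x = 0) ->
  green Omega u v a (fun x => chi x + psi x) = green Omega u v a chi + green Omega u v a psi.
Proof.
move=> C1 c0 P1 p0; rewrite /green -big_split; apply: eq_bigr => j _ /=.
have i c : Ck 1 c -> (forall x, ~ cube q r x -> c x = 0) ->
    leb3.-integrable Omega (EFin \o green_term Omega u v a c j).
  move=> C c_0; exact: (green_term_integrable j C c_0).
rewrite -(RintegralD mO (i _ C1 c0) (i _ P1 p0)); apply: eq_Rintegral => x _.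
rewrite /green_term.
have d1 : derivable chi x (unit_vec j) by exact: Ck_derivable C1.
have d2 : derivable psi x (unit_vec j) by exact: Ck_derivable P1.
have -> : 'D_(unit_vec j) (fun x => chi x + psi x) x = 'D_(unit_vec j) chi x + 'D_(unit_vec j) psi x.
  exact: (deriveD d1 d2).
have aux (p p' b1 b2 b3 c c' : R) : (p + p') * b1 + (c + c') * b2 + (c + c') * b3 =
    (p * b1 + c * b2 + c * b3) + (p' * b1 + c' * b2 + c' * b3) by ring.
exact: aux.
Qed.

(** A partition of unity built by induction on a finite cover: the part of chi under the plateau of
    the first cube falls under [green_near], and the rest vanishes on that cube, so that the
    remaining cubes cover its support. *)
Lemma green_compact chi q r : Ck 1 chi -> (forall x, ~ cube q r x -> chi x = 0) ->
  green Omega u v a chi = 0.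
Proof.
pose rho x := s2val (cid2 (green_near x)).
have rho0 x : 0 < rho x := s2valP (cid2 (green_near x)).
have rhoG x := s2valP' (cid2 (green_near x)).
have [x|l Hl] := compact_finite_cover (@compact_ccube R q r) (V := fun x => cube x (rho x)).
  by apply/nbhs_cube; exists (rho x).
move=> C1 c0.
have out x : ~ (exists2 p, p \in l & cube p (rho p) x) -> chi x = 0.
  move=> nx; apply: c0 => /cube_coord cq; apply: nx.
  have [|p pD cx] := Hl x; first by move=> j; exact: ltW.
  by exists p.
elim: l {Hl} chi C1 c0 out => [|p l IH] chi C1 c0 out.
  (* With no cube left chi is identically 0, and any center will do. *)
  by apply: (rhoG q _ C1) => y _; apply: out => -[].
have Cp := Ck_plateau p (rho p).
have C11 : Ck 1 (fun x => plateau p (rho p) x * chi x) by exact: Ck_mul.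
have C12 : Ck 1 (fun x => (1 - plateau p (rho p) x) * chi x).
  have C2 : Ck 1 (fun x => 1 - plateau p (rho p) x) by apply: Ck_sub; [exact: Ck_cst|exact: Cp].
  exact: (Ck_mul C2 C1).
have E : chi = fun x => plateau p (rho p) x * chi x + (1 - plateau p (rho p) x) * chi x.
  by apply/funext => x; ring.
rewrite E (greenD C11 _ C12 _ (q := q) (r := r)); try by move=> x /c0 ->; rewrite mulr0.
rewrite [X in _ + X]IH ?addr0//.
- by apply: (rhoG p _ C11) => y ny; rewrite plateau_out ?mul0r// ltW.
- by move=> x /c0 ->; rewrite mulr0.
- move=> x nx; have [cx|ncx] := pselect (cube p (rho p) x).
    by rewrite plateau_1// subrr mul0r.
  rewrite out ?mulr0// => -[p']; rewrite in_cons => /orP[/eqP->//|p'l cx].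
  by apply: nx; exists p'.
Qed.

End GlobalGreen.

Lemma derive_scale_dir (R : realType) (V : normedModType R) (f : V -> R) (c : R) x v :
  derivable f x v -> 'D_(c *: v) f x = c * 'D_v f x.
Proof.
move=> d; rewrite derive_line.
have dl : is_derive x v f ('D_v f x) by exact: derivableP.
have {}dl := (is_derive_line _ _ _ _).2 dl.
have dc : is_derive (0 : R) (1 : R) (fun h : R => h * c) c.
  have := @is_deriveM R R id (cst c) 0 1 1 0 (is_derive_id _ _) (is_derive_cst _ _ _).
  by rewrite /GRing.scale /= mulr0 add0r mulr1.
have -> : (fun h : R => f (h *: (c *: v) + x)) = (fun h => f (h *: v + x)) \o (fun h : R => h * c).
  by apply/funext => h; rewrite /= scalerA.
have := @is_derive1_comp R (fun h : R => f (h *: v + x)) (fun h : R => h * c) 0 ('D_v f x) c.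
by rewrite mul0r => /(_ dl dc) [_ ->]; rewrite mulrC.
Qed.

Local Notation dirac := Defs.dirac.

Section Symmetric.
Context {R : realType}.
Variable Omega : set (R * R * R).
Hypothesis C2O : C2_domain Omega.
Let oO : open Omega. Proof. by case: C2O. Qed.
Let mO : measurable (Omega : set (space3 R)) := open_measurable3 oO.
Variables (sigma : {measure set (space3 R) -> \bar R}).
Hypothesis surf : surface_measure Omega sigma.
Variables (u v : spinor_field R) (a : bool).
Hypotheses (du : dom Omega sigma u) (dv : dom Omega sigma v).
Local Notation MJ j := (Jmx *m alpha j).

Let hc (n : nat) : R := n.+1%:R^-1.
(** Dilations of one plateau: they tend to 1 everywhere and their derivatives are O(1/(n + 1))
    uniformly, which removes the cutoff on the unbounded domain. *)
Let chi n (x : R * R * R) : R := plateau 0 1 (hc n *: x).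

Let hc01 n : 0 < hc n <= 1.
Proof. by rewrite /hc invr_gt0 ltr0n /= invf_le1 ?ltr0n// ler1n. Qed.

Let chi_affine n h (w x : R * R * R) : hc n *: (h *: w + x) = h *: (hc n *: w) + hc n *: x.
Proof. by rewrite scalerDr !scalerA mulrC. Qed.

Let Ck_chi n : Ck 1 (chi n).
Proof.
apply: (Ck_comp_affine (chi_affine n)); last exact: Ck_plateau.
by move=> x; exact: scaler_continuous.
Qed.

Let chi_out n x : ~ cube 0 (2 * n.+1%:R) x -> chi n x = 0.
Proof.
move=> nx; apply: plateau_out => // -[h1 [h2 h3]]; apply: nx.
have H (t : R) : `|hc n * t - 0| < 2 * 1 -> `|t - 0| < 2 * n.+1%:R.
  rewrite !subr0 mulr1 normrM (gtr0_norm (andP (hc01 n)).1) /hc.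
  by rewrite -ltr_pdivlMl ?invr_gt0// invrK mulrC.
by split; [exact: H h1|split; [exact: H h2|exact: H h3]].
Qed.

Let derive_chi n x w : 'D_w (chi n) x = hc n * 'D_w (plateau 0 1) (hc n *: x).
Proof.
rewrite (derive_comp_affine (plateau 0 1) x w (chi_affine n)) derive_scale_dir//.
exact: (Ck_derivable (Ck_plateau 0 1)).
Qed.

(** Dominated convergence along the dilated cutoffs: since u and v are square-integrable with their
    derivatives, the three products of [green_term] have integrable bounds, and the one carrying the
    derivative of the cutoff tends to 0. *)
Lemma green_identity : \sum_(j < 3) Rintegral leb3 Omega (fun x =>
   bform (MJ j) a (wpartial Omega j u x) (v x) + bform (MJ j) a (u x) (wpartial Omega j v x)) = 0.
Proof.
have su := dom_sqint4 oO du; have sv := dom_sqint4 oO dv.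
have swu j := dom_wpartial_sqint4 oO j du; have swv j := dom_wpartial_sqint4 oO j dv.
have out1 x : ~ cube (0 : R * R * R) (2 * 1) x -> plateau 0 1 x = 0.
  by move=> nx; rewrite plateau_out.
have [M HM] := bounded_chi (Ck_plateau (0 : R * R * R) 1) out1.
have M0 : 0 <= M by apply: le_trans (HM 0).1.
have mone : measurable_fun (Omega : set (space3 R)) (fun=> 1 : R) by exact: measurable_cst.
have one1 (x : R * R * R) : Omega x -> `|1 : R| <= 1 by rewrite normr1.
have i1 j : leb3.-integrable Omega (EFin \o (fun x => 1 * bform (MJ j) a (u x) (v x))).
  exact: (bform_integrable mO (MJ j) a mone one1 su sv).
have i2 j : leb3.-integrable Omega (EFin \o (fun x => 1 * bform (MJ j) a (wpartial Omega j u x) (v x))).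
  exact: (bform_integrable mO (MJ j) a mone one1 (swu j) sv).
have i3 j : leb3.-integrable Omega (EFin \o (fun x => 1 * bform (MJ j) a (u x) (wpartial Omega j v x))).
  exact: (bform_integrable mO (MJ j) a mone one1 su (swv j)).
have B1 n x : `|chi n x| <= 1.
  by have /andP[h1 h2] := plateau_01 0 1 (hc n *: x); rewrite /chi ger0_norm.
have B2 n x j : `|'D_(unit_vec j) (chi n) x| <= hc n * M.
  have /andP[h1 h2] := hc01 n.
  by rewrite derive_chi normrM gtr0_norm// ler_wpM2l ?(ltW h1)//; exact: (HM _).2.
have B3 n x j : `|'D_(unit_vec j) (chi n) x| <= M.
  apply: le_trans (B2 n x j) _; have /andP[h1 h2] := hc01 n.
  by rewrite ler_piMl.
have cvh : hc n @[n --> \oo] --> (0 : R) by exact: cvg_harmonic.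
have cv0 x : chi n x @[n --> \oo] --> (1 : R).
  have <- : plateau (0 : R * R * R) 1 0 = (1 : R).
    by rewrite plateau_1// /cube /= !subrr normr0 ltr01.
  apply: continuous_cvg; first exact: (Ck_continuous (Ck_plateau _ _)).
  rewrite -(scale0r x); exact: cvgZr_tmp.
have cv1 j x : 'D_(unit_vec j) (chi n) x @[n --> \oo] --> (0 : R).
  apply/norm_cvg0P; apply: (@squeeze_cvgr _ _ _ _ (fun=> 0) (fun n => hc n * M)).
  - by apply: nearW => n; rewrite normr_ge0 B2.
  - exact: cvg_cst.
  - by rewrite -(mul0r M); apply: cvgMr_tmp.
have lim j : Rintegral leb3 Omega (green_term Omega u v a (chi n) j) @[n --> \oo] -->
    Rintegral leb3 Omega (fun x => bform (MJ j) a (wpartial Omega j u x) (v x) +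
     bform (MJ j) a (u x) (wpartial Omega j v x)).
  apply: (@Rintegral_dominated_cvg _ _ _ _ _ mO _ _ (fun x =>
     M * `|1 * bform (MJ j) a (u x) (v x)| + `|1 * bform (MJ j) a (wpartial Omega j u x) (v x)| +
     `|1 * bform (MJ j) a (u x) (wpartial Omega j v x)|)).
  - move=> n; apply: (integ_meas (mu := leb3)).
    have b1 x : Omega x -> `|chi n x| <= M + 1.
      by move=> _; apply: le_trans (B1 n x) _; rewrite lerDr.
    have b2 x : Omega x -> `|'D_(unit_vec j) (chi n) x| <= M + 1.
      by move=> _; apply: le_trans (B3 n x j) _; rewrite lerDl.
    exact: (green_bound_integrable C2O a du dv b1 b2 (Ck_chi n)).
  - have := integ_meas (integD mO (i2 j) (i3 j)).
    by apply: eq_measurable_fun => x _; rewrite !mul1r.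
  - move=> x Ox; set b1 := bform _ a (wpartial _ _ _ _) _; set b2 := bform _ a _ (wpartial _ _ _ _).
    rewrite (_ : b1 + b2 = 0 * bform (MJ j) a (u x) (v x) + 1 * b1 + 1 * b2); last first.
      by rewrite mul0r add0r !mul1r.
    apply: cvgD; first apply: cvgD.
    + by apply: cvgM; [exact: cv1|exact: cvg_cst].
    + by apply: cvgM; [exact: cv0|exact: cvg_cst].
    + by apply: cvgM; [exact: cv0|exact: cvg_cst].
  - have ia f : leb3.-integrable Omega (EFin \o f) ->
      leb3.-integrable Omega (EFin \o (fun x => `|f x|)) by move=> i; exact: integrable_abse i.
    exact: (integD mO (integD mO (integZ mO M (ia _ (i1 j))) (ia _ (i2 j))) (ia _ (i3 j))).
  - move=> n x Ox; rewrite /green_term.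
    apply: le_trans (ler_normD _ _) _; apply: lerD; first (apply: le_trans (ler_normD _ _) _; apply: lerD).
    + by rewrite mul1r normrM ler_wpM2r.
    + by rewrite mul1r normrM ler_piMl.
    + by rewrite mul1r normrM ler_piMl.
have E n : \sum_j Rintegral leb3 Omega (green_term Omega u v a (chi n) j) = 0.
  exact: (green_compact C2O surf a du dv (Ck_chi n) (@chi_out n)).
have L1 : (0 : R) @[n --> \oo] --> \sum_(j < 3) Rintegral leb3 Omega (fun x =>
     bform (MJ j) a (wpartial Omega j u x) (v x) + bform (MJ j) a (u x) (wpartial Omega j v x)).
  have := @cvg_sumr _ _ (index_enum 'I_3) _ _ lim.
  by rewrite (funext E).
by apply: (cvg_unique (@Rhausdorff R) L1); exact: cvg_cst.
Qed.

End Symmetric.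
(** The mass terms cancel because beta^T J = J beta, while alpha_j^T J = - J alpha_j makes the two
    derivative terms add up to a divergence. *)
Lemma form_dirac (R : realType) (Omega : set (R * R * R)) (s t : spinor_field R) x :
  (dirac Omega s x)^T *m Jmx *m t x - (s x)^T *m Jmx *m dirac Omega t x =
  ii *: \sum_(j < 3) ((wpartial Omega j s x)^T *m (Jmx *m alpha j) *m t x +
    (s x)^T *m (Jmx *m alpha j) *m wpartial Omega j t x).
Proof.
rewrite /dirac linearB linearZ /= linear_sum /= trmx_mul.
rewrite !mulmxBl !mulmxBr -(mulmxA (s x)^T) betaT_J.
rewrite !mulmxA opprB addrACA.
set A := _ *m beta *m _; set B := _ *m (ii *: _); set C := ii *: _ *m _ *m _.
have -> : A + B + (- C - A) = B - C.
  by rewrite [- C - A]addrC addrA (addrC A) addrK.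
rewrite /B /C -scalemxAr -!scalemxAl -scalerBr; congr (_ *: _).
rewrite big_split /= addrC mulmx_sumr !mulmx_suml -sumrN; congr (_ + _); apply: eq_bigr => j _.
  by rewrite !mulmxA.
by rewrite trmx_mul -!mulmxA (mulmxA (alpha j)^T) alphaT_J mulNmx mulmxN opprK !mulmxA.
Qed.

Section Sqint4.
Context d (T : measurableType d) (R : realType) (mu : {measure set T -> \bar R}).
Variable D : set T.
Hypothesis mD : measurable D.
Implicit Types u v : T -> 'cV[R[i]]_4.

Lemma sqint4D u v : sqint4 mu D u -> sqint4 mu D v -> sqint4 mu D (fun x => u x + v x).
Proof.
move=> su sv p; have := sqintD mD (su p) (sv p).
have E : cmp p (fun x => u x + v x) = fun x => cmp p u x + cmp p v x.
  by apply/funext => x; rewrite /cmp mxE cpartD.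
by rewrite E.
Qed.

Lemma sqint4_0 : sqint4 mu D (fun=> 0).
Proof.
move=> p; have E : cmp p (fun _ : T => 0 : 'cV[R[i]]_4) = fun=> 0.
  by apply/funext => x; rewrite /cmp mxE; case: p.2.
by rewrite E; exact: sqint0.
Qed.

Lemma cpart_mul b (z w : R[i]) : cpart b (z * w) =
  cpart b z * cpart false w + cpart b (z * ii) * cpart true w.
Proof. by case: z w => [p q] [r t]; case: b => /=; ring. Qed.

Lemma sqint4_mulmx (M : 'M[R[i]]_4) u : sqint4 mu D u -> sqint4 mu D (fun x => M *m u x).
Proof.
move=> su p; rewrite /cmp.
under eq_fun do rewrite mxE cpart_sum.
elim: (index_enum _) => [|j l IH]; first by under eq_fun do rewrite big_nil; exact: sqint0.
under eq_fun do rewrite big_cons cpart_mul.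
apply: (sqintD mD) IH; apply: (sqintD mD); apply: (sqintZ mD).
  exact: (su (j, false)).
exact: (su (j, true)).
Qed.

Lemma sqint4_sum (I : Type) (l : seq I) (F : I -> T -> 'cV[R[i]]_4) :
  (forall i, sqint4 mu D (F i)) -> sqint4 mu D (fun x => \sum_(i <- l) F i x).
Proof.
move=> sF; elim: l => [|i l IH]; first by under eq_fun do rewrite big_nil; exact: sqint4_0.
by under eq_fun do rewrite big_cons; exact: sqint4D.
Qed.

End Sqint4.

Section DiracSymmetric.
Context {R : realType}.
Variable Omega : set (R * R * R).
Hypothesis C2O : C2_domain Omega.
Let oO : open Omega. Proof. by case: C2O. Qed.
Let mO : measurable (Omega : set (space3 R)) := open_measurable3 oO.
Variables (sigma : {measure set (space3 R) -> \bar R}).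
Hypothesis surf : surface_measure Omega sigma.

(** The factor i in [form_dirac] exchanges real and imaginary parts, whence [~~ a] and the sign. *)
Lemma bform_dirac (s t : spinor_field R) a x :
  bform Jmx a (dirac Omega s x) (t x) - bform Jmx a (s x) (dirac Omega t x) =
  (-1) ^+ (~~ a) * \sum_(j < 3) (bform (Jmx *m alpha j) (~~ a) (wpartial Omega j s x) (t x) +
    bform (Jmx *m alpha j) (~~ a) (s x) (wpartial Omega j t x)).
Proof.
have E (M N : 'M[R[i]]_1) : M 0 0 - N 0 0 = (M - N) 0 0 by rewrite !mxE.
rewrite /bform -cpartB E form_dirac mxE summxE.
have iE (z : R[i]) : cpart a (ii * z) = (-1) ^+ (~~ a) * cpart (~~ a) z.
  by case: z => p q; case: (a); rewrite /= ?expr0 ?expr1 !(mul0r, mul1r, mulN1r, add0r, sub0r).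
rewrite iE cpart_sum; congr (_ * _); apply: eq_bigr => j _.
by rewrite mxE cpartD.
Qed.

Lemma dirac_sqint4 u : dom Omega sigma u -> sqint4 leb3 Omega (dirac Omega u).
Proof.
move=> du; rewrite /dirac.
have -> : (fun x => beta *m u x - ii *: \sum_(j < 3) alpha j *m wpartial Omega j u x) =
    fun x => beta *m u x + ((- ii)%:M : 'M[R[i]]_4) *m \sum_(j < 3) alpha j *m wpartial Omega j u x.
  by apply/funext => x; rewrite mul_scalar_mx scaleNr.
apply: (sqint4D mO); apply: (sqint4_mulmx mO); first exact: (dom_sqint4 oO du).
by apply: (sqint4_sum mO) => j; apply: (sqint4_mulmx mO); exact: (dom_wpartial_sqint4 oO j du).
Qed.

Lemma dirac_symmetric u v a : dom Omega sigma u -> dom Omega sigma v ->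
  Rintegral leb3 Omega (fun x => bform Jmx a (dirac Omega u x) (v x)) =
  Rintegral leb3 Omega (fun x => bform Jmx a (u x) (dirac Omega v x)).
Proof.
move=> du dv.
have su := dom_sqint4 oO du; have sv := dom_sqint4 oO dv.
have swu j := dom_wpartial_sqint4 oO j du; have swv j := dom_wpartial_sqint4 oO j dv.
have ib M b s t : sqint4 leb3 Omega s -> sqint4 leb3 Omega t ->
    leb3.-integrable Omega (EFin \o (fun x => bform M b (s x) (t x))).
  move=> ss st; have mone : measurable_fun (Omega : set (space3 R)) (fun=> 1 : R).
    exact: measurable_cst.
  have one1 (x : R * R * R) : Omega x -> `|1 : R| <= 1 by rewrite normr1.
  have := bform_integrable mO M b mone one1 ss st.
  by under eq_fun do rewrite mul1r.
have i1 := ib Jmx a _ _ (dirac_sqint4 du) sv; have i2 := ib Jmx a _ _ su (dirac_sqint4 dv).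
apply/eqP; rewrite -subr_eq0 -(RintegralB mO i1 i2); apply/eqP.
under eq_Rintegral do rewrite bform_dirac.
have i3 j := integD mO (ib (Jmx *m alpha j) (~~ a) _ _ (swu j) sv)
   (ib (Jmx *m alpha j) (~~ a) _ _ su (swv j)).
have [i4 E] := Rintegral_sum mO (index_enum _) i3.
by rewrite RintegralZl// E (green_identity C2O surf)// mulr0.
Qed.

End DiracSymmetric.

(** * Analytic continuation of scalar Laurent expansions *)

Section Modulus.
Context {R : realType}.
Implicit Types z w : R[i].

(** The norm of [R[i]] takes its values in [R[i]]; this is the modulus as an element of [R]. *)
Definition modc z : R := Normc.normc z.

Lemma modc0 : modc 0 = 0. Proof. exact: Normc.normc0. Qed.
Lemma modcM z w : modc (z * w) = modc z * modc w. Proof. exact: Normc.normcM. Qed.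
Lemma modcV z : modc z^-1 = (modc z)^-1. Proof. exact: Normc.normcV. Qed.
Lemma modcD z w : modc (z + w) <= modc z + modc w. Proof. exact: le_normcD. Qed.
Lemma modcN z : modc (- z) = modc z. Proof. exact: normcN. Qed.

Lemma modcB z w : modc (z - w) <= modc z + modc w.
Proof. by rewrite -(modcN w) modcD. Qed.

Lemma modc_ge0 z : 0 <= modc z.
Proof. by case: z => x y; exact: sqrtr_ge0. Qed.

Lemma modc_eq0 z : (modc z == 0) = (z == 0).
Proof. by apply/eqP/eqP => [/Normc.eq0_normc//|->]; exact: modc0. Qed.

Lemma modc_gt0 z : (0 < modc z) = (z != 0).
Proof. by rewrite lt_neqAle modc_ge0 andbT eq_sym modc_eq0. Qed.

Lemma modcX z n : modc (z ^+ n) = modc z ^+ n.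
Proof. by elim: n => [|n IH]; [exact: Normc.normc1|rewrite !exprS modcM IH]. Qed.

Lemma modc_sum n (F : nat -> R[i]) : modc (\sum_(k < n) F k) <= \sum_(k < n) modc (F k).
Proof.
elim: n => [|n IH]; first by rewrite !big_ord0 modc0.
by rewrite !big_ord_recr /=; apply: le_trans (modcD _ _) _; rewrite lerD2r.
Qed.

Lemma modc_lt z (e : R) : (`|z| < e%:C) = (modc z < e).
Proof. exact: ltcR. Qed.

End Modulus.

Section LaurentScalar.
Context {R : realType}.
Implicit Types (a : nat -> R[i]) (t : R[i]).

Definition sum_to a t (l : R[i]) : Prop := forall e : R, 0 < e ->
  exists n0, forall n, (n0 <= n)%N -> modc (l - \sum_(k < n) t ^+ k * a k) <= e.

(* Stated for the sum without the factor t^-N, which does not change where it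
   vanishes. *)
Definition vanishing_near0 a : Prop :=
  forall d : R, 0 < d -> exists t, [/\ t != 0, modc t < d & sum_to a t 0].

Lemma geometric_sum_le2 (x : R) n : 0 <= x <= 1 / 2 -> \sum_(k < n) x ^+ k <= 2.
Proof.
move=> /andP[x0 x1]; suff H : \sum_(k < n) x ^+ k <= 2 - 2 * x ^+ n.
  by apply: le_trans H _; rewrite gerBl mulr_ge0// exprn_ge0.
elim: n => [|n IH]; first by rewrite big_ord0 expr0; lra.
rewrite big_ord_recr /= exprS; have y0 : 0 <= x ^+ n by rewrite exprn_ge0.
have : x * x ^+ n <= 1 / 2 * x ^+ n by rewrite ler_wpM2r.
move: IH y0; set s := \sum_(_ < _) _; set y := x ^+ n; set w := x * y; lra.
Qed.

(** Convergence at one t1 <> 0 bounds |a_i| |t1|^i by some B. At a much smaller zero t the terms of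
    positive degree add up to at most 2 B |t| / |t1|, too little to compensate a nonzero a_0. *)
Lemma vanishing_coef0 a : vanishing_near0 a -> a 0%N = 0.
Proof.
move=> H; apply/eqP; apply/negPn/negP; rewrite -modc_gt0 => al0.
have [t1 [t10 _ s1]] := H 1 ltr01.
have r0 : 0 < modc t1 by rewrite modc_gt0.
have [n0 Hn0] := s1 1 ltr01.
have [B B0 HB] : exists2 B, 0 <= B & forall i, modc (a i) * modc t1 ^+ i <= B.
  (* From n0 on, partial sums are within 1 of the limit, so each term is at most 2; the sum covers
     the earlier terms. *)
  exists (2 + \sum_(k < n0) modc (t1 ^+ k * a k)).
    by rewrite addr_ge0// sumr_ge0// => k _; exact: modc_ge0.
  move=> i; rewrite mulrC -modcX -modcM.
  have [ni|ni] := leqP n0 i; last first.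
    rewrite (bigD1 (Ordinal ni))//= addrCA lerDl addr_ge0// sumr_ge0// => k _; exact: modc_ge0.
  have h1 := Hn0 _ ni; have h2 := Hn0 _ (leqW ni).
  have -> : t1 ^+ i * a i = (0 - \sum_(k < i) t1 ^+ k * a k) - (0 - \sum_(k < i.+1) t1 ^+ k * a k).
    by rewrite big_ord_recr /=; ring.
  apply: le_trans (modcB _ _) _; apply: (@le_trans _ _ 2).
    by move: h1 h2; lra.
  by rewrite lerDl sumr_ge0// => k _; exact: modc_ge0.
set al := modc (a 0%N) in al0.
(* The first bound makes the geometric ratio x = |t| / |t1| at most 1/2, so the series sums to at
   most 2; the second makes 2 B x at most al / 2. With the error al / 4 this contradicts al > 0. *)
pose d := Num.min (modc t1 / 2) (modc t1 * (al / (4 * (B + 1)))).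
have d0 : 0 < d by rewrite lt_min divr_gt0//= mulr_gt0// divr_gt0// mulr_gt0//; lra.
have [t [t0 td st]] := H d d0.
have al4 : 0 < al / 4 by rewrite divr_gt0.
have [m Hm] := st _ al4.
have {Hm} := Hm m.+1 (leqnSn m).
rewrite big_ord_recl expr0 mul1r /= sub0r modcN => Hm.
have {}Hm : al <= al / 4 + modc (\sum_(i < m) t ^+ (bump 0 i) * a (bump 0 i)).
  move: Hm; set w := \sum_(_ < _) _ => Hm; apply: (@le_trans _ _ (modc (a 0%N + w) + modc w)).
    by rewrite /al -{1}(addrK w (a 0%N)); exact: modcB.
  by rewrite lerD2r.
pose x := modc t / modc t1.
have x0 : 0 <= x by rewrite divr_ge0// ?modc_ge0// ltW.
move: td; rewrite lt_min => /andP[td1 td2].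
have x1 : x <= 1 / 2 by rewrite ler_pdivrMr// mulrC mul1r ltW.
have x2 : x < al / (4 * (B + 1)) by rewrite ltr_pdivrMr// mulrC.
have : modc (\sum_(i < m) t ^+ (bump 0 i) * a (bump 0 i)) <= B * (x * 2).
  apply: le_trans (modc_sum _ (fun i => t ^+ (bump 0 i) * a (bump 0 i))) _.
  apply: (@le_trans _ _ (\sum_(i < m) B * (x * x ^+ i))).
    apply: ler_sum => i _; rewrite /bump /= add1n modcM modcX -exprS /x expr_div_n.
    by rewrite mulrA ler_pdivlMr ?exprn_gt0// -mulrA [leRHS]mulrC ler_wpM2l ?exprn_ge0 ?modc_ge0// HB.
  rewrite -mulr_sumr ler_wpM2l// -mulr_sumr ler_wpM2l// geometric_sum_le2//.
  by rewrite x0.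
move=> H1.
have H2 : B * (x * 2) <= al / 2.
  move: x2; rewrite ltr_pdivlMr ?mulr_gt0//; last by lra.
  nra.
lra.
Qed.

(** Once a_0 = 0, the series divided by t vanishes at the same points, and its coefficients are
    those of a shifted by one. *)
Lemma vanishing_coef a : vanishing_near0 a -> forall k, a k = 0.
Proof.
move=> H k; elim: k a H => [|k IH] a H; first exact: vanishing_coef0.
have a0 := vanishing_coef0 H; apply: (IH (fun i => a i.+1)) => d d0.
have [t [t0 td st]] := H d d0; exists t; split=> // e e0.
have mt : 0 < modc t by rewrite modc_gt0.
have [n0 Hn0] := st (e * modc t) (mulr_gt0 e0 mt); exists n0 => n nn0.
have := Hn0 n.+1 (leqW nn0); rewrite big_ord_recl a0 mulr0 add0r !sub0r !modcN.
have -> : \sum_(i < n) t ^+ bump 0 i * a (bump 0 i) = (\sum_(i < n) t ^+ i * a i.+1) * t.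
  rewrite mulr_suml; apply: eq_bigr => i _.
  by rewrite /bump /= add1n exprS; ring.
by rewrite !add0r modcM ler_pM2r.
Qed.

End LaurentScalar.

(** * The surface M in the global coordinate s, and the identity theorem on it *)

Section Uniformizer.
Context {R : realType}.
Implicit Types (s : R[i]) (p q : R[i] * R[i]) (H : R[i] * R[i] -> R[i]) (a : nat -> R[i]).

(* The inverse of (z, omega) |-> s = z + omega, as z - omega = 1 / s on M. *)
Definition surf_point (s : R[i]) : R[i] * R[i] := ((s + s^-1) / 2, (s - s^-1) / 2).

Lemma surf_pointP s : s != 0 -> surfM (surf_point s).
Proof. by move=> s0; rewrite /surfM /surf_point /=; field. Qed.

Lemma surf_pointK (p : R[i] * R[i]) : surfM p -> p.1 + p.2 != 0 /\ surf_point (p.1 + p.2) = p.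
Proof.
case: p => z w; rewrite /surfM /surf_point /= => E.
have P : (z + w) * (z - w) = 1 by rewrite mulrC -subr_sqr E opprB addrC subrK.
have n0 : z + w != 0 by apply/eqP => Z; move: P; rewrite Z mul0r => /esym/eqP; rewrite oner_eq0.
split=> //; have -> : (z + w)^-1 = z - w by apply: (mulfI n0); rewrite mulfV.
by congr pair; field.
Qed.

Definition scalar_laurent H p (N : nat) a : Prop := exists eps : R, 0 < eps /\
  forall q, surfM q -> `|q.1 - p.1| < eps%:C -> `|q.2 - p.2| < eps%:C -> (q = p -> N = 0%N) ->
  forall e : R, 0 < e -> exists n0, forall n, (n0 <= n)%N ->
    modc (H q - \sum_(k < n) local_coord p q ^+ k / local_coord p q ^+ N * a k) <= e.

(** Differences of z = (s + 1/s)/2 factor with e = 1 and those of omega = (s - 1/s)/2 with e = -1;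
    s0^2 <> e says that the derivative of the chosen coordinate in s is nonzero at s0. *)
Lemma local_coord_surf_point s0 : s0 != 0 -> exists e : R[i],
  [/\ e * e = 1, s0 * s0 != e & forall s, s != 0 ->
  local_coord (surf_point s0) (surf_point s) = (s - s0) * (1 - e / (s * s0)) / 2].
Proof.
move=> s00; rewrite /local_coord /=; have [E|E] := eqVneq ((s0 - s0^-1) / 2) 0.
  exists (-1); split; last by move=> s sn0; field; rewrite s00 sn0.
    by rewrite mulrNN mulr1.
  have -> : s0 * s0 = 1.
    have : s0 * s0 - 1 = 2 * s0 * ((s0 - s0^-1) / 2) by field.
    by rewrite E mulr0 => /eqP; rewrite subr_eq0 => /eqP.
  by rewrite -subr_eq0 opprK -mulr2n pnatr_eq0.
exists 1; split; last by move=> s sn0; field; rewrite s00 sn0.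
  by rewrite mulr1.
apply/eqP => s2; move/eqP: E; apply.
have -> : (s0 - s0^-1) / 2 = (s0 * s0 - 1) / (2 * s0) by field.
by rewrite s2 subrr mul0r.
Qed.

Lemma surf_point_near s0 : s0 != 0 -> exists r K : R, [/\ 0 < r, 0 < K &
  forall s, s != s0 -> modc (s - s0) < r ->
  [/\ s != 0, local_coord (surf_point s0) (surf_point s) != 0,
    modc (local_coord (surf_point s0) (surf_point s)) <= K * modc (s - s0),
    modc ((surf_point s).1 - (surf_point s0).1) <= K * modc (s - s0) &
    modc ((surf_point s).2 - (surf_point s0).2) <= K * modc (s - s0)]].
Proof.
move=> s00; have [e [e1 es lc]] := local_coord_surf_point s00.
have m0 : 0 < modc s0 by rewrite modc_gt0.
have c2 : 0 < modc (2^-1 : R[i]) by rewrite modc_gt0 invr_eq0 pnatr_eq0.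
(* Bounds the factor (1 - f / (s s0)) / 2 for |f| = 1 as long as |s| >= |s0| / 2. *)
pose K := (1 + 1 / (modc s0 / 2 * modc s0)) * modc (2^-1 : R[i]).
have q0 : 0 < modc s0 / 2 * modc s0 by rewrite mulr_gt0// divr_gt0.
have bound f s : f * f = 1 -> s != 0 -> modc (s - s0) < modc s0 / 2 ->
    modc ((s - s0) * (1 - f / (s * s0)) / 2) <= K * modc (s - s0).
  move=> f1 sn0 sr; have mf : modc f = 1.
    apply/eqP; rewrite -(@pexpr_eq1 _ _ 2)// ?modc_ge0// expr2 -modcM f1.
    by apply/eqP; exact: Normc.normc1.
  rewrite !modcM (_ : K * _ = modc (s - s0) * (1 + 1 / (modc s0 / 2 * modc s0)) * modc (2^-1 : R[i]));
    last by rewrite /K; ring.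
  rewrite ler_wpM2r ?(ltW c2)// ler_wpM2l ?modc_ge0//.
  apply: le_trans (modcB _ _) _; rewrite (_ : modc 1 = 1) ?lerD2l; last exact: Normc.normc1.
  rewrite modcM modcV modcM mf !mul1r lef_pV2 ?posrE ?mulr_gt0 ?modc_gt0 ?divr_gt0//.
  rewrite ler_wpM2r ?(ltW m0)//.
  have : modc s0 <= modc s + modc (s - s0).
    by apply: le_trans (modcB _ _); rewrite opprB addrC subrK.
  by move: sr; set x := modc (s - s0); set y := modc s; set z := modc s0; lra.
(* The first radius keeps |s| >= |s0| / 2; the second excludes s s0 = e, where the local coordinate
   would vanish again. *)
exists (Num.min (modc s0 / 2) (modc (s0 * s0 - e) / modc s0)), K; split.
- by rewrite lt_min !divr_gt0// modc_gt0 subr_eq0.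
- by rewrite mulr_gt0// addr_gt0// divr_gt0.
- move=> s ss0; rewrite lt_min => /andP[s1 s2].
  have sn0 : s != 0.
    apply/eqP => E; move: s1; rewrite E sub0r modcN; lra.
  rewrite lc//; split=> //.
  + rewrite !mulf_neq0 ?subr_eq0// ?invr_eq0 ?pnatr_eq0//.
    apply/eqP => E; move: s2; rewrite ltr_pdivlMr// -modcM.
    have -> : (s - s0) * s0 = - (s0 * s0 - e).
      have -> : e = s * s0 by rewrite -[LHS](@divfK _ (s * s0)) ?mulf_neq0// -E mul1r.
      by ring.
    by rewrite modcN ltxx.
  + exact: bound.
  + rewrite (_ : _ - _ = (s - s0) * (1 - 1 / (s * s0)) / 2); first by rewrite bound// mulr1.
    by rewrite /surf_point /=; field; rewrite s00 sn0.
  + rewrite (_ : _ - _ = (s - s0) * (1 - (-1) / (s * s0)) / 2); first by rewrite bound// mulrNN mulr1.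
    by rewrite /surf_point /=; field; rewrite s00 sn0.
Qed.

Lemma modc_real (x : R) : modc x%:C = `|x|.
Proof. by rewrite /modc /= expr0n /= addr0 sqrtr_sqr. Qed.

Lemma modc_imag (y : R) : modc (0 +i* y) = `|y|.
Proof. by rewrite /modc /= expr0n /= add0r sqrtr_sqr. Qed.

(** Multiplication by t^N turns the Laurent expansion into a power series in t; the bound on t lets
    smallness be measured in s. *)
Lemma laurent_sum_to H s0 N a : s0 != 0 -> scalar_laurent H (surf_point s0) N a ->
  exists d K : R, [/\ 0 < d, 0 < K & forall s, s != s0 -> modc (s - s0) < d ->
  let t := local_coord (surf_point s0) (surf_point s) in
  [/\ t != 0, modc t <= K * modc (s - s0) & sum_to a t (t ^+ N * H (surf_point s))]].
Proof.
move=> s00 [eps [e0 HL]]; have [r [K [r0 K0 near]]] := surf_point_near s00.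
exists (Num.min r (eps / K)), K; split=> //; first by rewrite lt_min r0 divr_gt0.
move=> s ss0; rewrite lt_min => /andP[sr se] t; have [sn0 tn0 tK q1 q2] := near s ss0 sr.
split=> // e ep; have mt : 0 < modc t ^+ N by rewrite exprn_gt0// modc_gt0.
have sK : K * modc (s - s0) < eps by rewrite mulrC -ltr_pdivlMr.
have [|||qp|n0 Hn0] := HL (surf_point s) _ _ _ _ (e / modc t ^+ N) (divr_gt0 ep mt).
- exact: surf_pointP.
- by rewrite modc_lt; exact: le_lt_trans q1 sK.
- by rewrite modc_lt; exact: le_lt_trans q2 sK.
- by move: tn0; rewrite qp /local_coord; case: ifP; rewrite subrr eqxx.
exists n0 => n nn0; have := Hn0 n nn0; rewrite ler_pdivlMr// -modcX -modcM mulrBl.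
congr (modc (_ - _) <= _); first by rewrite mulrC.
rewrite mulr_suml; apply: eq_bigr => k _.
by rewrite mulrAC divfK// expf_neq0.
Qed.

(** The identity theorem at one point: zeros accumulating at s0 kill all coefficients of the power
    series of t^N H, and then H itself on a punctured disc. *)
Lemma laurent_zeros H s0 N a : s0 != 0 -> scalar_laurent H (surf_point s0) N a ->
  (forall d : R, 0 < d -> exists s, [/\ s != s0, modc (s - s0) < d & H (surf_point s) = 0]) ->
  (forall k, a k = 0) /\
  exists2 d : R, 0 < d & forall s, s != s0 -> modc (s - s0) < d -> H (surf_point s) = 0.
Proof.
move=> s00 /(laurent_sum_to s00)[d1 [K [d10 K0 L]]] Hz.
have a0 : forall k, a k = 0.
  apply: vanishing_coef => d d0.
  have [|s [ss0 sd Hs]] := Hz (Num.min d1 (d / K)); first by rewrite lt_min d10 divr_gt0.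
  move: sd; rewrite lt_min => /andP[sd1 sd].
  have [tn0 tK] := L s ss0 sd1; rewrite Hs mulr0 => st.
  exists (local_coord (surf_point s0) (surf_point s)); split=> //.
  by apply: le_lt_trans tK _; rewrite mulrC -ltr_pdivlMr.
split=> //; exists d1 => // s ss0 sd; have [tn0 tK st] := L s ss0 sd.
set t := local_coord _ _ in tn0 st.
apply/eqP; rewrite -(mulrI_eq0 _ (mulfI (expf_neq0 N tn0))).
apply/negPn/negP; rewrite -modc_gt0 => h0.
have h2 : 0 < modc (t ^+ N * H (surf_point s)) / 2 by rewrite divr_gt0.
have [n0 Hn0] := st _ h2; have := Hn0 n0 (leqnn _).
rewrite big1 => [|k _]; last by rewrite a0 mulr0.
by rewrite subr0; move: h0; set y := modc _; lra.
Qed.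

(** The coefficients of t times the series of [a]. *)
Definition shift a k : R[i] := if k is j.+1 then a j else 0.

Lemma sum_to_shift a t l : sum_to a t l -> sum_to (shift a) t (t * l).
Proof.
move=> st e e0; have m1 : 0 < modc t + 1 by have := modc_ge0 t; lra.
have [n0 Hn0] := st (e / (modc t + 1)) (divr_gt0 e0 m1); exists n0.+1 => -[//|n] nn0.
rewrite big_ord_recl /= mulr0 add0r.
have -> : \sum_(i < n) t ^+ bump 0 i * a i = t * \sum_(i < n) t ^+ i * a i.
  by rewrite mulr_sumr; apply: eq_bigr => i _; rewrite /bump /= add1n exprS mulrA.
rewrite -mulrBr modcM; have := Hn0 n nn0; rewrite ler_pdivlMr// => H.
by apply: le_trans H; rewrite mulrC ler_wpM2l ?modc_ge0// lerDl.
Qed.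

Lemma sum_toB a b t l m : sum_to a t l -> sum_to b t m -> sum_to (fun k => a k - b k) t (l - m).
Proof.
move=> sa sb e e0; have e2 : 0 < e / 2 by rewrite divr_gt0.
have [n1 H1] := sa _ e2; have [n2 H2] := sb _ e2; exists (maxn n1 n2) => n.
rewrite geq_max => /andP[/H1 h1 /H2 h2].
have -> : l - m - \sum_(k < n) t ^+ k * (a k - b k) =
   (l - \sum_(k < n) t ^+ k * a k) - (m - \sum_(k < n) t ^+ k * b k).
  under eq_bigr do rewrite mulrBr.
  by rewrite sumrB; ring.
by apply: le_trans (modcB _ _) _; rewrite [leRHS](splitr e) lerD.
Qed.

(** Multiplying the pole-free expansion by t^(N + 1) gives a second power series for t^(N + 1) H,
    with zero constant term; the difference of the two vanishes near 0. A genuine pole thus admits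
    no expansion without principal part. *)
Lemma laurent_unique0 H p N a b : surfM p -> scalar_laurent H p 0 b ->
  scalar_laurent H p N.+1 a -> a 0%N = 0.
Proof.
move=> sp; have [s00 <-] := surf_pointK sp; set s0 := p.1 + p.2 in s00 *.
move=> /(laurent_sum_to s00)[d1 [K1 [d10 K10 L1]]] /(laurent_sum_to s00)[d2 [K2 [d20 K20 L2]]].
pose b' := iter N.+1 shift b.
suff : a 0%N - b' 0%N = 0 by rewrite subr0.
apply: (@vanishing_coef _ (fun k => a k - b' k)) => d d0.
pose e := Num.min (Num.min d1 d2) (d / K1) / 2.
have m0 : 0 < Num.min (Num.min d1 d2) (d / K1) by rewrite !lt_min d10 d20 divr_gt0.
have e0 : 0 < e by rewrite divr_gt0.
have : e < Num.min (Num.min d1 d2) (d / K1) by rewrite /e ltr_pdivrMr// ltr_pMr// ltr1n.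
rewrite !lt_min => /andP[/andP[ed1 ed2] edK].
have se : modc (s0 + e%:C - s0) = e by rewrite addrC addKr modc_real gtr0_norm.
have sn : s0 + e%:C != s0 by rewrite -subr_eq0 -modc_eq0 se gt_eqF.
have [|tn0 tK s1] := L1 _ sn; first by rewrite se.
have [|_ _ s2] := L2 _ sn; first by rewrite se.
set t := local_coord _ _ in tn0 tK s1 s2.
exists t; split=> //; first by apply: le_lt_trans tK _; rewrite se mulrC -ltr_pdivlMr.
have s3 M : sum_to (iter M shift b) t (t ^+ M * H (surf_point (s0 + e%:C))).
  elim: M => [|M IH] //=; rewrite exprS -mulrA; exact: sum_to_shift.
by have := sum_toB s2 (s3 N.+1); rewrite subrr.
Qed.

Lemma modc_le (z : R[i]) : modc z <= `|complex.Re z| + `|complex.Im z|.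
Proof.
case: z => x y; rewrite -[complex.Re _]/x -[complex.Im _]/y; have -> : x +i* y = x%:C + (0 +i* y).
  by apply/eqP; rewrite eq_complex /= addr0 add0r !eqxx.
by apply: le_trans (modcD _ _) _; rewrite modc_real modc_imag.
Qed.

Lemma Im_le_modc (z : R[i]) : `|complex.Im z| <= modc z.
Proof.
case: z => x y; rewrite /modc /= -sqrtr_sqr ler_wsqrtr// lerDr sqr_ge0//.
Qed.

Lemma Im_surf_point s : 0 < complex.Im s -> 0 < complex.Im (surf_point s).2.
Proof.
case: s => x y y0.
rewrite -[(surf_point _).2]/((x +i* y - (x +i* y)^-1) / 2).
have -> : (2 : R[i])^-1 = (2^-1)%:C by rewrite fmorphV rmorph_nat.
rewrite -[complex.Im _]/(cpart true _) cpartMr mulr_gt0 ?invr_gt0//=.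
move: y0; rewrite -[complex.Im _]/y => y0.
by rewrite opprK addr_gt0// divr_gt0// ltr_wpDl ?sqr_ge0// exprn_gt0.
Qed.

(** Continuation along s0 + i t: let T be the infimum of the heights above which H vanishes on a
    punctured disc around every point of the half-line. Zeros accumulate at height T, so
    [laurent_zeros] gives a disc there too, which would lower T unless T = 0. *)
Lemma zeros_along_line H s0 :
  (forall p, surfM p -> exists N a, scalar_laurent H p N a) ->
  (forall q, surfM q -> 0 < complex.Im q.2 -> H q = 0) ->
  (forall t : R, 0 <= t -> s0 + (0 +i* t) != 0) ->
  forall d : R, 0 < d -> exists s, [/\ s != s0, modc (s - s0) < d & H (surf_point s) = 0].
Proof.
move=> Lau V line; pose st (t : R) := s0 + (0 +i* t).
have stB t t' : st t - st t' = 0 +i* (t - t').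
  by rewrite /st opprD addrACA subrr add0r; apply/eqP; rewrite eq_complex /= subrr !eqxx.
pose Z (t : R) := exists2 d : R, 0 < d & forall s, s != st t -> modc (s - st t) < d -> H (surf_point s) = 0.
pose S := [set t : R | 0 <= t /\ forall t', t <= t' -> Z t'].
have S0 : S !=set0.
  (* From this height on, the disc of radius 1 around [st t] lies in Im s > 0, where H vanishes. *)
  exists (`|complex.Im s0| + 1); split; first by rewrite addr_ge0.
  move=> t tt; exists 1 => // s _ s1.
  have s2 : 0 < complex.Im s.
    have h1 := le_lt_trans (Im_le_modc _) s1; have h2 := lerNnormlW (lexx `|complex.Im s0|).
    have E : complex.Im (s - st t) = complex.Im s - (complex.Im s0 + t).
      by rewrite /st; case: (s) => ? ?; case: (s0).
    by move: h1; rewrite E ltr_norml => /andP[? _]; lra.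
  apply: V; last exact: Im_surf_point.
  by apply: surf_pointP; apply: contraTneq s2 => ->; rewrite ltxx.
have Slb : lbound S 0 by move=> t [].
have hS : has_inf S by split=> //; exists 0.
pose T := inf S.
have T0 : 0 <= T by exact: lb_le_inf.
have TS t : S t -> T <= t by move=> St; apply: ge_inf => //; exists 0.
have TZ t : T < t -> Z t.
  move=> tT; have e0 : 0 < t - T by rewrite subr_gt0.
  have [t1 [_ St1] t1T] := inf_adherent e0 hS.
  by apply: St1; move: t1T; rewrite addrC subrK => /ltW.
have acc d : 0 < d -> exists s, [/\ s != st T, modc (s - st T) < d & H (surf_point s) = 0].
  move=> d0; have [d' d'0 Hd'] := TZ (T + d / 2) (ltac:(lra)).
  pose e := Num.min (d / 2) d' / 2.
  have e0 : 0 < e by rewrite divr_gt0// lt_min divr_gt0.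
  have [e1 e2] : e < d / 2 /\ e < d'.
    have : e < Num.min (d / 2) d' by rewrite /e; move: e0; rewrite /e; lra.
    by rewrite lt_min => /andP[].
  have E : st (T + d / 2) + e%:C - st T = e +i* (d / 2).
    by rewrite addrAC stB; apply/eqP; rewrite eq_complex /= add0r addr0 addrC addKr !eqxx.
  (* [Z] says nothing at the point of the half-line itself, hence the small horizontal shift by
     e. *)
  exists (st (T + d / 2) + e%:C); split.
  - by rewrite -subr_eq0 E eq_complex /= gt_eqF.
  - rewrite E; apply: le_lt_trans (modc_le _) _ => /=.
    by rewrite (gtr0_norm e0) gtr0_norm ?divr_gt0// [ltRHS](splitr d) ltrD2r.
  - apply: Hd'; last by rewrite addrC addKr modc_real gtr0_norm.
    by rewrite -subr_eq0 addrC addKr eq_complex /= gt_eqF.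
have [N [a L]] := Lau _ (surf_pointP (line T T0)).
have [_ [dl dl0 Hdl]] := laurent_zeros (line T T0) L acc.
have T_0 : T = 0.
  apply/eqP; rewrite eq_le T0 andbT.
  (* Each point of the half-line slightly below [st T] has a disc that stays in the disc of radius
     dl and avoids [st T]; with T > 0 this contradicts the choice of T as infimum. *)
  have : S (Num.max 0 (T - dl / 2)).
    split=> [|t]; first by rewrite le_max lexx.
    rewrite ge_max => /andP[t0 t1].
    have [tT|tT|->] := ltrgtP t T; last by exists dl.
      exists (Num.min (T - t) (dl - (T - t))); first by rewrite lt_min !subr_gt0 tT; lra.
      move=> s _; rewrite lt_min => /andP[m1 m2]; have E : s - st T = (s - st t) + (0 +i* (t - T)).
        by rewrite -stB addrA subrK.
      apply: Hdl.
        apply/eqP => sT; move: m1; rewrite sT stB modc_imag ger0_norm ?ltxx// subr_ge0 ltW//.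
      rewrite E; apply: le_lt_trans (modcD _ _) _; rewrite modc_imag ltr0_norm ?subr_lt0//; lra.
    exact: TZ.
  move/TS; rewrite le_max => /orP[//|]; lra.
move=> d d0; have [s [h1 h2 h3]] := acc d d0.
have st0 : st T = s0.
  by rewrite T_0 /st; apply/eqP; rewrite -subr_eq0 addrC addKr eq_complex /= eqxx.
by exists s; rewrite -st0.
Qed.

(** The half-line going up from s0 = z + omega meets 0 only if s0 = - i t with t > 0, and then omega
    = (s0 - 1/s0)/2 lies in i(-oo, 0]. *)
Lemma laurent_coef_eq0 H (p : R[i] * R[i]) N a : surfM p ->
  (forall p, surfM p -> exists N a, scalar_laurent H p N a) ->
  (forall q, surfM q -> 0 < complex.Im q.2 -> H q = 0) ->
  (~ exists t : R, t <= 0 /\ p.2 = 0 +i* t) ->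
  scalar_laurent H p N a -> forall k, a k = 0.
Proof.
move=> sp Lau V out L; have [s0 E] := surf_pointK sp.
rewrite -E in L; apply: (laurent_zeros s0 L _).1.
apply: (zeros_along_line Lau V) => t t0; apply/eqP => Z; apply: out.
have Es : p.1 + p.2 = 0 +i* (- t).
  apply/eqP; rewrite -subr_eq0 -[X in _ == X]Z -subr_eq0 opprD addrACA subrr add0r.
  by rewrite eq_complex /= !(oppr0, addr0) opprK subrr !eqxx.
have tn0 : t != 0 by apply: contra_neq s0 => tE; rewrite Es tE oppr0.
(* For s = - i t one has 1/s = i/t, so (s - 1/s)/2 is i times this number. *)
exists ((- t - t^-1) / 2); split.
  by have := t0; rewrite -invr_ge0; set x := t^-1; lra.
rewrite -E Es /surf_point.
have -> : (0 +i* (- t))^-1 = 0 +i* t^-1.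
  have n0 : 0 +i* (- t) != 0 :> R[i] by rewrite -Es.
  apply: (mulfI n0); rewrite mulfV//; apply/esym/eqP.
  by rewrite eq_complex /= !mul0r mulr0 addr0 sub0r mulNr opprK divff// !eqxx.
have -> : (2 : R[i])^-1 = (2^-1)%:C by rewrite fmorphV rmorph_nat.
by apply/eqP; rewrite eq_complex /= !(mulr0, mul0r, subr0, addr0, oppr0, add0r) !eqxx.
Qed.

End Uniformizer.

Lemma ae_integ d (T : measurableType d) (R : realType) (mu : {measure set T -> \bar R}) (D : set T)
    (f g : T -> R) : measurable D -> mu.-integrable D (EFin \o f) -> measurable_fun D g ->
  {ae mu, forall x, D x -> f x = g x} ->
  mu.-integrable D (EFin \o g) /\ Rintegral mu D f = Rintegral mu D g.
Proof.
move=> mD fi mg fg; have mf := integ_meas fi; split.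
  apply/integrableP; split; first exact/measurable_EFinP.
  have /integrableP[_] := fi; rewrite (_ : (\int[mu]_(x in D) _ = \int[mu]_(x in D) `|(EFin \o g) x|)%E)//.
  apply: ae_eq_integral => //.
  - by apply/measurableT_comp => //; exact/measurable_EFinP.
  - by apply/measurableT_comp => //; exact/measurable_EFinP.
  - by apply: (ae_imp fg) => x Hx Dx /=; rewrite Hx.
rewrite /Rintegral; congr fine; apply: ae_eq_integral => //.
- exact/measurable_EFinP.
- exact/measurable_EFinP.
- by apply: (ae_imp fg) => x Hx Dx /=; rewrite Hx.
Qed.

(** * The pairing of compactly supported and local fields *)

Section Weights.
Context {R : realType}.

(* Test functions equal to 1 on a ball are avoided: w divides by the values of
   chi, which are bounded below on the ball. *)
Lemma cutoff_weight (rho : R) : exists (chi w : R * R * R -> R) (K : R),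
  [/\ test_function setT chi, measurable_fun setT (w : space3 R -> R),
    forall x, `|w x| <= K & forall x, ball (0 : R * R * R) rho x -> w x * chi x = 1].
Proof.
pose chi := cbump (0 : R * R * R) (rho + 1) 0.
have [m m0 Hm] := @cbump_lower R 0 rho (rho + 1) 0 (ltac:(lra)).
exists chi, (fun x => (Num.max m (chi x))^-1), m^-1; split.
- exact: test_cbumpT.
- apply: continuous_measurable3 => x; apply: cvgV.
    by rewrite gt_eqF// lt_max m0.
  apply: (@continuous_max _ _ (fun=> m) chi); first exact: cvg_cst.
  exact: (Ck_continuous (smooth_cbump 0 (rho + 1) 0 0)).
- move=> x; have h : 0 < Num.max m (chi x) by rewrite lt_max m0.
  by rewrite gtr0_norm ?invr_gt0// lef_pV2 ?posrE// le_max lexx.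
- move=> x; rewrite -cube_ball => /Hm h; rewrite (max_idPr h) mulVf// gt_eqF//.
  exact: lt_le_trans h.
Qed.

End Weights.

Section Pairing.
Context {R : realType}.
Variable Omega : set (R * R * R).
Hypothesis oO : open Omega.
Let mO : measurable (Omega : set (space3 R)) := open_measurable3 oO.
Implicit Types (f g u v : spinor_field R).

(** What the pairing uses of membership in [dom_loc]: square-integrability on bounded parts of
    Omega, up to the boundary. *)
Definition loc_sqint u : Prop := forall chi : R * R * R -> R, test_function setT chi ->
  sqint4 leb3 Omega (cutoff chi u).

Lemma cmp_cutoff (p : 'I_4 * bool) (chi : R * R * R -> R) u x : cmp p (cutoff chi u) x = chi x * cmp p u x.
Proof. by rewrite /cmp /cutoff mxE mulrC cpartMr mulrC. Qed.

Lemma sqint4_cutoff (c : R * R * R -> R) K u : measurable_fun (Omega : set (space3 R)) c ->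
  (forall x, Omega x -> `|c x| <= K) -> sqint4 leb3 Omega u -> sqint4 leb3 Omega (cutoff c u).
Proof.
move=> mc cK su p; have := sqint_bmul mO mc cK (su p).
by congr sqint; apply/funext => x; exact: (esym (cmp_cutoff _ _ _ _)).
Qed.

Lemma sqint4_loc u : sqint4 leb3 Omega u -> loc_sqint u.
Proof.
move=> su chi tc; have [r r0 Hr] := test_support tc.
have [K HK] := bounded_chi (test_Ck 1 tc) Hr.
apply: (sqint4_cutoff _ (fun x _ => (HK x).1)) => //.
by apply: measurable_funTS; apply: continuous_measurable3; exact: (test_Ck 0 tc).
Qed.

Lemma loc_sqintD u v : loc_sqint u -> loc_sqint v -> loc_sqint (fun x => u x + v x).
Proof.
move=> lu lv chi tc; have := sqint4D mO (lu chi tc) (lv chi tc).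
by congr sqint4; apply/funext => x; rewrite /cutoff scalerDr.
Qed.

Lemma loc_sqintZ (c : R[i]) u : loc_sqint u -> loc_sqint (fun x => c *: u x).
Proof.
move=> lu chi tc; have := sqint4_mulmx mO c%:M (lu chi tc).
congr sqint4; apply/funext => x; rewrite /cutoff mul_scalar_mx.
by rewrite !scalerA mulrC.
Qed.

(** On the ball of radius n the component equals a weight times that of a square-integrable cutoff
    of u; these measurable functions are eventually constant at each point. *)
Lemma loc_sqint_measurable u p : loc_sqint u -> measurable_fun (Omega : set (space3 R)) (cmp p u).
Proof.
move=> lu; pose W n := cid (cutoff_weight (n%:R : R)).
have H n : exists h : space3 R -> R, measurable_fun (Omega : set (space3 R)) h /\
    forall x, ball (0 : R * R * R) n%:R x -> h x = cmp p u x.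
  have [chi [w [K [tc mw wK wc]]]] := cutoff_weight (n%:R : R).
  exists (fun x => w x * cmp p (cutoff chi u) x); split.
    by apply: measurable_funM; [exact: measurable_funTS|have [] := lu chi tc p].
  by move=> x xb; rewrite cmp_cutoff mulrA wc// mul1r.
pose h n := sval (cid (H n)).
have hm n : measurable_fun (Omega : set (space3 R)) (h n) := (svalP (cid (H n))).1.
have he n x : ball (0 : R * R * R) n%:R x -> h n x = cmp p u x := (svalP (cid (H n))).2 x.
apply: (measurable_fun_cvg hm) => x _; apply: cvg_near_cst.
(* N exceeds every coordinate of x in absolute value, so x lies in all balls of radius n >= N, which
   are cubes for the product norm. *)
pose N := \max_(j < 3) (Num.truncn `|coord3 j x|).+1.
exists N => // n /= Nn; rewrite he// -cube_ball; apply/cube_coord => j.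
rewrite (_ : coord3 j 0 = 0); last by rewrite /coord3; case: (val j) => [|[|]].
rewrite subr0; apply: (@lt_le_trans _ _ (Num.truncn `|coord3 j x|).+1%:R); first exact: truncnS_gt.
by rewrite ler_nat; apply: leq_trans Nn; exact: (leq_bigmax j).
Qed.

Lemma measurable_bform M a u v : (forall p, measurable_fun (Omega : set (space3 R)) (cmp p u)) ->
  (forall p, measurable_fun (Omega : set (space3 R)) (cmp p v)) ->
  measurable_fun (Omega : set (space3 R)) (fun x => bform M a (u x) (v x)).
Proof.
move=> mu mv; under eq_fun do rewrite bformE.
apply: measurable_sum => p; apply: measurable_funM; first exact: measurable_cst.
by apply: measurable_funM; [exact: (mu p.1)|exact: (mv p.2)].
Qed.

Lemma bform_sqint4_integrable M a u v : sqint4 leb3 Omega u -> sqint4 leb3 Omega v ->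
  leb3.-integrable Omega (EFin \o (fun x => bform M a (u x) (v x))).
Proof.
move=> su sv; have mone : measurable_fun (Omega : set (space3 R)) (fun=> 1 : R).
  exact: measurable_cst.
have one1 (x : R * R * R) : Omega x -> `|1 : R| <= 1 by rewrite normr1.
have := bform_integrable mO M a mone one1 su sv.
by under eq_fun do rewrite mul1r.
Qed.

Lemma L2_in_sqint4 rho f : L2_in Omega rho f -> sqint4 leb3 Omega f.
Proof. by move=> [Lf _]; exact: sqint4_L2. Qed.

(** Since w chi = 1 on the ball that carries f, the pairing of f with u is that of w f with chi u,
    and these two fields are square-integrable. *)
Lemma comp_bform M a rho f u (chi w : R * R * R -> R) (K : R) : L2_in Omega rho f -> loc_sqint u ->
  test_function setT chi -> measurable_fun setT (w : space3 R -> R) -> (forall x, `|w x| <= K) ->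
  (forall x, ball (0 : R * R * R) rho x -> w x * chi x = 1) ->
  leb3.-integrable Omega (EFin \o (fun x => bform M a (f x) (u x))) /\
  Rintegral leb3 Omega (fun x => bform M a (cutoff w f x) (cutoff chi u x)) =
  Rintegral leb3 Omega (fun x => bform M a (f x) (u x)).
Proof.
move=> Lf lu tc mw wK wc; have sf := L2_in_sqint4 Lf.
have swf : sqint4 leb3 Omega (cutoff w f).
  by apply: (sqint4_cutoff (measurable_funTS mw) _ sf) => x _; exact: wK.
apply: ae_integ => //.
- exact: bform_sqint4_integrable swf (lu chi tc).
- apply: measurable_bform => p; first by have [] := sf p.
  exact: loc_sqint_measurable.
- apply: (ae_imp Lf.2) => x Hx Ox.
  have [xb|xb] := pselect (ball (0 : R * R * R) rho x); last first.
    by rewrite Hx// /cutoff Hx// scaler0 /bform trmx0 !mul0mx.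
  have E (k : R[i]) (z : 'cV[R[i]]_4) : (k *: z)^T = k *: z^T by apply/matrixP => i j; rewrite !mxE.
  rewrite /bform /cutoff E -!scalemxAl -scalemxAr scalerA -rmorphM wc// scale1r.
  by [].
Qed.

Lemma comp_bform_integrable M a f u : L2comp Omega f -> loc_sqint u ->
  leb3.-integrable Omega (EFin \o (fun x => bform M a (f x) (u x))).
Proof.
move=> [rho Lf] lu; have [chi [w [K [tc mw wK wc]]]] := cutoff_weight rho.
exact: (comp_bform M a Lf lu tc mw wK wc).1.
Qed.

End Pairing.

Section Pair.
Context {R : realType}.
Variable Omega : set (R * R * R).
Hypothesis oO : open Omega.
Let mO : measurable (Omega : set (space3 R)) := open_measurable3 oO.
Implicit Types (f g u v : spinor_field R) (h : R * R * R -> R[i]).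

Definition cintegrable h : Prop := forall b,
  leb3.-integrable Omega (EFin \o (fun x => cpart b (h x))).

Lemma cpart_cintegral b h : cpart b (cintegral Omega h) = Rintegral leb3 Omega (fun x => cpart b (h x)).
Proof. by case: b. Qed.

Lemma cintegral_linear (c : R[i]) h k : cintegrable h -> cintegrable k ->
  cintegral Omega (fun x => c * h x + k x) = c * cintegral Omega h + cintegral Omega k.
Proof.
move=> ih ik; apply: eq_cpart => b; rewrite cpartD cpart_mul !cpart_cintegral.
have i1 := integZ mO (cpart b c) (ih false).
have i2 := integZ mO (cpart b (c * ii)) (ih true).
rewrite -(RintegralZl (cpart b c) mO (ih false)) -(RintegralZl (cpart b (c * ii)) mO (ih true)).
rewrite -(RintegralD mO i1 i2) -(RintegralD mO (integD mO i1 i2) (ik b)).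
by apply: eq_Rintegral => x _; rewrite cpartD cpart_mul.
Qed.

Definition jform f u x : R[i] := ((f x)^T *m Jmx *m u x) 0 0.

(** The form b. It is used with both fields square-integrable, or with f compactly supported and u
    only locally square-integrable. *)
Definition jpair f u : R[i] := cintegral Omega (jform f u).

Lemma jform_linear (c : R[i]) f u v x : jform f (fun x => c *: u x + v x) x = c * jform f u x + jform f v x.
Proof. by rewrite /jform mulmxDr -scalemxAr !mxE. Qed.

Lemma jform_antisym f u x : jform f u x = - jform u f x.
Proof.
rewrite /jform -[(f x)^T *m Jmx *m u x]trmxK mxE !trmx_mul trmxK JmxT.
by rewrite mulNmx mulmxN mulmxA mxE.
Qed.

Lemma comp_cintegrable f u : L2comp Omega f -> loc_sqint Omega u -> cintegrable (jform f u).
Proof. by move=> Lf lu b; exact: (comp_bform_integrable oO Jmx b Lf lu). Qed.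

Lemma sqint4_cintegrable f u : sqint4 leb3 Omega f -> sqint4 leb3 Omega u -> cintegrable (jform f u).
Proof. by move=> sf su b; exact: (bform_sqint4_integrable oO Jmx b sf su). Qed.

Lemma jpair_linear (c : R[i]) f u v : L2comp Omega f -> loc_sqint Omega u -> loc_sqint Omega v ->
  jpair f (fun x => c *: u x + v x) = c * jpair f u + jpair f v.
Proof.
move=> Lf lu lv; rewrite /jpair -cintegral_linear; try exact: comp_cintegrable.
by congr cintegral; apply/funext => x; exact: jform_linear.
Qed.

Lemma sqint4_jpair_linear (c : R[i]) f u v : sqint4 leb3 Omega f -> sqint4 leb3 Omega u ->
  sqint4 leb3 Omega v -> jpair f (fun x => c *: u x + v x) = c * jpair f u + jpair f v.
Proof.
move=> Lf lu lv; rewrite /jpair -cintegral_linear; try exact: sqint4_cintegrable.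
by congr cintegral; apply/funext => x; exact: jform_linear.
Qed.

Lemma pair0 f : jpair f (fun=> 0) = 0.
Proof.
apply: eq_cpart => b; rewrite cpart_cintegral.
have -> : (fun x => cpart b (jform f (fun=> 0) x)) = fun=> 0.
  by apply/funext => x; rewrite /jform mulmx0 mxE; case: b.
by rewrite Rintegral_cst// mul0r; case: b.
Qed.

Lemma loc_sqint0 : loc_sqint Omega (fun=> 0 : 'cV[R[i]]_4).
Proof. by apply: sqint4_loc => //; exact: sqint4_0. Qed.

Lemma loc_sqint_sum (I : Type) (s : seq I) (c : I -> R[i]) (u : I -> spinor_field R) :
  (forall i, loc_sqint Omega (u i)) -> loc_sqint Omega (fun x => \sum_(i <- s) c i *: u i x).
Proof.
move=> lu; elim: s => [|i s IH]; first by under eq_fun do rewrite big_nil; exact: loc_sqint0.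
by under eq_fun do rewrite big_cons; apply: loc_sqintD => //; exact: loc_sqintZ.
Qed.

Lemma jpair_sum f (I : Type) (s : seq I) (c : I -> R[i]) (u : I -> spinor_field R) :
  L2comp Omega f -> (forall i, loc_sqint Omega (u i)) ->
  jpair f (fun x => \sum_(i <- s) c i *: u i x) = \sum_(i <- s) c i * jpair f (u i).
Proof.
move=> Lf lu; elim: s => [|i s IH].
  by under eq_fun do rewrite big_nil; rewrite big_nil pair0.
under eq_fun do rewrite big_cons.
by rewrite jpair_linear// ?big_cons ?IH//; exact: loc_sqint_sum.
Qed.

Lemma jpair_ae f u v : L2comp Omega f -> loc_sqint Omega u -> loc_sqint Omega v ->
  aeeq Omega u v -> jpair f u = jpair f v.
Proof.
move=> Lf lu lv uv; apply: eq_cpart => b; rewrite [LHS]cpart_cintegral [RHS]cpart_cintegral.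
have E : {ae leb3, forall x, Omega x -> cpart b (jform f u x) = cpart b (jform f v x)}.
  by apply: (ae_imp uv) => x H Ox; rewrite /jform H.
exact (ae_integ mO (comp_cintegrable Lf lu b) (integ_meas (comp_cintegrable Lf lv b)) E).2.
Qed.

Lemma jpair_ael f g u : sqint4 leb3 Omega f -> sqint4 leb3 Omega g -> sqint4 leb3 Omega u ->
  aeeq Omega f g -> jpair f u = jpair g u.
Proof.
move=> sf sg su fg; apply: eq_cpart => b; rewrite [LHS]cpart_cintegral [RHS]cpart_cintegral.
have E : {ae leb3, forall x, Omega x -> cpart b (jform f u x) = cpart b (jform g u x)}.
  by apply: (ae_imp fg) => x H Ox; rewrite /jform H.
exact (ae_integ mO (sqint4_cintegrable sf su b) (integ_meas (sqint4_cintegrable sg su b)) E).2.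
Qed.

Lemma bform_bound M a f u : sqint4 leb3 Omega f -> sqint4 leb3 Omega u ->
  `|Rintegral leb3 Omega (fun x => bform M a (f x) (u x))| <=
  \sum_(p : ('I_4 * bool) * ('I_4 * bool)) `|bcoef M a p.1 p.2| *
    Num.sqrt (sqn leb3 Omega (cmp p.1 f) * sqn leb3 Omega (cmp p.2 u)).
Proof.
move=> sf su; under eq_Rintegral do rewrite bformE.
have i p := integZ mO (bcoef M a p.1 p.2) (sqint_mul mO (sf p.1) (su p.2)).
have [_ ->] := Rintegral_sum mO (index_enum (('I_4 * bool) * ('I_4 * bool))%type) i.
apply: le_trans (ler_norm_sum _ _ _) _; apply: ler_sum => p _.
rewrite RintegralZl//; last exact: (sqint_mul mO (sf p.1) (su p.2)).
by rewrite normrM ler_wpM2l// (cauchy_schwarz mO (sf p.1) (su p.2)).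
Qed.

(** Continuity of b(f, .) for a single seminorm whose cutoff depends on f alone; this is how
    [op_close], with its squared norms, controls scalar errors. *)
Lemma jpair_bound f : L2comp Omega f -> exists (chi : R * R * R -> R) (C : R),
  [/\ test_function setT chi, 0 <= C & forall u (d : R), loc_sqint Omega u -> 0 <= d ->
  (L2normsq leb3 Omega (cutoff chi u) <= d%:E)%E -> modc (jpair f u) <= C * Num.sqrt d].
Proof.
move=> [rho Lf]; have [chi [w [K [tc mw wK wc]]]] := cutoff_weight rho.
pose cf := cutoff w f.
have scf : sqint4 leb3 Omega cf.
  apply: (sqint4_cutoff oO (measurable_funTS mw) _ (L2_in_sqint4 oO Lf)) => x _; exact: wK.
pose C b := \sum_(p : ('I_4 * bool) * ('I_4 * bool)) `|bcoef Jmx b p.1 p.2| *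
    Num.sqrt (sqn leb3 Omega (cmp p.1 cf)).
exists chi, (C false + C true); split=> //.
  by rewrite addr_ge0// sumr_ge0// => p _; rewrite mulr_ge0// sqrtr_ge0.
move=> u d lu d0 Hd; apply: le_trans (modc_le _) _; rewrite mulrDl.
have su := lu chi tc.
have H b : `|cpart b (jpair f u)| <= C b * Num.sqrt d.
  rewrite cpart_cintegral -(comp_bform oO Jmx b Lf lu tc mw wK wc).2.
  apply: le_trans (bform_bound Jmx b scf su) _; rewrite /C mulr_suml; apply: ler_sum => p _.
  rewrite -mulrA ler_wpM2l// sqrtrM ?sqn_ge0// ler_wpM2l ?sqrtr_ge0// ler_wsqrtr//.
  rewrite -lee_fin; apply: le_trans Hd.
  have LU : L2 leb3 Omega (cutoff chi u) by apply/(L2P _ mO) => i b'; exact: (su (i, b')).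
  exact: (sqn_part_le mO p.2.1 p.2.2 LU).
by apply: lerD; [exact: (H false)|exact: (H true)].
Qed.

End Pair.

Section Scalars.
Context {R : realType}.
Variable Omega : set (R * R * R).
Variable sigma : {measure set (space3 R) -> \bar R}.
Hypothesis oO : open Omega.
Let mO : measurable (Omega : set (space3 R)) := open_measurable3 oO.
Implicit Types (f g u v : spinor_field R) (F : R[i] * R[i] -> operator R).

Lemma dom_loc_sqint u : dom_loc Omega sigma u -> loc_sqint Omega u.
Proof. by move=> du chi tc; exact: (dom_sqint4 oO (du chi tc)). Qed.

Lemma L2normsq_ge0 u : (0 <= L2normsq leb3 Omega u)%E.
Proof.
apply: integral_ge0 => x _; rewrite lee_fin normsq_part sumr_ge0// => p _.
exact: sqr_ge0.
Qed.

Lemma L2normsq_le_H1 u : (L2normsq leb3 Omega u <= H1normsq Omega u)%E.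
Proof. by rewrite /H1normsq leeDl// sume_ge0// => j _; exact: L2normsq_ge0. Qed.

Lemma scalar_laurentD (H K : R[i] * R[i] -> R[i]) p N a b :
  scalar_laurent H p N a -> scalar_laurent K p N b ->
  scalar_laurent (fun q => H q + K q) p N (fun k => a k + b k).
Proof.
move=> [e1 [e10 H1]] [e2 [e20 H2]]; exists (Num.min e1 e2); split; first by rewrite lt_min e10.
move=> q sq; rewrite !modc_lt !lt_min => /andP[q1 q2] /andP[q3 q4] qp e e0.
have e'0 : 0 < e / 2 by rewrite divr_gt0.
have [||n1 N1] := H1 q sq _ _ qp _ e'0; try by rewrite modc_lt.
have [||n2 N2] := H2 q sq _ _ qp _ e'0; try by rewrite modc_lt.
exists (maxn n1 n2) => n; rewrite geq_max => /andP[/N1 h1 /N2 h2].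
under eq_bigr do rewrite mulrDr.
rewrite big_split /= opprD addrACA [leRHS](splitr e).
by apply: le_trans (modcD _ _) _; rewrite lerD.
Qed.

Lemma laurent_scalar F p N (A : nat -> operator R) f g : L2comp Omega f -> L2comp Omega g ->
  laurent Omega sigma F p N A ->
  scalar_laurent (fun q => jpair Omega f (F q g)) p N (fun k => jpair Omega f (A k g)).
Proof.
move=> Lf Lg [cA [eps [eps0 HF]]]; exists eps; split=> // q sq q1 q2 qp e e0.
have [cF Hop] := HF q sq q1 q2 qp.
have [chi [C [tc C0 HC]]] := jpair_bound oO Lf; have [rho Lrho] := Lg.
have lA k : loc_sqint Omega (A k g) by have [_ d _] := cA k; apply: dom_loc_sqint; exact: d.
have lF : loc_sqint Omega (F q g) by have [_ d _] := cF; apply: dom_loc_sqint; exact: d.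
have gfin : (L2normsq leb3 Omega g)%E \is a fin_num.
  by rewrite ge0_fin_numE ?L2normsq_ge0//; have [[]] := Lrho.
pose G := fine (L2normsq leb3 Omega g).
have G0 : 0 <= G by rewrite fine_ge0// L2normsq_ge0.
(* Seminorms are squared: this choice gives C sqrt(e2 G) <= C e / (C + 1) <= e, the added ones
   avoiding division by 0. *)
pose e2 := (e / (C + 1)) ^+ 2 / (G + 1).
have C1 : 0 < C + 1 by rewrite ltr_wpDl.
have G1 : 0 < G + 1 by rewrite ltr_wpDl.
have e20 : 0 < e2 by rewrite divr_gt0// exprn_gt0// divr_gt0.
have [n0 Hn0] := Hop rho chi tc e2 e20; exists n0 => n nn0.
set t := local_coord p q; set L := laurent_sum A N n t.
have lL : loc_sqint Omega (L g) by exact: loc_sqint_sum.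
have -> : jpair Omega f (F q g) - \sum_(k < n) t ^+ k / t ^+ N * jpair Omega f (A k g) =
    jpair Omega f (fun x => F q g x - L g x).
  rewrite -(jpair_sum oO (index_enum _) (fun k : 'I_n => t ^+ k / t ^+ N) Lf (fun k : 'I_n => lA k)).
  have -> : (fun x => F q g x - L g x) = fun x => (-1) *: L g x + F q g x.
    by apply/funext => x; rewrite scaleN1r addrC.
  by rewrite jpair_linear// mulN1r addrC.
have lFL : loc_sqint Omega (fun x => F q g x - L g x).
  have -> : (fun x => F q g x - L g x) = fun x => F q g x + (-1) *: L g x.
    by apply/funext => x; rewrite scaleN1r.
  by apply: loc_sqintD => //; exact: loc_sqintZ.
apply: le_trans (HC _ (e2 * G) lFL _ _) _; first by rewrite mulr_ge0// ltW.
  apply: le_trans (L2normsq_le_H1 _) _; apply: le_trans (Hn0 n nn0 g Lrho) _.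
  by rewrite -(fineK gfin) -EFinM.
apply: (@le_trans _ _ (C * (e / (C + 1)))).
  have x0 : 0 <= e / (C + 1) by rewrite divr_ge0 ?ltW.
  have -> : e / (C + 1) = Num.sqrt ((e / (C + 1)) ^+ 2) by rewrite sqrtr_sqr ger0_norm.
  apply: ler_wpM2l => //; apply: ler_wsqrtr.
  by rewrite /e2 mulrAC ler_pdivrMr// ler_wpM2l ?sqr_ge0// lerDl.
by rewrite mulrA ler_pdivrMr// mulrC ler_wpM2l ?lerDl// ltW.
Qed.

End Scalars.

(** * Skewness of the resolvent and parity of the rank *)

Lemma skew_even (F : numFieldType) m (M : 'M[F]_m) : M^T = - M ->
  (forall c : 'cV[F]_m, M *m c = 0 -> c = 0) -> ~~ odd m.
Proof.
move=> MT inj; apply/negP => om.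
have : \det M = 0.
  have E : \det M = - \det M.
    by rewrite -{1}det_tr MT -scaleN1r detZ -signr_odd om expr1 mulN1r.
  have : \det M *+ 2 = 0 by rewrite mulr2n {1}E addNr.
  by move/eqP; rewrite mulrn_eq0 => /eqP.
move/eqP/det0P => [v v0 vM]; move/negP: v0; apply.
(* A zero determinant provides a left null vector; skewness makes its transpose a right one. *)
have /inj/(congr1 trmx) : M *m v^T = 0.
  by apply: (can_inj (@trmxK _ _ _)); rewrite trmx_mul trmxK MT mulmxN vM oppr0 trmx0.
by rewrite trmxK trmx0 => ->.
Qed.

Section Skew.
Context {R : realType}.
Variable Omega : set (R * R * R).
Variable sigma : {measure set (space3 R) -> \bar R}.
Hypothesis C2O : C2_domain Omega.
Hypothesis surf : surface_measure Omega sigma.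
Let oO : open Omega. Proof. by case: C2O. Qed.
Let mO : measurable (Omega : set (space3 R)) := open_measurable3 oO.
Implicit Types (f g u v : spinor_field R).

Lemma jpair_antisym f u : sqint4 leb3 Omega f -> sqint4 leb3 Omega u ->
  jpair Omega f u = - jpair Omega u f.
Proof.
move=> sf su; rewrite -mulN1r -[RHS]addr0.
have i0 : cintegrable Omega (fun=> 0).
  by case; exact: (integ0 leb3 Omega).
have E0 : cintegral Omega (fun=> 0) = 0 :> R[i].
  by apply: eq_cpart => b; rewrite cpart_cintegral; case: b; rewrite Rintegral_cst// mul0r.
rewrite -[in RHS]E0 /jpair -(cintegral_linear oO (-1) (sqint4_cintegrable oO su sf) i0).
by congr cintegral; apply/funext => x; rewrite addr0 mulN1r jform_antisym.
Qed.

(** With u = T f and v = T g one has f = (D - z) u and g = (D - z) v. The terms z b(u, v) and z b(v,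
    u) cancel because b is skew, and b(Du, v) - b(u, Dv) = 0 remains. *)
Lemma resolvent_skew z T f g : resolvent Omega sigma z T -> L2comp Omega f -> L2comp Omega g ->
  jpair Omega f (T g) + jpair Omega g (T f) = 0.
Proof.
move=> [_ _ HT _] [rf Lf] [rg Lg].
have [du eu] := HT _ Lf.1; have [dv ev] := HT _ Lg.1.
move: (T f) (T g) du eu dv ev => u v du eu dv ev.
have su := dom_sqint4 oO du; have sv := dom_sqint4 oO dv.
have sDu := dirac_sqint4 C2O du; have sDv := dirac_sqint4 C2O dv.
have sf := L2_in_sqint4 oO Lf; have sg := L2_in_sqint4 oO Lg.
have key a b w : sqint4 leb3 Omega a -> sqint4 leb3 Omega b -> sqint4 leb3 Omega w ->
    sqint4 leb3 Omega (dirac Omega b) ->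
    aeeq Omega (fun x => dirac Omega b x - z *: b x) a ->
    jpair Omega a w = z * jpair Omega w b + jpair Omega (dirac Omega b) w.
  move=> sa sb sw sD e.
  have E : (fun x => dirac Omega b x - z *: b x) = fun x => (- z) *: b x + dirac Omega b x.
    by apply/funext => x; rewrite scaleNr addrC.
  rewrite E in e.
  have sE : sqint4 leb3 Omega (fun x => (- z) *: b x + dirac Omega b x).
    apply: (sqint4D mO) sD; have := sqint4_mulmx mO (- z)%:M sb.
    by congr sqint4; apply/funext => x; rewrite mul_scalar_mx.
  rewrite -(jpair_ael oO sE sa sw e) (jpair_antisym sE sw) (sqint4_jpair_linear oO _ sw sb sD).
  by rewrite (jpair_antisym sD sw) mulNr opprD opprK.
have sym : jpair Omega (dirac Omega u) v = jpair Omega u (dirac Omega v).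
  apply: eq_cpart => b; rewrite [LHS]cpart_cintegral [RHS]cpart_cintegral.
  exact: (dirac_symmetric C2O surf b du dv).
have k1 := key f u v sf su sv sDu eu; have k2 := key g v u sg sv su sDv ev.
have a1 := jpair_antisym sv su; have a2 := jpair_antisym sDv su.
have aux (p1 p2 q1 q2 r1 r2 r : R[i]) : p1 = z * q1 + r1 -> p2 = z * q2 + r2 -> q1 = - q2 ->
    r2 = - r -> r1 = r -> p1 + p2 = 0 by move=> -> -> -> -> ->; ring.
exact (aux _ _ _ _ _ _ _ k1 k2 a1 a2 sym).
Qed.

Definition conjv (y : 'cV[R[i]]_4) : 'cV[R[i]]_4 := map_mx (fun c : R[i] => c^*%C) y.

Lemma conjv_mul (y : 'cV[R[i]]_4) : ((conjv y)^T *m y) 0 0 = (normsq y)%:C.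
Proof.
rewrite mxE /normsq rmorph_sum; apply: eq_bigr => i _; rewrite !mxE.
by case: (y i 0) => p q; apply/eqP; rewrite eq_complex /=; apply/andP; split; apply/eqP; ring.
Qed.

(** Take g = chi J c with c the complex conjugate of chi u: since J^T J = 1, the integrand g^T J u
    is the squared norm of chi u. Letting the cutoff grow covers all of Omega. *)
Lemma jpair_nondegenerate u : loc_sqint Omega u ->
  (forall g, L2comp Omega g -> jpair Omega g u = 0) -> aeeq Omega u (fun=> 0).
Proof.
move=> lu Hu.
pose chi n := cbump (0 : R * R * R) n.+1%:R 0.
have tchi n : test_function setT (chi n) by exact: test_cbumpT.
have H n : {ae leb3, forall x, Omega x -> cutoff (chi n) u x = 0}.
  pose y := cutoff (chi n) u.
  have sy : sqint4 leb3 Omega y := lu _ (tchi n).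
  pose c x : 'cV[R[i]]_4 := conjv (y x).
  have sc : sqint4 leb3 Omega c.
    move=> p; have := sqintZ mO ((-1) ^+ p.2) (sy p); congr sqint; apply/funext => x.
    rewrite /cmp /c /conjv [X in _ = cpart _ X]mxE; case: p => i b; rewrite -[(i, b).1]/i -[(i, b).2]/b.
    by move: (y x i 0) => [a1 a2]; case: b; rewrite /= ?expr1 ?expr0 ?mulN1r ?mul1r.
  pose g := cutoff (chi n) (fun x => Jmx *m c x).
  have sg : sqint4 leb3 Omega g := sqint4_loc oO (sqint4_mulmx mO Jmx sc) (tchi n).
  have Lg : L2comp Omega g.
    exists n.+1%:R; split; first by apply/(L2P _ mO) => i b; exact: (sg (i, b)).
    apply: aeW => x _ nb; rewrite /g /cutoff /chi cbump_out ?scale0r// cube_ball.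
    exact: nb.
  have E x : jform g u x = (normsq (y x))%:C.
    rewrite /jform -conjv_mul -/(c x) /g /y /cutoff.
    have tr (k : R) (z : 'cV[R[i]]_4) : (k%:C *: (Jmx *m z))^T = k%:C *: (z^T *m - Jmx).
      by apply/matrixP => i j; rewrite -JmxT -trmx_mul !mxE.
    rewrite tr -!scalemxAl -scalemxAr -[_ *m - Jmx *m Jmx]mulmxA mulNmx Jmx_sqr opprK mulmx1.
    by [].
  have Z := congr1 (cpart false) (Hu g Lg).
  have {}Z : Rintegral leb3 Omega (fun x => normsq (y x)) = 0.
    by move: Z; rewrite cpart_cintegral (_ : (fun x => _) = fun x => normsq (y x)); last by apply/funext => x; rewrite E.
  have LY : L2 leb3 Omega y by apply/(L2P _ mO) => i b; exact: (sy (i, b)).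
  have Z2 : L2normsq leb3 Omega y = 0%E.
    by move: Z; rewrite /Rintegral -/(L2normsq leb3 Omega y) L2normsqE//= => ->.
  have mn : measurable_fun (Omega : set (space3 R)) (fun x => (normsq (y x))%:E).
    apply/measurable_EFinP; under eq_fun do rewrite normsq_part.
    by apply: measurable_sum => p; apply: measurable_funX; have [] := sy p.
  have n0 x : 0 <= normsq (y x).
    by rewrite normsq_part sumr_ge0// => p _; exact: sqr_ge0.
  have /(ae_eq_integral_abs leb3 mO mn) : (\int[leb3]_(x in Omega) `|(normsq (y x))%:E| = 0)%E.
    by rewrite -[RHS]Z2; apply: eq_integral => x _; rewrite gee0_abs// lee_fin.
  move=> A; apply: (ae_imp A) => x /[apply] -[]; rewrite -/(y x) => nx.
  apply: (eq_part (g := fun=> 0)) => i b; rewrite /part [X in _ = cpart b X]mxE.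
  have -> : cpart b 0 = 0 :> R by case: b.
  apply/eqP; rewrite -sqrf_eq0; apply/eqP/le_anti; rewrite sqr_ge0 andbT -nx normsq_part.
  by rewrite (bigD1 (i, b))//= lerDl sumr_ge0// => p _; exact: sqr_ge0.
apply: (ae_imp (ae_foralln H)) => x Hx Ox.
(* For this N the cutoff [chi N] is positive at x, so it can be divided out. *)
pose N := \max_(j < 3) (Num.truncn `|coord3 j x|).+1.
have cx : cube 0 N%:R x.
  apply/cube_coord => j; rewrite (_ : coord3 j 0 = 0); last by rewrite /coord3; case: (val j) => [|[|]].
  rewrite subr0; apply: (@lt_le_trans _ _ (Num.truncn `|coord3 j x|).+1%:R); first exact: truncnS_gt.
  by rewrite ler_nat; exact: (leq_bigmax j).
have [|m m0 Hm] := @cbump_lower R 0 N%:R N.+1%:R 0; first by rewrite ltr_nat.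
have := Hx N Ox; rewrite /cutoff => /eqP; rewrite scaler_eq0 => /orP[|/eqP//].
by rewrite -modc_eq0 modc_real normr_eq0 gt_eqF// (lt_le_trans m0)// Hm.
Qed.

End Skew.

Section Resonances.
Context {R : realType}.
Variable Omega : set (R * R * R).
Variable sigma : {measure set (space3 R) -> \bar R}.
Hypothesis C2O : C2_domain Omega.
Hypothesis surf : surface_measure Omega sigma.
Let oO : open Omega. Proof. by case: C2O. Qed.
Variable F : R[i] * R[i] -> operator R.
Hypothesis F_cont : resolvent_continuation Omega sigma F.
Implicit Types (f g u v : spinor_field R) (A : nat -> operator R).

Lemma continuous_loc_sqint (B : operator R) f : continuous_operator Omega sigma B ->
  L2comp Omega f -> loc_sqint Omega (B f).
Proof. by move=> [_ dB _] Lf; apply: (dom_loc_sqint oO); exact: dB. Qed.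

(** Here F agrees almost everywhere with a resolvent, and b does not see null sets. *)
Lemma continuation_skew q f g : surfM q -> 0 < complex.Im q.2 -> L2comp Omega f -> L2comp Omega g ->
  jpair Omega f (F q g) + jpair Omega g (F q f) = 0.
Proof.
case: q => z w sq q0 Lf Lg; have [_ /(_ z w sq q0)[[A [cA [eps [e0 HF]]]] _ [T [rT FT]]]] := F_cont.
have [cF _] : continuous_operator Omega sigma (F (z, w)) /\ True.
  by have [] := HF (z, w) sq; rewrite ?subrr ?normr0 ?ltcR.
have lT h : L2comp Omega h -> loc_sqint Omega (T h).
  move=> [rho [Lh _]]; have [_ _ /(_ _ Lh)[dT _] _] := rT.
  exact: (sqint4_loc oO (dom_sqint4 oO dT)).
rewrite (jpair_ae oO Lf (continuous_loc_sqint cF Lg) (lT _ Lg) (FT _ Lg)).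
rewrite (jpair_ae oO Lg (continuous_loc_sqint cF Lf) (lT _ Lf) (FT _ Lf)).
exact: (resolvent_skew C2O surf rT Lf Lg).
Qed.

Lemma laurent_skew p N A f g : surfM p -> (~ exists t : R, t <= 0 /\ p.2 = 0 +i* t) ->
  laurent Omega sigma F p N A -> L2comp Omega f -> L2comp Omega g ->
  forall k, jpair Omega f (A k g) + jpair Omega g (A k f) = 0.
Proof.
move=> sp out L Lf Lg.
pose H q := jpair Omega f (F q g) + jpair Omega g (F q f).
have sl p' N' A' : laurent Omega sigma F p' N' A' ->
    scalar_laurent H p' N' (fun k => jpair Omega f (A' k g) + jpair Omega g (A' k f)).
  by move=> L'; apply: scalar_laurentD; exact: (laurent_scalar oO _ _ L').
apply: (laurent_coef_eq0 sp _ _ out (sl _ _ _ L)).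
- move=> p' sp'; have [fm _] := F_cont; have [N' [A' [L' _]]] := fm p' sp'.
  by exists N'; eexists; exact: sl L'.
- by move=> q sq q0; exact: continuation_skew.
Qed.

(** Let B f_1, ..., B f_m be a basis of the range and M_ij = b(f_i, B f_j). If M c = 0, then h =
    \sum_j c_j B f_j is orthogonal to each f_i. For any g, skewness moves B onto g, the span
    property expands B g in the basis, and skewness moves B back, so b(g, h) is a combination of the
    b(f_i, h). Hence h = 0 and c = 0. *)
Lemma skew_rank_even (B : operator R) m : continuous_operator Omega sigma B ->
  (forall f g, L2comp Omega f -> L2comp Omega g ->
     jpair Omega f (B g) + jpair Omega g (B f) = 0) ->
  has_rank Omega B m -> ~~ odd m.
Proof.
move=> cB skew [f [Lf free span]].
have lB g : L2comp Omega g -> loc_sqint Omega (B g) := continuous_loc_sqint cB.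
pose M := \matrix_(i < m, j < m) jpair Omega (f i) (B (f j)).
apply: (@skew_even _ _ M).
  by apply/matrixP => i j; rewrite !mxE; apply/eqP; rewrite -addr_eq0 skew.
move=> c Mc; pose h x := \sum_(j < m) c j 0 *: B (f j) x.
have lh : loc_sqint Omega h by apply: loc_sqint_sum => // j; exact: lB.
have ph i : jpair Omega (f i) h = 0.
  rewrite (jpair_sum oO)// => [|j]; last exact: lB.
  have := congr1 (fun X : 'cV_m => X i 0) Mc; rewrite !mxE => Z; rewrite -[RHS]Z.
  by apply: eq_bigr => j _; rewrite mxE mulrC.
have h0 : aeeq Omega h (fun=> 0).
  apply: (jpair_nondegenerate C2O lh) => g Lg.
  rewrite (jpair_sum oO)// => [|j]; last exact: lB.
  have [d dE] := span g Lg.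
  have ld : loc_sqint Omega (fun x => \sum_(i < m) d i *: B (f i) x).
    by apply: loc_sqint_sum => // j; exact: lB.
  have pg j : jpair Omega g (B (f j)) = - \sum_(i < m) d i * jpair Omega (f j) (B (f i)).
    rewrite -(jpair_sum oO) // => [|i]; last exact: lB.
    rewrite -(jpair_ae oO (Lf j) (lB _ Lg) ld dE).
    by apply/eqP; rewrite -addr_eq0 skew.
  under eq_bigr do rewrite pg mulrN mulr_sumr.
  rewrite sumrN exchange_big /= big1 ?oppr0// => i _.
  under eq_bigr do rewrite mulrCA.
  rewrite -mulr_sumr (_ : \sum_j _ = 0) ?mulr0//.
  have S j : jpair Omega (f j) (B (f i)) = - jpair Omega (f i) (B (f j)).
    by apply/eqP; rewrite -addr_eq0 skew.
  under eq_bigr do rewrite S mulrN.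
  by rewrite sumrN -(jpair_sum oO) ?ph ?oppr0// => j; exact: lB.
apply/matrixP => i j; rewrite (ord1 j) mxE; exact: (free (fun i => c i 0) h0 i).
Qed.

(** The expansion witnessing the pole need not be the one whose principal part is known to have
    finite rank; if the latter had no principal part, [laurent_unique0] and nondegeneracy would make
    the leading coefficient of the former zero. *)
Lemma multiplicity_exists p : pole Omega sigma F p -> exists m, multiplicity Omega sigma F p m.
Proof.
move=> [sp [N [A [L nz]]]]; have [fm _] := F_cont.
have [[|N'] [A' [L' hr]]] := fm p sp; last first.
  by have [m hm] := hr N' (ltnSn N'); exists m, N', A'.
exfalso; apply: nz => f Lf; have [cA _] := L.
apply: (jpair_nondegenerate C2O (continuous_loc_sqint (cA 0%N) Lf)) => g Lg.
exact: (laurent_unique0 sp (laurent_scalar oO Lg Lf L') (laurent_scalar oO Lg Lf L)).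
Qed.

End Resonances.

Theorem corollary4p1 (R : realType) (Omega : set (R * R * R))
  (Omega_C2 : C2_domain Omega)
  (Omega_ext : bounded_set (~` Omega))
  (sigma : {measure set (space3 R) -> \bar R})
  (sigma_surf : surface_measure Omega sigma)
  (F : R[i] * R[i] -> operator R)
  (F_cont : resolvent_continuation Omega sigma F)
  (lambda kappa : R[i])
  (res : pole Omega sigma F (lambda, kappa))
  (kappa_out : ~ exists t : R, t <= 0 /\ kappa = 0 +i* t) :
  (exists m, multiplicity Omega sigma F (lambda, kappa) m) /\
  (forall m, multiplicity Omega sigma F (lambda, kappa) m -> ~~ odd m).
Proof.
split; first exact: (multiplicity_exists Omega_C2 F_cont res).
move=> m [N [A [L rk]]]; have [sp _] := res; have [cA _] := L.
apply: (skew_rank_even Omega_C2 (cA N)) rk => f g Lf Lg.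
exact: (laurent_skew Omega_C2 sigma_surf F_cont sp kappa_out L Lf Lg).
Qed.
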